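(* Let $v_1,v_2\in\mathbf{C}[h]$ be nonzero polynomials. The classical generalized Weyl algebras $T(v_1)$ and $T(v_2)$ are strongly graded Morita equivalent if and only if there is some $b\in\mathbf{C}$ such that the polynomials $v_1(h+b)$ and $v_2(h)$ have the same type.
   Context: **Classical GWA.** For $v\in\mathbf{C}[h]$, let $\tau$ be the automorphism of $\mathbf{C}[h]$ with $\tau(p(h))=p(h+1)$. $T(v)$ is the $\mathbf{C}$-algebra generated by $\mathbf{C}[h]$, $t_+$, $t_-$ subject to $$r t_+=t_+\tau(r),\quad \tau(r)t_-=t_-r,\quad t_-t_+=\tau(v),\quad t_+t_-=v\qquad(r\in\mathbf{C}[h]).$$ It is $\mathbf{Z}$-graded with $\deg t_+=1$, $\deg t_-=-1$, $\deg r=0$ for $r\in\mathbf{C}[h]$. **Strongly graded Morita equivalence.** For a graded ring $A$, let $A\text{-}\mathrm{grMod}$ be the category of $\mathbf{Z}$-graded left $A$-modules with degree-preserving module homomorphisms, with shift $M[n]_i=M_{i+n}$. Graded algebras $A$ and $B$ are strongly graded Morita equivalent if there is a $\mathbf{C}$-linear equivalence of categories $F:B\text{-}\mathrm{grMod}\to A\text{-}\mathrm{grMod}$ such that $F(M[1])\cong F(M)[1]$ for every graded $B$-module $M$. **Type.** Let $\mathbf{Z}^f[h]$ be the set of polynomials of the form $\prod_i(h-n_i)$ with $n_i\in\mathbf{Z}$ (finite products). For $u(h)=\prod_{i=1}^n(h-u_i)^{d_i}$ and $v(h)=\prod_{i=1}^m(h-v_i)^{e_i}$ in $\mathbf{Z}^f[h]$,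 with $u_1<\dots<u_n$, $v_1<\dots<v_m$ integers and all $d_i,e_i\ge 1$, write $u\sim v$ if $n=m$ and $d_i=e_i$ for all $i$. Let $q:\mathbf{C}\to\mathbf{C}/\mathbf{Z}$ be the quotient map. For nonzero $u,v\in\mathbf{C}[h]$, write, up to nonzero scalar factors, $v(h)=\prod_i v_i(h-a_i)$ and $u(h)=\prod_j u_j(h-b_j)$ with $v_i,u_j\in\mathbf{Z}^f[h]$ nonconstant, such that the $a_i$ are pairwise distinct modulo $\mathbf{Z}$ and the $b_j$ are pairwise distinct modulo $\mathbf{Z}$. Then $u$ and $v$ have the same type if there is a bijection $i\mapsto j(i)$ between the index sets with $q(a_i)=q(b_{j(i)})$ and $v_i\sim u_{j(i)}$ for all $i$. (Equivalently: the same classes of roots modulo $\mathbf{Z}$ occur, and within each class, ordered naturally, the multiplicities occur in the same order.) *)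

(* Defs.v *)
From HB Require Import structures.
From mathcomp Require Import all_boot all_order all_algebra.
From mathcomp Require Import boolp classical_sets.

Set Implicit Arguments.
Unset Strict Implicit.
Unset Printing Implicit Defensive.

Import GRing.Theory Num.Theory.

Local Open Scope ring_scope.
Local Open Scope classical_set_scope.
Local Open Scope quotient_scope.

(* The family g is a family of subgroups of V with V = \bigoplus_i g i. *)
Record is_grading (V : zmodType) (g : int -> set V) : Prop := IsGrading {
  grading0 : forall i, g i 0;
  gradingB : forall i x y, g i x -> g i y -> g i (x - y);
  grading_span : forall x, exists s : seq V,
    (forall y, y \in s -> exists i, g i y) /\ x = \sum_(y <- s) y;
  grading_indep : forall (s : seq int) (f : int -> V),
    uniq s -> (forall i, g i (f i)) -> \sum_(i <- s) f i = 0 ->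
    forall i, i \in s -> f i = 0
}.

Record gralg (K : comNzRingType) := GrAlg {
  gralg_sort :> algType K;
  gralg_comp : int -> set gralg_sort;
  gralg_grading : is_grading gralg_comp;
  gralg_scale : forall i (c : K) a, gralg_comp i a -> gralg_comp i (c *: a);
  gralg_one : gralg_comp 0 1;
  gralg_mul : forall i j a b,
    gralg_comp i a -> gralg_comp j b -> gralg_comp (i + j) (a * b)
}.

Section GradedModules.
Variables (K : comNzRingType) (A : gralg K).

Record grmodule := GrModule {
  grmod_sort :> lmodType A;
  grmod_comp : int -> set grmod_sort;
  grmod_grading : is_grading grmod_comp;
  grmod_act : forall i j (a : A) x,
    gralg_comp i a -> grmod_comp j x -> grmod_comp (i + j) (a *: x)
}.

Section Shift.
Variables (n : int) (M : grmodule).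

Definition shift_comp (i : int) : set M := grmod_comp (i + n).

Lemma shift_grading : is_grading shift_comp.
Proof.
have [g0 gB gS gI] := grmod_grading M.
split=> [i|i x y|x|s f us fg s0 i is_]; first exact: g0.
- exact: gB.
- have [s [sg ->]] := gS x; exists s; split=> // y /sg [i yi].
  by exists (i - n); rewrite /shift_comp subrK.
- have -> : f i = f ((i + n) - n) by rewrite addrK.
  apply: (gI (map (fun k => k + n) s) (fun k => f (k - n))).
  + by rewrite map_inj_uniq //; apply: addIr.
  + by move=> k; have := fg (k - n); rewrite /shift_comp subrK.
  + by rewrite big_map -[RHS]s0; apply: eq_bigr => k _; rewrite addrK.
  + exact: map_f.
Qed.

Lemma shift_act i j (a : A) (x : M) :
  gralg_comp i a -> shift_comp j x -> shift_comp (i + j) (a *: x).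
Proof. by rewrite /shift_comp -addrA; apply: grmod_act. Qed.

Definition shift : grmodule := GrModule shift_grading shift_act.
End Shift.

Section Homs.
Variables M N : grmodule.

Record grhom := GrHom {
  grhom_fun :> {linear M -> N};
  grhom_deg : forall i x, grmod_comp i x -> grmod_comp i (grhom_fun x)
}.

Lemma grhom_ext (f g : grhom) : (forall x, f x = g x) -> f = g.
Proof.
case: f g => [f fd] [g gd] /= fg.
have {}fg : f = g.
  case: f g fg {fd gd} => [f [[f1] [f2]]] [g [[g1] [g2]]] /= /funext fg.
  have {}fg : f = g by [].
  subst g.
  by rewrite (Prop_irrelevance f1 g1) (Prop_irrelevance f2 g2).
by subst g; congr GrHom; exact: Prop_irrelevance.
Qed.

HB.instance Definition _ := gen_eqMixin grhom.
HB.instance Definition _ := gen_choiceMixin grhom.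

Lemma grmod0 i : grmod_comp i (0 : N).
Proof. exact: grading0 (grmod_grading N) i. Qed.
Lemma grmodN i (x : N) : grmod_comp i x -> grmod_comp i (- x).
Proof.
by move=> xi; rewrite -sub0r; apply: (gradingB (grmod_grading N)) => //; exact: grmod0.
Qed.
Lemma grmodD i (x y : N) :
  grmod_comp i x -> grmod_comp i y -> grmod_comp i (x + y).
Proof.
move=> xi yi; rewrite -[y]opprK.
by apply: (gradingB (grmod_grading N)) => //; exact: grmodN.
Qed.
Lemma grmodZ i (c : K) (x : N) :
  grmod_comp i x -> grmod_comp i ((c%:A : A) *: x).
Proof.
move=> xi; rewrite -[i]add0r; apply: grmod_act => //.
by apply: gralg_scale; exact: gralg_one.
Qed.

Lemma grhom0_deg i (x : M) : grmod_comp i x -> grmod_comp i (\0%R x : N).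
Proof. by move=> _; exact: grmod0. Qed.
Lemma grhomN_deg (f : grhom) i (x : M) :
  grmod_comp i x -> grmod_comp i ((\- f) x : N).
Proof. by move=> xi; apply: grmodN; exact: grhom_deg. Qed.
Lemma grhomD_deg (f g : grhom) i (x : M) :
  grmod_comp i x -> grmod_comp i ((f \+ g) x : N).
Proof. by move=> xi; apply: grmodD; exact: grhom_deg. Qed.

Definition grhom0 := GrHom grhom0_deg.
Definition grhomN (f : grhom) := GrHom (@grhomN_deg f).
Definition grhomD (f g : grhom) := GrHom (@grhomD_deg f g).

(* Scalars act through the structure map c |-> c%:A of the algebra; the result
   is A-linear because c%:A is central. *)
Definition scale_fun (c : K) (f : grhom) (x : M) : N := (c%:A : A) *: f x.

Lemma scale_fun_linear c f : linear (scale_fun c f).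
Proof.
move=> a x y; rewrite /scale_fun linearP scalerDr !scalerA; congr (_ *: _ + _).
by rewrite -scalerAr mulr1 -scalerAl mul1r.
Qed.
HB.instance Definition _ c f :=
  GRing.isLinear.Build A M N *:%R (scale_fun c f) (scale_fun_linear c f).

Lemma grhomZ_deg c (f : grhom) i (x : M) :
  grmod_comp i x -> grmod_comp i (scale_fun c f x).
Proof. by move=> xi; apply: grmodZ; exact: grhom_deg. Qed.
Definition grhomZ (c : K) (f : grhom) := GrHom (@grhomZ_deg c f).

Fact grhomDA : associative grhomD.
Proof. by move=> f g h; apply: grhom_ext => x /=; rewrite addrA. Qed.
Fact grhomDC : commutative grhomD.
Proof. by move=> f g; apply: grhom_ext => x /=; rewrite addrC. Qed.
Fact grhom0D : left_id grhom0 grhomD.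
Proof. by move=> f; apply: grhom_ext => x /=; rewrite add0r. Qed.
Fact grhomND : left_inverse grhom0 grhomN grhomD.
Proof. by move=> f; apply: grhom_ext => x /=; rewrite addNr. Qed.
HB.instance Definition _ :=
  GRing.isZmodule.Build grhom grhomDA grhomDC grhom0D grhomND.

Fact grhomZA a b f : grhomZ a (grhomZ b f) = grhomZ (a * b) f.
Proof.
apply: grhom_ext => x /=; rewrite /scale_fun /= /scale_fun scalerA.
by rewrite -scalerAl mul1r scalerA.
Qed.
Fact grhom1Z : left_id 1 grhomZ.
Proof. by move=> f; apply: grhom_ext => x /=; rewrite /scale_fun !scale1r. Qed.
Fact grhomZDr : right_distributive grhomZ +%R.
Proof. by move=> a f g; apply: grhom_ext => x /=; rewrite /scale_fun scalerDr. Qed.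
Fact grhomZDl f : {morph grhomZ^~ f : a b / a + b}.
Proof. by move=> a b; apply: grhom_ext => x /=; rewrite /scale_fun !scalerDl. Qed.
HB.instance Definition _ :=
  GRing.Zmodule_isLmodule.Build K grhom grhomZA grhom1Z grhomZDr grhomZDl.
End Homs.

Lemma grhom_id_deg (M : grmodule) i (x : M) :
  grmod_comp i x -> grmod_comp i (idfun x).
Proof. by []. Qed.
Definition grhom_id (M : grmodule) : grhom M M := GrHom (@grhom_id_deg M).

Lemma grhom_comp_deg (L M N : grmodule) (g : grhom M N) (f : grhom L M) i x :
  grmod_comp i x -> grmod_comp i ((g \o f) x).
Proof. by move=> xi; do 2!apply: grhom_deg. Qed.
Definition grhom_comp (L M N : grmodule) (g : grhom M N) (f : grhom L M) :
  grhom L N := GrHom (@grhom_comp_deg L M N g f).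
End GradedModules.

Record category := Category {
  obj :> Type;
  hom : obj -> obj -> Type;
  idm : forall X, hom X X;
  comp : forall X Y Z, hom Y Z -> hom X Y -> hom X Z;
  comp_idl : forall X Y (f : hom X Y), comp (idm Y) f = f;
  comp_idr : forall X Y (f : hom X Y), comp f (idm X) = f;
  compA : forall X Y Z W (h : hom Z W) (g : hom Y Z) (f : hom X Y),
    comp h (comp g f) = comp (comp h g) f
}.

Definition is_iso (C : category) (X Y : C) (f : hom X Y) :=
  exists g : hom Y X, comp g f = idm X /\ comp f g = idm Y.

Definition isomorphic (C : category) (X Y : C) :=
  exists f : hom X Y, is_iso f.

Record functor (C D : category) := Functor {
  fobj :> C -> D;
  fmap : forall X Y, hom X Y -> hom (fobj X) (fobj Y);
  fmap_id : forall X, fmap (idm X) = idm (fobj X);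
  fmap_comp : forall X Y Z (g : hom Y Z) (f : hom X Y),
    fmap (comp g f) = comp (fmap g) (fmap f)
}.

Definition functor_id (C : category) : functor C C :=
  @Functor C C id (fun _ _ => id) (fun _ => erefl) (fun _ _ _ _ _ => erefl).

Section FunctorComp.
Variables (C D E : category) (G : functor D E) (F : functor C D).
Lemma fcomp_id X : fmap G (fmap F (idm X)) = idm (G (F X)).
Proof. by rewrite !fmap_id. Qed.
Lemma fcomp_comp X Y Z (g : hom Y Z) (f : hom X Y) :
  fmap G (fmap F (comp g f)) = comp (fmap G (fmap F g)) (fmap G (fmap F f)).
Proof. by rewrite !fmap_comp. Qed.
Definition functor_comp : functor C E :=
  @Functor C E (fun X => G (F X)) (fun X Y f => fmap G (fmap F f))
    fcomp_id fcomp_comp.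
End FunctorComp.

Definition naturally_isomorphic (C D : category) (F G : functor C D) :=
  exists eta : forall X, hom (F X) (G X),
    (forall X, is_iso (eta X)) /\
    (forall X Y (f : hom X Y), comp (eta Y) (fmap F f) = comp (fmap G f) (eta X)).

Definition is_equivalence (C D : category) (F : functor C D) :=
  exists G : functor D C,
    naturally_isomorphic (functor_comp G F) (functor_id C) /\
    naturally_isomorphic (functor_comp F G) (functor_id D).

Section Morita.
Variable K : comNzRingType.

Definition grMod (A : gralg K) : category.
Proof.
by refine (@Category (grmodule A) (@grhom K A) (@grhom_id K A) (@grhom_comp K A)
  _ _ _) => *; apply: grhom_ext.
Defined.

Definition klinear (A B : gralg K) (F : functor (grMod B) (grMod A)) :=
  forall M N : grmodule B,
    linear (@fmap _ _ F M N : grhom M N -> grhom (F M) (F N)).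

Definition strongly_graded_Morita_equivalent (A B : gralg K) :=
  exists F : functor (grMod B) (grMod A),
    [/\ is_equivalence F, klinear F &
        forall M : grMod B, isomorphic (F (shift 1 M)) (shift 1 (F M))].
End Morita.

Section GWA.
Variables (K : numFieldType) (v : {poly K}).

Definition tau (p : {poly K}) : {poly K} := p \Po ('X + 1).

Inductive gwa_term :=
| gpoly of {poly K}
| gplus
| gminus
| gopp of gwa_term
| gadd of gwa_term & gwa_term
| gmul of gwa_term & gwa_term.

(* The smallest congruence making the terms a ring, gpoly a ring morphism, and
   the four defining relations hold.  Scalars are constant polynomials; that
   they are central follows from the relations, since tau fixes them. *)
Inductive gwa_cong : gwa_term -> gwa_term -> Prop :=
| gc_refl x : gwa_cong x x
| gc_sym x y : gwa_cong x y -> gwa_cong y x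
| gc_trans x y z : gwa_cong x y -> gwa_cong y z -> gwa_cong x z
| gc_opp x x' : gwa_cong x x' -> gwa_cong (gopp x) (gopp x')
| gc_add x x' y y' :
    gwa_cong x x' -> gwa_cong y y' -> gwa_cong (gadd x y) (gadd x' y')
| gc_mul x x' y y' :
    gwa_cong x x' -> gwa_cong y y' -> gwa_cong (gmul x y) (gmul x' y')
| gc_addA x y z : gwa_cong (gadd x (gadd y z)) (gadd (gadd x y) z)
| gc_addC x y : gwa_cong (gadd x y) (gadd y x)
| gc_add0 x : gwa_cong (gadd (gpoly 0) x) x
| gc_addN x : gwa_cong (gadd (gopp x) x) (gpoly 0)
| gc_mulA x y z : gwa_cong (gmul x (gmul y z)) (gmul (gmul x y) z)
| gc_mul1l x : gwa_cong (gmul (gpoly 1) x) x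
| gc_mul1r x : gwa_cong (gmul x (gpoly 1)) x
| gc_mulDl x y z : gwa_cong (gmul (gadd x y) z) (gadd (gmul x z) (gmul y z))
| gc_mulDr x y z : gwa_cong (gmul x (gadd y z)) (gadd (gmul x y) (gmul x z))
| gc_polyD p q : gwa_cong (gpoly (p + q)) (gadd (gpoly p) (gpoly q))
| gc_polyM p q : gwa_cong (gpoly (p * q)) (gmul (gpoly p) (gpoly q))
| gc_plus r : gwa_cong (gmul (gpoly r) gplus) (gmul gplus (gpoly (tau r)))
| gc_minus r : gwa_cong (gmul (gpoly (tau r)) gminus) (gmul gminus (gpoly r))
| gc_mp : gwa_cong (gmul gminus gplus) (gpoly (tau v))
| gc_pm : gwa_cong (gmul gplus gminus) (gpoly v).

HB.instance Definition _ := gen_eqMixin gwa_term.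
HB.instance Definition _ := gen_choiceMixin gwa_term.

Definition gwa_rel : rel gwa_term := fun x y => `[< gwa_cong x y >].

Fact gwa_rel_refl : reflexive gwa_rel.
Proof. by move=> x; apply/asboolP; exact: gc_refl. Qed.
Fact gwa_rel_sym : symmetric gwa_rel.
Proof. by move=> x y; apply/asboolP/asboolP; exact: gc_sym. Qed.
Fact gwa_rel_trans : transitive gwa_rel.
Proof. by move=> y x z /asboolP xy /asboolP yz; apply/asboolP; exact: gc_trans yz. Qed.

Canonical gwa_equiv := EquivRel gwa_rel gwa_rel_refl gwa_rel_sym gwa_rel_trans.

Definition gwa := {eq_quot gwa_equiv}.
HB.instance Definition _ := Choice.on gwa.
HB.instance Definition _ := EqQuotient.on gwa.

Definition gwa_class (x : gwa_term) : gwa := \pi_gwa x.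

Lemma gwa_classP x y : gwa_class x = gwa_class y <-> gwa_cong x y.
Proof.
split; first by move=> /eqmodP /asboolP.
by move=> xy; apply/eqmodP/asboolP.
Qed.

Lemma gwa_classW (P : gwa -> Prop) : (forall x, P (gwa_class x)) -> forall x, P x.
Proof. by move=> Px; elim/quotW. Qed.

Lemma gwa_repr x : gwa_cong (repr (gwa_class x)) x.
Proof. by apply/gwa_classP; rewrite /gwa_class reprK. Qed.

Definition gwa_zero : gwa := gwa_class (gpoly 0).
Definition gwa_one : gwa := gwa_class (gpoly 1).
Definition gwa_opp (x : gwa) : gwa := gwa_class (gopp (repr x)).
Definition gwa_add (x y : gwa) : gwa := gwa_class (gadd (repr x) (repr y)).
Definition gwa_mul (x y : gwa) : gwa := gwa_class (gmul (repr x) (repr y)).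

Lemma gwa_oppE x : gwa_opp (gwa_class x) = gwa_class (gopp x).
Proof. by apply/gwa_classP/gc_opp/gwa_repr. Qed.
Lemma gwa_addE x y : gwa_add (gwa_class x) (gwa_class y) = gwa_class (gadd x y).
Proof. by apply/gwa_classP/gc_add; exact: gwa_repr. Qed.
Lemma gwa_mulE x y : gwa_mul (gwa_class x) (gwa_class y) = gwa_class (gmul x y).
Proof. by apply/gwa_classP/gc_mul; exact: gwa_repr. Qed.

Let gwaE := (gwa_oppE, gwa_addE, gwa_mulE).

Fact gwa_addA : associative gwa_add.
Proof.
elim/gwa_classW=> x; elim/gwa_classW=> y; elim/gwa_classW=> z.
by rewrite !gwaE; apply/gwa_classP/gc_addA.
Qed.
Fact gwa_addC : commutative gwa_add.
Proof.
by elim/gwa_classW=> x; elim/gwa_classW=> y; rewrite !gwaE; apply/gwa_classP/gc_addC.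
Qed.
Fact gwa_add0 : left_id gwa_zero gwa_add.
Proof. by elim/gwa_classW=> x; rewrite !gwaE; apply/gwa_classP/gc_add0. Qed.
Fact gwa_addN : left_inverse gwa_zero gwa_opp gwa_add.
Proof. by elim/gwa_classW=> x; rewrite !gwaE; apply/gwa_classP/gc_addN. Qed.
HB.instance Definition _ :=
  GRing.isZmodule.Build gwa gwa_addA gwa_addC gwa_add0 gwa_addN.

Fact gwa_mulA : associative gwa_mul.
Proof.
elim/gwa_classW=> x; elim/gwa_classW=> y; elim/gwa_classW=> z.
by rewrite !gwaE; apply/gwa_classP/gc_mulA.
Qed.
Fact gwa_mul1l : left_id gwa_one gwa_mul.
Proof. by elim/gwa_classW=> x; rewrite !gwaE; apply/gwa_classP/gc_mul1l. Qed.
Fact gwa_mul1r : right_id gwa_one gwa_mul.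
Proof. by elim/gwa_classW=> x; rewrite !gwaE; apply/gwa_classP/gc_mul1r. Qed.
Fact gwa_mulDl : left_distributive gwa_mul gwa_add.
Proof.
elim/gwa_classW=> x; elim/gwa_classW=> y; elim/gwa_classW=> z.
by rewrite !gwaE; apply/gwa_classP/gc_mulDl.
Qed.
Fact gwa_mulDr : right_distributive gwa_mul gwa_add.
Proof.
elim/gwa_classW=> x; elim/gwa_classW=> y; elim/gwa_classW=> z.
by rewrite !gwaE; apply/gwa_classP/gc_mulDr.
Qed.

(* 1 <> 0: the algebra acts on functions f : int -> K by
   (p f)(n) = p(n) f(n), (t_+ f)(n) = v(n) f(n-1), (t_- f)(n) = f(n+1). *)
Fixpoint gwa_act (x : gwa_term) (f : int -> K) (n : int) {struct x} : K :=
  match x with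
  | gpoly p => p.[n%:~R] * f n
  | gplus => v.[n%:~R] * f (n - 1)
  | gminus => f (n + 1)
  | gopp y => - gwa_act y f n
  | gadd y z => gwa_act y f n + gwa_act z f n
  | gmul y z => gwa_act y (gwa_act z f) n
  end.

Lemma tau_eval p (n : int) : (tau p).[n%:~R] = p.[(n + 1)%:~R].
Proof. by rewrite /tau horner_comp !hornerE intrD. Qed.

Lemma gwa_actD x f g : gwa_act x (fun n => f n + g n) =
  fun n => gwa_act x f n + gwa_act x g n.
Proof.
elim: x f g => [p|||y IHy|y IHy z IHz|y IHy z IHz] f g; apply: funext => n //=.
- by rewrite mulrDr.
- by rewrite mulrDr.
- by rewrite IHy opprD.
- by rewrite IHy IHz addrACA.
- by rewrite IHz IHy.
Qed.

Lemma gwa_act_cong x y : gwa_cong x y -> gwa_act x = gwa_act y.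
Proof.
elim=> {x y}
  [|x y _ ->|x y z _ -> _ ->|x x' _ IH|x x' y y' _ IHx _ IHy|x x' y y' _ IHx _ IHy
  |x y z|x y|x|x|x y z|x|x|x y z|x y z|p q|p q|r|r||] //;
  apply: funext => f; apply: funext => n /=.
- by rewrite IH.
- by rewrite IHx IHy.
- by rewrite IHx IHy.
- by rewrite addrA.
- by rewrite addrC.
- by rewrite horner0 mul0r add0r.
- by rewrite horner0 mul0r addNr.
- by rewrite hornerC mul1r.
- by congr (gwa_act x _ n); apply: funext => m /=; rewrite hornerC mul1r.
- by rewrite gwa_actD.
- by rewrite hornerD mulrDl.
- by rewrite hornerM mulrA.
- by rewrite tau_eval subrK mulrCA.
- by rewrite tau_eval.
- by rewrite tau_eval addrK.
- by rewrite subrK.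
Qed.

Fact gwa_oner_neq0 : gwa_one != 0.
Proof.
apply/eqP => /gwa_classP /gwa_act_cong /(congr1 (fun F => F (fun=> 1) 0)) /=.
by rewrite hornerC horner0 mul1r mul0r => /eqP; rewrite oner_eq0.
Qed.

HB.instance Definition _ := GRing.Zmodule_isNzRing.Build gwa
  gwa_mulA gwa_mul1l gwa_mul1r gwa_mulDl gwa_mulDr gwa_oner_neq0.

Definition gwa_poly (p : {poly K}) : gwa := gwa_class (gpoly p).
Definition gwa_tp : gwa := gwa_class gplus.
Definition gwa_tm : gwa := gwa_class gminus.

Lemma gwa_polyD p q : gwa_poly (p + q) = gwa_poly p + gwa_poly q.
Proof. by rewrite -[RHS]/(gwa_add _ _) gwaE; apply/gwa_classP/gc_polyD. Qed.
Lemma gwa_polyM p q : gwa_poly (p * q) = gwa_poly p * gwa_poly q.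
Proof. by rewrite -[RHS]/(gwa_mul _ _) gwaE; apply/gwa_classP/gc_polyM. Qed.
Lemma gwa_tpE r : gwa_poly r * gwa_tp = gwa_tp * gwa_poly (tau r).
Proof.
by rewrite -[LHS]/(gwa_mul _ _) -[RHS]/(gwa_mul _ _) !gwaE; apply/gwa_classP/gc_plus.
Qed.
Lemma gwa_tmE r : gwa_poly (tau r) * gwa_tm = gwa_tm * gwa_poly r.
Proof.
by rewrite -[LHS]/(gwa_mul _ _) -[RHS]/(gwa_mul _ _) !gwaE; apply/gwa_classP/gc_minus.
Qed.
Lemma gwa_mpE : gwa_tm * gwa_tp = gwa_poly (tau v).
Proof. by rewrite -[LHS]/(gwa_mul _ _) gwaE; apply/gwa_classP/gc_mp. Qed.
Lemma gwa_pmE : gwa_tp * gwa_tm = gwa_poly v.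
Proof. by rewrite -[LHS]/(gwa_mul _ _) gwaE; apply/gwa_classP/gc_pm. Qed.

Lemma gwa_ind (P : gwa -> Prop) :
  (forall p, P (gwa_poly p)) -> P gwa_tp -> P gwa_tm ->
  (forall x, P x -> P (- x)) ->
  (forall x y, P x -> P y -> P (x + y)) ->
  (forall x y, P x -> P y -> P (x * y)) -> forall x, P x.
Proof.
move=> Pp Pt Pm PN PD PM; elim/gwa_classW; elim=> //.
- by move=> x Px; rewrite -gwa_oppE; exact: PN.
- by move=> x Px y Py; rewrite -gwa_addE; exact: PD.
- by move=> x Px y Py; rewrite -gwa_mulE; exact: PM.
Qed.

Definition gwa_scale (c : K) (x : gwa) : gwa := gwa_poly c%:P * x.

Lemma tauC c : tau c%:P = c%:P.
Proof. exact: comp_polyC. Qed.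

Lemma gwa_constC c x : gwa_poly c%:P * x = x * gwa_poly c%:P.
Proof.
elim/gwa_ind: x => [p||||x y IHx IHy|x y IHx IHy].
- by rewrite -!gwa_polyM mulrC.
- by rewrite gwa_tpE tauC.
- by rewrite -{1}(tauC c) gwa_tmE.
- by move=> x IH; rewrite mulrN IH mulNr.
- by rewrite mulrDr IHx IHy mulrDl.
- by rewrite mulrA IHx -mulrA IHy mulrA.
Qed.

Fact gwa_scaleA a b x : gwa_scale a (gwa_scale b x) = gwa_scale (a * b) x.
Proof. by rewrite /gwa_scale mulrA -gwa_polyM polyCM. Qed.
Fact gwa_scale1 : left_id 1 gwa_scale.
Proof. by move=> x; rewrite /gwa_scale polyC1 -[gwa_poly 1]/(1 : gwa) mul1r. Qed.
Fact gwa_scaleDr : right_distributive gwa_scale +%R.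
Proof. by move=> a x y; rewrite /gwa_scale mulrDr. Qed.
Fact gwa_scaleDl x : {morph gwa_scale^~ x : a b / a + b}.
Proof. by move=> a b; rewrite /gwa_scale polyCD gwa_polyD mulrDl. Qed.
HB.instance Definition _ := GRing.Zmodule_isLmodule.Build K gwa
  gwa_scaleA gwa_scale1 gwa_scaleDr gwa_scaleDl.

Fact gwa_scaleAl (a : K) (x y : gwa) : a *: (x * y) = (a *: x) * y.
Proof. exact: mulrA. Qed.
HB.instance Definition _ := GRing.Lmodule_isLalgebra.Build K gwa gwa_scaleAl.
Fact gwa_scaleAr (a : K) (x y : gwa) : a *: (x * y) = x * (a *: y).
Proof.
rewrite -[LHS]/(gwa_poly a%:P * _) -[a *: y]/(gwa_poly a%:P * _).
by rewrite mulrA gwa_constC mulrA.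
Qed.
HB.instance Definition _ := GRing.Lalgebra_isAlgebra.Build K gwa gwa_scaleAr.

Inductive gwa_comp : int -> set gwa :=
| gwa_comp_poly p : gwa_comp 0 (gwa_poly p)
| gwa_comp_tp : gwa_comp 1 gwa_tp
| gwa_comp_tm : gwa_comp (- 1) gwa_tm
| gwa_comp_0 i : gwa_comp i 0
| gwa_comp_B i x y : gwa_comp i x -> gwa_comp i y -> gwa_comp i (x - y)
| gwa_comp_M i j x y :
    gwa_comp i x -> gwa_comp j y -> gwa_comp (i + j) (x * y).

Fact gwa_comp_scale i (c : K) x : gwa_comp i x -> gwa_comp i (c *: x).
Proof.
by move=> xi; rewrite -[i]add0r; apply: gwa_comp_M => //; exact: gwa_comp_poly.
Qed.

(* The degree automorphism t_+ |-> 2 t_+, t_- |-> 2^-1 t_-, which is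
   multiplication by 2 ^ i in degree i. *)
Fixpoint gwa_dil_term (x : gwa_term) : gwa :=
  match x with
  | gpoly p => gwa_poly p
  | gplus => 2 *: gwa_tp
  | gminus => 2^-1 *: gwa_tm
  | gopp y => - gwa_dil_term y
  | gadd y z => gwa_dil_term y + gwa_dil_term z
  | gmul y z => gwa_dil_term y * gwa_dil_term z
  end.

Lemma gwa_dil_cong x y : gwa_cong x y -> gwa_dil_term x = gwa_dil_term y.
Proof.
have p0 : gwa_poly 0 = 0 by [].
have p1 : gwa_poly 1 = 1 by [].
have n2 : (2 : K) != 0 by rewrite pnatr_eq0.
elim=> {x y}
  [|x y _ ->|x y z _ -> _ ->|x x' _ IH|x x' y y' _ IHx _ IHy|x x' y y' _ IHx _ IHy
  |x y z|x y|x|x|x y z|x|x|x y z|x y z|p q|p q|r|r||] //=.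
- by rewrite IH.
- by rewrite IHx IHy.
- by rewrite IHx IHy.
- by rewrite addrA.
- by rewrite addrC.
- by rewrite p0 add0r.
- by rewrite p0 addNr.
- by rewrite mulrA.
- by rewrite p1 mul1r.
- by rewrite p1 mulr1.
- by rewrite mulrDl.
- by rewrite mulrDr.
- by rewrite gwa_polyD.
- by rewrite gwa_polyM.
- by rewrite -scalerAr -scalerAl gwa_tpE.
- by rewrite -scalerAr -scalerAl gwa_tmE.
- by rewrite -scalerAr -scalerAl scalerA divff // scale1r gwa_mpE.
- by rewrite -scalerAr -scalerAl scalerA mulVf // scale1r gwa_pmE.
Qed.

Definition gwa_dil (x : gwa) : gwa := gwa_dil_term (repr x).

Lemma gwa_dilE x : gwa_dil (gwa_class x) = gwa_dil_term x.
Proof. exact: gwa_dil_cong (gwa_repr x). Qed.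

Lemma gwa_dilD x y : gwa_dil (x + y) = gwa_dil x + gwa_dil y.
Proof.
elim/gwa_classW: x => x; elim/gwa_classW: y => y.
by rewrite -[_ + _ in LHS]/(gwa_add _ _) gwa_addE !gwa_dilE.
Qed.
Lemma gwa_dilN x : gwa_dil (- x) = - gwa_dil x.
Proof.
elim/gwa_classW: x => x.
by rewrite -[- _ in LHS]/(gwa_opp _) gwa_oppE !gwa_dilE.
Qed.
Lemma gwa_dilM x y : gwa_dil (x * y) = gwa_dil x * gwa_dil y.
Proof.
elim/gwa_classW: x => x; elim/gwa_classW: y => y.
by rewrite -[_ * _ in LHS]/(gwa_mul _ _) gwa_mulE !gwa_dilE.
Qed.
Lemma gwa_dil0 : gwa_dil 0 = 0.
Proof. by rewrite -[0 in LHS]/(gwa_class (gpoly 0)) gwa_dilE. Qed.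

Lemma gwa_dil_comp i x : gwa_comp i x -> gwa_dil x = (2 : K) ^ i *: x.
Proof.
have n2 : (2 : K) != 0 by rewrite pnatr_eq0.
elim=> {i x} [p|||i|i x y _ IHx _ IHy|i j x y _ IHx _ IHy].
- by rewrite gwa_dilE expr0z scale1r.
- by rewrite gwa_dilE expr1z.
- by rewrite gwa_dilE exprN1.
- by rewrite gwa_dil0 scaler0.
- by rewrite gwa_dilD gwa_dilN IHx IHy scalerBr.
- by rewrite gwa_dilM IHx IHy -scalerAr -scalerAl scalerA mulrC expfzDr.
Qed.

Lemma gwa_comp_indep (s : seq int) (f : int -> gwa) :
  uniq s -> (forall i, gwa_comp i (f i)) -> \sum_(i <- s) f i = 0 ->
  forall i, i \in s -> f i = 0.
Proof.
elim: s f => [//|j s IH] f /= /andP[js us] fg s0.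
have fs i : i \in s -> f i = 0.
  move=> is_; have ij : i != j by apply: contraNneq js => <-.
  have cf0 : ((2 : K) ^ i - 2 ^ j) *: f i = 0.
    apply: (IH (fun i => ((2 : K) ^ i - 2 ^ j) *: f i)) => //.
      by move=> k; exact: gwa_comp_scale.
    have := congr1 gwa_dil s0.
    rewrite (big_morph gwa_dil gwa_dilD gwa_dil0) gwa_dil0.
    under eq_bigr => k _ do rewrite (gwa_dil_comp (fg k)).
    move=> d0; have := congr2 (fun x y => x - 2 ^ j *: y) d0 s0.
    rewrite scaler0 subr0 scaler_sumr -sumrB big_cons subrr add0r => e.
    by rewrite -[RHS]e; apply: eq_bigr => k _; rewrite scalerBl.
  have c0 : (2 : K) ^ i - 2 ^ j != 0.
    rewrite subr_eq0; apply: contra ij => /eqP e2.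
    apply/eqP/(@ieexprIz _ (2 : rat)) => //; apply: (fmorph_inj (@ratr K)).
    by rewrite !fmorphXz /= ratr_nat.
  by rewrite -[f i]scale1r -(mulVf c0) -scalerA cf0 scaler0.
move=> i; rewrite inE => /orP[/eqP->|]; last exact: fs.
by move: s0; rewrite big_cons big_seq big1 ?addr0.
Qed.

Lemma gwa_comp_span x : exists s : seq gwa,
  (forall y, y \in s -> exists i, gwa_comp i y) /\ x = \sum_(y <- s) y.
Proof.
have homog i y : gwa_comp i y -> exists s : seq gwa,
    (forall z, z \in s -> exists i, gwa_comp i z) /\ y = \sum_(z <- s) z.
  move=> yi; exists [:: y]; rewrite big_seq1; split=> // z.
  by rewrite inE => /eqP->; exists i.
elim/gwa_ind: x.
- by move=> p; apply: homog; exact: gwa_comp_poly.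
- by apply: homog; exact: gwa_comp_tp.
- by apply: homog; exact: gwa_comp_tm.
- move=> x [s [sg ->]]; exists (map -%R s); rewrite big_map sumrN; split=> //.
  move=> _ /mapP[y /sg[i yi] ->]; exists i; rewrite -sub0r.
  by apply: gwa_comp_B => //; exact: gwa_comp_0.
- move=> x y [s [sg ->]] [t [tg ->]]; exists (s ++ t); rewrite big_cat; split=> //.
  by move=> z; rewrite mem_cat => /orP[/sg|/tg].
- move=> x y [s [sg ->]] [t [tg ->]]; exists [seq a * b | a <- s, b <- t].
  rewrite big_allpairs_dep big_distrlr; split=> // z.
  move=> /allpairsP[[a b] /= [/sg[i ai] /tg[j bj] ->]].
  by exists (i + j); exact: gwa_comp_M.
Qed.

Lemma gwa_grading : is_grading gwa_comp.
Proof.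
by split; [exact: gwa_comp_0|exact: gwa_comp_B|exact: gwa_comp_span|
           exact: gwa_comp_indep].
Qed.

Definition GWA : gralg K :=
  GrAlg gwa_grading gwa_comp_scale (gwa_comp_poly 1) gwa_comp_M.
End GWA.

Section SameType.
Variable K : fieldType.

(* u = \prod_i (h - x i) ^ d i with increasing integers x i and d i >= 1. *)
Definition Zf_factorization (n : nat) (x : 'I_n -> int) (d : 'I_n -> nat)
    (u : {poly K}) :=
  [/\ forall i j : 'I_n, (i < j)%N -> x i < x j,
      forall i, (0 < d i)%N &
      u = \prod_(i < n) ('X - ((x i)%:~R)%:P) ^+ d i].

Definition Zf (u : {poly K}) :=
  exists s : seq int, u = \prod_(n <- s) ('X - (n%:~R)%:P).

Definition Zf_sim (u v : {poly K}) :=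
  exists (n : nat) (d : 'I_n -> nat) (x y : 'I_n -> int),
    Zf_factorization x d u /\ Zf_factorization y d v.

Definition eq_mod_Z (a b : K) := exists n : int, a - b = n%:~R.

Definition type_factorization (k : nat) (a : 'I_k -> K) (w : 'I_k -> {poly K})
    (v : {poly K}) :=
  [/\ forall i, Zf (w i) /\ (1 < size (w i))%N,
      forall i j, i != j -> ~ eq_mod_Z (a i) (a j) &
      exists2 c : K, c != 0 & v = c *: \prod_(i < k) (w i \Po ('X - (a i)%:P))].

(* The factorizations are unique up to reindexing and integer translations of
   the a i, which change the w i only up to Zf_sim; so it does not matter
   which ones are chosen. *)
Definition same_type (u v : {poly K}) :=
  exists (k l : nat) (a : 'I_k -> K) (w : 'I_k -> {poly K})
         (b : 'I_l -> K) (z : 'I_l -> {poly K}) (j : 'I_k -> 'I_l),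
    [/\ type_factorization a w v, type_factorization b z u, bijective j &
        forall i, eq_mod_Z (a i) (b (j i)) /\ Zf_sim (w i) (z (j i))].
End SameType.

(* Main.v *)
From HB Require Import structures.
From mathcomp Require Import all_boot all_order all_algebra.
From mathcomp Require Import boolp classical_sets.
From mathcomp Require Import zify ring.
From mathcomp Require Import reals complex.
Require Import Defs.

(** Let K be the base field, write M_i for the degree i component of a graded
    T(v)-module M, and let H act on M_i as h - i. Then H commutes with t_+ and
    t_-, and a graded module is the same thing as a sequence of K[H]-modules M_i
    with maps back and forth between M_i and M_(i+1) whose composites, both ways,
    are v(H + i + 1). At a point H = c only the edges i with v(c + i + 1) = 0 are
    not invertible; they correspond to the roots of v in the class of c modulo Z,
    in their natural order. The shift M |-> M[1] translates H by 1.

    From type to equivalence. If v = a b, the edge from i - 1 to i is labelled by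
    a(H + i) b(H + i). When a and b are coprime there is, up to isomorphism, one
    way to insert a module X_i on the edge so that it splits into a b-edge and an
    a-edge: X_i consists of the pairs (x, y) in M_(i-1) x M_i with t_+ x = b y and
    t_- y = a x, where a and b are taken at H + i. The sequence of the X_i is then a graded module over the algebra
    of a(h - 1) b(h), and when a(h) and b(h + 1) are coprime too the same
    construction undoes it ([eta_iso]). So factors can be slid past integers as
    long as they do not collide with the others ([Morita_slide]). Two increasing
    sequences of positions with the same multiplicities can both be slid to their
    sum ([slide_up], [slide_to_sum]), whence [same_type_Morita].

    From equivalence to type. An equivalence F maps the central operator H to a
    polynomial in H, and compatibility with the shift forces F(H) = H + mu
    ([center_translation]). Let P_m be the free module generated in degree m. The
    round trips P_m -> P_n -> P_m are the multiples of the product of the edge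
    labels between m and n; the same holds for the F(P_m) with v_2(H + mu) in
    place of v_1 ([chain]). Since F(P_n) is a retract of a finite sum of P_m's
    ([free_through]), it becomes isomorphic to some P_m once polynomials not
    vanishing at c are inverted, with m bounded independently of c
    ([exists_iso_at]). Comparing orders of vanishing at c of round trips, for c
    so far up in its class that all roots lie below it, shows that the numbers of
    roots beyond a variable point of the class take the same values for v_1 and
    for v_2(h + mu) ([chain_tails]). The bound on m is what excludes a reversal
    of the order. These values are the partial sums, from the top, of the
    sequence of multiplicities, so they determine it ([same_type_of_tails]). *)

Set Implicit Arguments.
Unset Strict Implicit.
Unset Printing Implicit Defensive.

Import Order.TTheory GRing.Theory Num.Theory.
Local Open Scope ring_scope.

(** * Homogeneous components *)

Section Components.
Variables (V : zmodType) (g : int -> set V) (hg : is_grading g).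

Lemma gr0 i : g i 0. Proof. exact: grading0 hg i. Qed.
Lemma grB i x y : g i x -> g i y -> g i (x - y).
Proof. exact: (gradingB hg). Qed.
Lemma grN i x : g i x -> g i (- x).
Proof. by move=> xi; rewrite -sub0r; apply: grB => //; apply: gr0. Qed.
Lemma grD i x y : g i x -> g i y -> g i (x + y).
Proof. by move=> xi yi; rewrite -[y]opprK; apply: grB => //; apply: grN. Qed.
Lemma gr_sum i (I : Type) (r : seq I) (P : pred I) F :
  (forall k, P k -> g i (F k)) -> g i (\sum_(k <- r | P k) F k).
Proof. by apply: big_ind => //; [apply: gr0 | move=> x y; apply: grD]. Qed.

Lemma homog_ind (P : V -> Prop) : P 0 ->
  (forall x y, P x -> P y -> P (x + y)) ->
  (forall i x, g i x -> P x) -> forall x, P x.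
Proof.
move=> P0 PD Ph x; have [s [sg ->]] := grading_span hg x.
elim: s sg => [|y s IH] sg; first by rewrite big_nil.
rewrite big_cons; apply: PD; last by apply: IH => z zs; apply: sg; rewrite inE zs orbT.
by have [|i yi] := sg y; [rewrite mem_head | exact: Ph yi].
Qed.

Definition decomposes (x : V) (sf : seq int * (int -> V)) :=
  [/\ uniq sf.1, forall i, g i (sf.2 i), forall i, i \notin sf.1 -> sf.2 i = 0 &
      x = \sum_(i <- sf.1) sf.2 i].

Lemma sum_widen (s t : seq int) (f : int -> V) : uniq s -> uniq t ->
  {subset s <= t} -> (forall i, i \notin s -> f i = 0) ->
  \sum_(i <- t) f i = \sum_(i <- s) f i.
Proof.
move=> us ut st f0; rewrite (bigID (mem s)) /= [X in _ + X]big1 ?addr0 => [|i /f0 //].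
rewrite -big_filter; apply: perm_big; apply: uniq_perm => //; first exact: filter_uniq.
by move=> i; rewrite mem_filter; apply: andb_idr => /st.
Qed.

Lemma decomposes_uniq x sf tk : decomposes x sf -> decomposes x tk -> sf.2 =1 tk.2.
Proof.
case: sf tk => [s f] [t k] [/= us fg f0 xs] [/= ut kg k0 xt] i.
pose r := undup (s ++ t).
have sr : {subset s <= r} by move=> j js; rewrite mem_undup mem_cat js.
have tr : {subset t <= r} by move=> j jt; rewrite mem_undup mem_cat jt orbT.
have ur : uniq r by apply: undup_uniq.
have [ir|] := boolP (i \in r); last first.
  by rewrite mem_undup mem_cat negb_or => /andP[/f0 -> /k0 ->].
apply/eqP; rewrite -subr_eq0; apply/eqP.
apply: (grading_indep hg ur (f := fun i => f i - k i)) => // [j|]; first exact: grB.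
by rewrite sumrB (@sum_widen s r f) // (@sum_widen t r k) // -xs -xt subrr.
Qed.

Lemma decomposesD x y sf tk : decomposes x sf -> decomposes y tk ->
  decomposes (x + y) (undup (sf.1 ++ tk.1), fun i => sf.2 i + tk.2 i).
Proof.
case: sf tk => [s f] [t k] [/= us fg f0 xs] [/= ut kg k0 yt].
split=> /= [|i|i|]; first exact: undup_uniq.
- exact: grD.
- by rewrite mem_undup mem_cat negb_or => /andP[/f0 -> /k0 ->]; rewrite addr0.
- rewrite big_split /= xs yt; congr (_ + _); apply/esym; apply: sum_widen => //.
  + exact: undup_uniq.
  + by move=> j js; rewrite mem_undup mem_cat js.
  + exact: undup_uniq.
  + by move=> j jt; rewrite mem_undup mem_cat jt orbT.
Qed.

Lemma decomposes_homog i x : g i x ->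
  decomposes x ([:: i], fun j => if j == i then x else 0).
Proof.
move=> xi; split=> /= [//|j|j|]; last by rewrite big_seq1 eqxx.
- by case: eqP => [->|_] //; apply: gr0.
- by rewrite inE => /negbTE ->.
Qed.

Lemma decomposes_exists x : exists sf, decomposes x sf.
Proof.
elim/homog_ind: x => [|x y [sf xsf] [tk ytk]|i x xi].
- exists ([::], fun=> 0); split=> //= [i|]; [exact: gr0 | by rewrite big_nil].
- by eexists; apply: decomposesD xsf ytk.
- by eexists; apply: decomposes_homog xi.
Qed.

Definition degrees (x : V) : seq int := (projT1 (cid (decomposes_exists x))).1.
Definition part (i : int) (x : V) : V := (projT1 (cid (decomposes_exists x))).2 i.

Lemma partP x : decomposes x (degrees x, part^~ x).
Proof. by rewrite /part /degrees; case: cid => -[]. Qed.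

Lemma part_comp i x : g i (part i x).
Proof. by case: (partP x). Qed.
Lemma degrees_uniq x : uniq (degrees x).
Proof. by case: (partP x). Qed.
Lemma part_sum x : x = \sum_(i <- degrees x) part i x.
Proof. by case: (partP x). Qed.
Lemma part_notin i x : i \notin degrees x -> part i x = 0.
Proof. by case: (partP x) => _ _ + _; apply. Qed.
Lemma partE x sf i : decomposes x sf -> part i x = sf.2 i.
Proof. by move=> xsf; apply: decomposes_uniq (partP x) xsf i. Qed.
Lemma partD i x y : part i (x + y) = part i x + part i y.
Proof. by rewrite (partE _ (decomposesD (partP x) (partP y))). Qed.
Lemma part_homog i j x : g i x -> part j x = if j == i then x else 0.
Proof. by move=> /decomposes_homog /partE ->. Qed.
Lemma part_id i x : g i x -> part i x = x.
Proof. by move=> /part_homog ->; rewrite eqxx. Qed.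
Lemma part0 i : part i 0 = 0.
Proof. by rewrite part_id //; apply: gr0. Qed.
Lemma partN i x : part i (- x) = - part i x.
Proof. by apply/eqP; rewrite -addr_eq0 -partD addNr part0. Qed.
Lemma partB i x y : part i (x - y) = part i x - part i y.
Proof. by rewrite partD partN. Qed.

Lemma comp_part i x : (forall j, j != i -> part j x = 0) -> g i x.
Proof.
move=> x0; rewrite (part_sum x); apply: gr_sum => j _.
by case: (eqVneq j i) => [->|/x0 ->]; [apply: part_comp | apply: gr0].
Qed.

(** An operator such as H is prescribed by a different formula in each degree. *)
Definition glue (W : zmodType) (phi : int -> V -> W) (x : V) : W :=
  \sum_(i <- degrees x) phi i (part i x).

Lemma sum_widenW (W : zmodType) (phi : int -> V -> W) x (s : seq int) :
  (forall i, phi i 0 = 0) -> uniq s -> {subset degrees x <= s} ->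
  \sum_(i <- s) phi i (part i x) = glue phi x.
Proof.
move=> phi0 us xs; rewrite /glue (bigID (mem (degrees x))) /=.
rewrite [X in _ + X]big1 ?addr0 => [|i /part_notin ->]; last by rewrite phi0.
rewrite -big_filter; apply: perm_big; apply: uniq_perm => //.
- exact: filter_uniq.
- exact: degrees_uniq.
- by move=> i; rewrite mem_filter; apply: andb_idr => /xs.
Qed.

Lemma glueD (W : zmodType) (phi : int -> V -> W) :
  (forall i x y, phi i (x + y) = phi i x + phi i y) ->
  forall x y, glue phi (x + y) = glue phi x + glue phi y.
Proof.
move=> phiD x y.
have phi0 i : phi i 0 = 0.
  by apply/eqP; rewrite -(inj_eq (addrI (phi i 0))) -phiD !addr0.
pose s := undup (degrees x ++ degrees y ++ degrees (x + y)).
have us : uniq s by apply: undup_uniq.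
have ws z : z \in [:: x; y; x + y] -> \sum_(i <- s) phi i (part i z) = glue phi z.
  move=> zxy; apply: sum_widenW => // i iz; rewrite mem_undup !mem_cat.
  by move: zxy; rewrite !inE => /or3P[] /eqP ez; rewrite -ez iz ?orbT.
rewrite -!ws ?inE ?eqxx ?orbT //.
by rewrite -big_split; apply: eq_bigr => i _; rewrite partD phiD.
Qed.

Lemma glue_homog (W : zmodType) (phi : int -> V -> W) i x :
  (forall i, phi i 0 = 0) -> g i x -> glue phi x = phi i x.
Proof.
move=> phi0 xi; have <- : \sum_(j <- undup (i :: degrees x)) phi j (part j x) = glue phi x.
  apply: sum_widenW => [//||j jx]; first exact: undup_uniq.
  by rewrite mem_undup inE jx orbT.
rewrite (bigD1_seq i) ?mem_undup ?mem_head ?undup_uniq //.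
rewrite part_id // big1 => [|j /negbTE ji]; first exact: addr0.
by rewrite (part_homog _ xi) ji.
Qed.
End Components.

Section GradedHoms.
Variables (K : comNzRingType) (A : gralg K).
Implicit Types M N : grmodule A.

Definition mpart M i (x : M) := part (grmod_grading M) i x.

Lemma grhom_part M N (f : grhom M N) i x : f (mpart i x) = mpart i (f x).
Proof.
elim/(homog_ind (grmod_grading M)): x => [|x y IHx IHy|j x xj].
- by rewrite /mpart !(part0, raddf0).
- by rewrite raddfD /mpart !partD raddfD; congr (_ + _).
- rewrite /mpart (part_homog _ _ xj) (part_homog _ _ (grhom_deg f xj)).
  by case: ifP; rewrite ?raddf0.
Qed.

Lemma act_part M i j (a : A) (x : M) : gralg_comp i a ->
  a *: mpart j x = mpart (i + j) (a *: x).
Proof.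
move=> ai; elim/(homog_ind (grmod_grading M)): x => [|x y IHx IHy|k x xk].
- by rewrite /mpart scaler0 !part0 scaler0.
- by rewrite scalerDr /mpart !partD scalerDr; congr (_ + _).
- rewrite /mpart (part_homog _ _ xk) (part_homog _ _ (grmod_act ai xk)).
  by rewrite (inj_eq (addrI i)); case: ifP; rewrite ?scaler0.
Qed.

Lemma grhom_homog_ext M N (f g : grhom M N) :
  (forall i x, grmod_comp i x -> f x = g x) -> f = g.
Proof.
move=> fg; apply: grhom_ext; apply: (homog_ind (grmod_grading M)) => [|x y IHx IHy|//].
- by rewrite !raddf0.
- by rewrite !raddfD; congr (_ + _).
Qed.

(** The inverse is linear and graded because the injective f sees both sides of
    each identity agree. *)
Lemma iso_of_bijective M N (f : grhom M N) : injective f ->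
  (forall y, exists x, f x = y) -> @is_iso (grMod A) M N f.
Proof.
move=> fI fS; pose g y := projT1 (cid (fS y)).
have gK y : f (g y) = y by rewrite /g; case: cid.
have gl : linear g by move=> a x y; apply: fI; rewrite linearP !gK.
pose L : {linear N -> M} :=
  HB.pack g (GRing.isLinear.Build A N M *:%R g gl).
have gd i y : grmod_comp i y -> grmod_comp i (L y).
  move=> yi; apply: (@comp_part _ _ (grmod_grading M) i (L y)) => j ji; apply: fI.
  rewrite -[part _ _ _]/(mpart j (g y)) grhom_part gK raddf0 /mpart.
  by rewrite (part_homog _ _ yi) (negbTE ji).
exists (GrHom gd); split; apply: grhom_ext => x /=; last exact: gK.
by apply: fI; rewrite gK.
Qed.
End GradedHoms.

(** * Translations of polynomials *)

Section ShiftPoly.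
Variable K : comNzRingType.
Implicit Types (p q : {poly K}) (c d : K).

Definition shp c p := p \Po ('X + c%:P).

Lemma shpD c p q : shp c (p + q) = shp c p + shp c q.
Proof. exact: raddfD. Qed.
Lemma shpM c p q : shp c (p * q) = shp c p * shp c q.
Proof. exact: comp_polyM. Qed.
Lemma shpZ c d p : shp c (d *: p) = d *: shp c p.
Proof. exact: comp_polyZ. Qed.
Lemma shpC c d : shp c d%:P = d%:P.
Proof. exact: comp_polyC. Qed.
Lemma shp1 c : shp c 1 = 1.
Proof. by rewrite -polyC1 shpC. Qed.
Lemma shpp0 c : shp c 0 = 0.
Proof. exact: comp_poly0. Qed.
Lemma shpX c : shp c 'X = 'X + c%:P.
Proof. exact: comp_polyX. Qed.
Lemma shp_shp c d p : shp c (shp d p) = shp (c + d) p.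
Proof. by rewrite /shp -comp_polyA comp_polyD comp_polyX comp_polyC polyCD addrA. Qed.
Lemma shp0 p : shp 0 p = p.
Proof. by rewrite /shp addr0 comp_polyXr. Qed.
Lemma shp_prod c (I : Type) (r : seq I) (P : pred I) F :
  shp c (\prod_(i <- r | P i) F i) = \prod_(i <- r | P i) shp c (F i).
Proof. by apply: big_morph => [p q|]; [exact: shpM | exact: shp1]. Qed.
Lemma horner_shp c p x : (shp c p).[x] = p.[x + c].
Proof. by rewrite /shp horner_comp !hornerE. Qed.
Lemma shp_eq0 c p : (shp c p == 0) = (p == 0).
Proof.
apply/eqP/eqP => [|->]; last exact: shpp0.
by move=> /(congr1 (shp (- c))); rewrite shp_shp addNr shp0 shpp0.
Qed.
End ShiftPoly.

Lemma tauE (K : numFieldType) (p : {poly K}) : tau p = shp 1 p.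
Proof. by rewrite /tau -polyC1. Qed.

(** * Homogeneous elements of a generalized Weyl algebra *)

Section GwaStructure.
Variables (K : numFieldType) (v : {poly K}).
Notation gw := (gwa v).
Notation pol := (@gwa_poly K v).
Notation tp := (@gwa_tp K v).
Notation tm := (@gwa_tm K v).
Notation T := (@gwa_comp K v).

Lemma pol0 : pol 0 = 0. Proof. by []. Qed.
Lemma pol1 : pol 1 = 1. Proof. by []. Qed.
Lemma polN p : pol (- p) = - pol p.
Proof. by apply/eqP; rewrite -addr_eq0 -gwa_polyD addNr pol0. Qed.
Lemma polB p q : pol (p - q) = pol p - pol q.
Proof. by rewrite gwa_polyD polN. Qed.

(** A homogeneous element of degree j moves h to h + j when it passes a
    polynomial; this is why h - i in degree i is central. *)
Lemma pol_comm j a p : T j a -> pol p * a = a * pol (shp j%:~R p).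
Proof.
move=> ja; elim: ja p => {j a} [q|||j|j x y _ IHx _ IHy|i j x y _ IHx _ IHy] p.
- by rewrite -!gwa_polyM shp0 mulrC.
- by rewrite gwa_tpE tauE.
- rewrite -[in LHS](shp0 p) -[0 in LHS](subrr (1 : K)) -shp_shp -tauE gwa_tmE.
  by congr (_ * pol (shp _ _)); rewrite mulrN1z.
- by rewrite mulr0 mul0r.
- by rewrite mulrBr mulrBl IHx IHy.
- by rewrite mulrA IHx -mulrA IHy mulrA shp_shp -intrD [j + i]addrC.
Qed.

Definition tpow (j : int) : gw :=
  match j with Posz n => tp ^+ n | Negz n => tm ^+ n.+1 end.

Lemma tpXdeg n : T n%:Z (tp ^+ n).
Proof.
elim: n => [|n IH]; first exact: gwa_comp_poly.
by rewrite exprS intS; apply: gwa_comp_M => //; exact: gwa_comp_tp.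
Qed.
Lemma tmXdeg n : T (- n%:Z) (tm ^+ n).
Proof.
elim: n => [|n IH]; first exact: gwa_comp_poly.
by rewrite exprS intS opprD; apply: gwa_comp_M => //; exact: gwa_comp_tm.
Qed.
Lemma tpow_deg j : T j (tpow j).
Proof. by case: j => n; [exact: tpXdeg | rewrite NegzE; exact: tmXdeg]. Qed.
Lemma tpow_pos n : tpow n%:Z = tp ^+ n. Proof. by []. Qed.
Lemma tpow_neg n : tpow (- n%:Z) = tm ^+ n.
Proof. by case: n. Qed.

Lemma tp_tpow j : exists p, tp * tpow j = pol p * tpow (1 + j).
Proof.
case: j => n; first by exists 1; rewrite pol1 mul1r /= -exprS.
exists v; rewrite NegzE tpow_neg exprS mulrA gwa_pmE; congr (_ * _).
by rewrite -(tpow_neg n); congr tpow; lia.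
Qed.

Lemma tm_tpow j : exists p, tm * tpow j = pol p * tpow (-1 + j).
Proof.
case: j => [[|n]|n].
- by exists 1; rewrite pol1 mul1r mulr1 addr0 (tpow_neg 1) expr1.
- exists (tau v); rewrite tpow_pos exprS mulrA gwa_mpE; congr (_ * _).
  by rewrite -tpow_pos; congr tpow; lia.
- exists 1; rewrite pol1 mul1r NegzE tpow_neg -exprS -tpow_neg.
  by congr tpow; lia.
Qed.

Lemma tpow_tpow i j : exists p, tpow i * tpow j = pol p * tpow (i + j).
Proof.
have step k x : T k x -> (forall j, exists p, x * tpow j = pol p * tpow (k + j)) ->
    forall n j, exists p, x ^+ n * tpow j = pol p * tpow (n%:Z * k + j).
  move=> kx xj; elim=> [|n IH] {}j.
    by exists 1; rewrite expr0 pol1 !mul1r mul0r add0r.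
  have [p e1] := IH j; rewrite exprS -mulrA e1 mulrA.
  have xp q : exists q', x * pol q = pol q' * x.
    exists (shp (- k%:~R) q); rewrite (pol_comm _ kx) shp_shp.
    by rewrite subrr shp0.
  have [q ->] := xp p; rewrite -mulrA.
  have [r ->] := xj (n%:Z * k + j); exists (q * r); rewrite gwa_polyM -mulrA.
  by congr (_ * (_ * tpow _)); rewrite intS mulrDl mul1r addrA.
case: i => n.
- have [p e] := step _ _ (gwa_comp_tp v) tp_tpow n j; exists p.
  by rewrite tpow_pos e mulr1.
- have [p e] := step _ _ (gwa_comp_tm v) tm_tpow n.+1 j; exists p.
  by rewrite NegzE tpow_neg e mulrN1.
Qed.

(** Polynomials can be moved to the left and neighbouring t_+ and t_- cancel into
    values of v, so the components are K[h] t_+^j and K[h] t_-^j. *)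
Lemma gwa_compE j x : T j x -> exists p, x = pol p * tpow j.
Proof.
elim=> {j x} [p|||j|j x y _ [p ->] _ [q ->]|i j x y _ [p ->] _ [q ->]].
- by exists p; rewrite mulr1.
- by exists 1; rewrite pol1 mul1r.
- by exists 1; rewrite pol1 mul1r (tpow_neg 1).
- by exists 0; rewrite pol0 mul0r.
- by exists (p - q); rewrite polB mulrBl.
- have [r e] := tpow_tpow i j.
  exists (p * shp (- i%:~R) q * r); rewrite !gwa_polyM -!mulrA -e !mulrA.
  congr (_ * _); rewrite -!mulrA (pol_comm _ (tpow_deg i)) shp_shp.
  by rewrite subrr shp0.
Qed.

(** T(v) acts on functions on the integers, p(h) through its values, and a nonzero
    polynomial does not vanish at all integers. *)
Lemma pol_inj : injective pol.
Proof.
move=> p q /gwa_classP /gwa_act_cong e.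
have {e} pq (n : int) : p.[n%:~R] = q.[n%:~R].
  have := congr1 (fun F => F (fun=> 1) n) e.
  by rewrite /= !mulr1.
apply/eqP; rewrite -subr_eq0; apply/eqP/(@roots_geq_poly_eq0 K _
  [seq (n%:~R : K) | n <- map Posz (iota 0 (size (p - q)))]).
- by apply/allP => _ /mapP[n _ ->]; rewrite rootE !hornerE pq subrr.
- rewrite map_inj_uniq ?map_inj_uniq ?iota_uniq //.
  + by move=> m n [].
  + by move=> m n; apply: intr_inj.
- by rewrite !size_map size_iota.
Qed.

(** The product of the labels w(H + i + 1) of the n edges that start in degree m:
    what a round trip from degree m to degree m + n, or the other way round, does
    in terms of H. *)
Definition edges (w : {poly K}) (m : int) (n : nat) : {poly K} :=
  \prod_(j < n) shp (m + j%:Z + 1)%:~R w.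

Lemma edges0 w m : edges w m 0 = 1.
Proof. by rewrite /edges big_ord0. Qed.
Lemma edgesS w m n : edges w m n.+1 = edges w m n * shp (m + n%:Z + 1)%:~R w.
Proof. by rewrite /edges big_ord_recr. Qed.
Lemma edges_neq0 w m n : w != 0 -> edges w m n != 0.
Proof. by move=> w0; apply/prodf_neq0 => i _; rewrite shp_eq0. Qed.
Lemma shp_edges (k : int) w m n : shp k%:~R (edges w m n) = edges w (k + m) n.
Proof.
rewrite /edges shp_prod; apply: eq_bigr => i _.
by rewrite shp_shp -intrD !addrA.
Qed.

Lemma tmX_tpX n : tm ^+ n * tp ^+ n = pol (edges v 0 n).
Proof.
elim: n => [|n IH]; first by rewrite edges0 mulr1.
rewrite exprSr -mulrA exprS [X in _ * X]mulrA gwa_mpE (pol_comm _ (tpXdeg n)).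
rewrite mulrA IH -gwa_polyM edgesS tauE shp_shp add0r intrD.
by [].
Qed.

Lemma tpX_tmX n : tp ^+ n * tm ^+ n = pol (edges v (- n%:Z) n).
Proof.
elim: n => [|n IH]; first by rewrite edges0 mulr1.
rewrite exprSr -mulrA exprS [X in _ * X]mulrA gwa_pmE (pol_comm _ (tmXdeg n)).
rewrite mulrA IH -gwa_polyM; congr pol.
rewrite /edges big_ord_recl [RHS]mulrC; congr (_ * _); last first.
  by congr (shp _%:~R _); rewrite /=; lia.
by apply: eq_bigr => i _; congr (shp _%:~R _); rewrite /= /bump /=; lia.
Qed.

(** Multiplying by t^(-j) brings p t^j back to degree 0. *)
Lemma pol_tpow_eq0 p j : v != 0 -> pol p * tpow j = 0 -> p = 0.
Proof.
move=> v0 /(congr1 (fun x => x * tpow (- j))); rewrite mul0r -mulrA => e.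
have [q q0 eq] : exists2 q, q != 0 & tpow j * tpow (- j) = pol q.
  case: j {e} => n.
    by exists (edges v (- n%:Z) n); rewrite ?edges_neq0 // tpow_neg tpX_tmX.
  exists (edges v 0 n.+1); rewrite ?edges_neq0 // NegzE opprK tpow_neg.
  exact: tmX_tpX.
move: e; rewrite eq -gwa_polyM -pol0 => /pol_inj /eqP.
by rewrite mulf_eq0 (negbTE q0) orbF => /eqP.
Qed.
End GwaStructure.

(** * Quotients of graded modules *)

Section Quotient.
Local Open Scope quotient_scope.
Variables (K : comNzRingType) (A : gralg K) (M : grmodule A) (I : set M).

(** Closure under components is what makes the quotient graded. *)
Record graded_submodule : Prop := GradedSubmodule {
  gsub0 : I 0;
  gsubB : forall x y, I x -> I y -> I (x - y);
  gsubZ : forall (a : A) x, I x -> I (a *: x);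
  gsub_part : forall i x, I x -> I (mpart i x)
}.
Hypothesis hI : graded_submodule.

Definition quo_rel : rel M := fun x y => `[< I (x - y) >].

Fact quo_rel_refl : reflexive quo_rel.
Proof. by move=> x; apply/asboolP; rewrite subrr; exact: gsub0. Qed.
Fact quo_rel_sym : symmetric quo_rel.
Proof.
suff S x y : I (x - y) -> I (y - x) by move=> x y; apply/asboolP/asboolP; apply: S.
by move=> xy; rewrite -opprB -sub0r; apply: gsubB => //; exact: gsub0.
Qed.
Fact quo_rel_trans : transitive quo_rel.
Proof.
move=> y x z /asboolP xy; rewrite [quo_rel y z]quo_rel_sym => /asboolP zy.
by apply/asboolP; have := gsubB hI xy zy; rewrite opprB addrA subrK.
Qed.

Definition quo_equiv := EquivRel quo_rel quo_rel_refl quo_rel_sym quo_rel_trans.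
Definition quo := {eq_quot quo_equiv}.
HB.instance Definition _ := Choice.on quo.
HB.instance Definition _ := EqQuotient.on quo.

Definition quo_class (x : M) : quo := \pi_quo x.

Lemma quo_classP x y : quo_class x = quo_class y <-> I (x - y).
Proof.
split; first by move=> /eqmodP /asboolP.
by move=> xy; apply/eqmodP/asboolP.
Qed.
Lemma quo_classW (P : quo -> Prop) : (forall x, P (quo_class x)) -> forall x, P x.
Proof. by move=> Px; elim/quotW. Qed.
Lemma quo_repr x : I (repr (quo_class x) - x).
Proof. by apply/quo_classP; rewrite /quo_class reprK. Qed.

Definition quo_opp (x : quo) : quo := quo_class (- repr x).
Definition quo_add (x y : quo) : quo := quo_class (repr x + repr y).
Definition quo_scale (a : A) (x : quo) : quo := quo_class (a *: repr x).

Lemma quo_oppE x : quo_opp (quo_class x) = quo_class (- x).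
Proof.
apply/quo_classP; rewrite -opprB -[- _]sub0r; apply: gsubB => //; first exact: gsub0.
by rewrite opprK addrC; exact: quo_repr.
Qed.
Lemma quo_addE x y : quo_add (quo_class x) (quo_class y) = quo_class (x + y).
Proof.
apply/quo_classP; rewrite opprD addrACA -[_ + (_ - y)]opprK opprD -[X in I X]opprK.
rewrite opprK opprD; have := gsubB hI (gsubB hI (gsub0 hI) (quo_repr x)) (quo_repr y).
by move=> /(gsubB hI (gsub0 hI)); rewrite sub0r opprD !opprK sub0r opprK.
Qed.
Lemma quo_scaleE a x : quo_scale a (quo_class x) = quo_class (a *: x).
Proof. by apply/quo_classP; rewrite -scalerBr; apply: gsubZ => //; exact: quo_repr. Qed.

Let quoE := (quo_oppE, quo_addE, quo_scaleE).

Fact quo_addA : associative quo_add.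
Proof.
by elim/quo_classW=> x; elim/quo_classW=> y; elim/quo_classW=> z; rewrite !quoE addrA.
Qed.
Fact quo_addC : commutative quo_add.
Proof. by elim/quo_classW=> x; elim/quo_classW=> y; rewrite !quoE addrC. Qed.
Fact quo_add0 : left_id (quo_class 0) quo_add.
Proof. by elim/quo_classW=> x; rewrite !quoE add0r. Qed.
Fact quo_addN : left_inverse (quo_class 0) quo_opp quo_add.
Proof. by elim/quo_classW=> x; rewrite !quoE addNr. Qed.
HB.instance Definition _ :=
  GRing.isZmodule.Build quo quo_addA quo_addC quo_add0 quo_addN.

Fact quo_scaleA a b x : quo_scale a (quo_scale b x) = quo_scale (a * b) x.
Proof. by elim/quo_classW: x => x; rewrite !quoE scalerA. Qed.
Fact quo_scale1 : left_id 1 quo_scale.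
Proof. by elim/quo_classW=> x; rewrite !quoE scale1r. Qed.
Fact quo_scaleDr : right_distributive quo_scale +%R.
Proof.
move=> a; elim/quo_classW=> x; elim/quo_classW=> y.
by rewrite -![_ + _ in LHS]/(quo_add _ _) -[RHS]/(quo_add _ _) !quoE scalerDr.
Qed.
Fact quo_scaleDl x : {morph quo_scale^~ x : a b / a + b}.
Proof.
move=> a b; elim/quo_classW: x => x.
by rewrite -[RHS]/(quo_add _ _) !quoE scalerDl.
Qed.
HB.instance Definition _ := GRing.Zmodule_isLmodule.Build A quo
  quo_scaleA quo_scale1 quo_scaleDr quo_scaleDl.

Fact quo_class_linear : linear quo_class.
Proof.
move=> a x y; rewrite -[RHS]/(quo_add (quo_scale _ _) _).
by rewrite !quoE.
Qed.
HB.instance Definition _ :=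
  GRing.isLinear.Build A M quo *:%R quo_class quo_class_linear.

Definition quo_comp i : set quo := [set quo_class x | x in grmod_comp i]%classic.

Lemma quo_grading : is_grading quo_comp.
Proof.
have gM := grmod_grading M.
split=> [i|i _ _ [x xi <-] [y yi <-]|x|s f us fg s0 i is_].
- by exists 0; [exact: gr0 gM i|exact: raddf0].
- by exists (x - y); [exact: grB gM _ _ _ xi yi|exact: raddfB].
- elim/quo_classW: x => x; have [s [sg ->]] := grading_span gM x.
  exists (map quo_class s); rewrite big_map raddf_sum; split=> // _ /mapP[y ys ->].
  by have [i yi] := sg _ ys; exists i; exists y.
- pose h j := projT1 (cid2 (fg j)).
  have hE j : quo_class (h j) = f j by rewrite /h; case: cid2.
  have hj j : grmod_comp j (h j) by rewrite /h; case: cid2.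
  have : I (\sum_(j <- s) h j).
    rewrite -[X in I X]subr0; apply/quo_classP; rewrite [RHS]raddf0 raddf_sum -[RHS]s0.
    by apply: eq_bigr => j _; exact: hE.
  move=> /(gsub_part hI i).
  have -> : mpart i (\sum_(j <- s) h j) = h i.
    have D : decomposes (@grmod_comp _ _ M) (\sum_(j <- s) h j)
        (s, fun j => if j \in s then h j else 0).
      split=> //= [j|j /negbTE -> //|].
      - by case: ifP => _; [exact: hj|exact: gr0 gM j].
      - by rewrite big_seq_cond [RHS]big_seq_cond; apply: eq_bigr => j /andP[->].
    by rewrite /mpart (partE (grmod_grading M) i D) /= is_.
  by rewrite -[h i]subr0 => /quo_classP; rewrite hE raddf0.
Qed.

Lemma quo_act i j (a : A) x :
  gralg_comp i a -> quo_comp j x -> quo_comp (i + j) (a *: x).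
Proof.
move=> ai [y yj <-]; exists (a *: y); first exact: grmod_act.
by rewrite linearZ.
Qed.

Definition quotient : grmodule A := GrModule quo_grading quo_act.

Lemma quo_class_deg i x : grmod_comp i x -> @grmod_comp _ _ quotient i (quo_class x).
Proof. by exists x. Qed.
Definition quo_proj : grhom M quotient :=
  @GrHom _ _ M quotient quo_class quo_class_deg.

Lemma quo_proj_eq0 x : quo_proj x = 0 <-> I x.
Proof.
rewrite -[0]/(quo_class 0) -[quo_proj x]/(quo_class x) -[X in I X]subr0.
exact: quo_classP.
Qed.
End Quotient.

(** * The central operator H *)

Section Central.
Variables (K : numFieldType) (v : {poly K}).
Notation A := (GWA v).
Notation pol := (@gwa_poly K v).
Implicit Types M N : grmodule A.

(** H is h - i in degree i. *)
Definition hact (p : {poly K}) (i : int) : A := pol (shp (- i%:~R) p).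

Lemma hact_deg p i : @gralg_comp _ A 0 (hact p i).
Proof. exact: gwa_comp_poly. Qed.

Lemma hactM p q i : hact (p * q) i = hact p i * hact q i.
Proof. by rewrite /hact shpM gwa_polyM. Qed.
Lemma hactD p q i : hact (p + q) i = hact p i + hact q i.
Proof. by rewrite /hact shpD gwa_polyD. Qed.
Lemma hactN p i : hact (- p) i = - hact p i.
Proof. by apply/eqP; rewrite -addr_eq0 -hactD addNr /hact shpp0 pol0. Qed.
Lemma hact1 i : hact 1 i = 1.
Proof. by rewrite /hact shp1 pol1. Qed.
Lemma hact0 i : hact 0 i = 0.
Proof. by rewrite /hact shpp0 pol0. Qed.
Lemma hactC c i : hact c%:P i = c%:A.
Proof. by rewrite /hact shpC -[RHS]/(pol c%:P * 1) mulr1. Qed.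
Lemma hact_deg0 p : hact p 0 = pol p.
Proof. by rewrite /hact oppr0 shp0. Qed.
Lemma hact_shift p (k i : int) : hact (shp k%:~R p) i = hact p (i - k).
Proof. by rewrite /hact shp_shp -[_ + k%:~R]opprK opprD opprK -intrB. Qed.

Lemma hact_comm j a p i : @gralg_comp _ A j a ->
  hact p (j + i) * a = a * hact p i.
Proof.
move=> ja; rewrite /hact (pol_comm _ ja) shp_shp intrD opprD addrA subrr.
by rewrite add0r.
Qed.

Definition acts M (f : grhom M M) p :=
  forall i x, grmod_comp i x -> f x = hact p i *: x.

Lemma acts_uniq M (f g : grhom M M) p : acts f p -> acts g p -> f = g.
Proof. by move=> fp gp; apply: grhom_homog_ext => i x xi; rewrite (fp i) // (gp i). Qed.

Lemma hact_grmod p i M (x : M) : grmod_comp i x -> grmod_comp i (hact p i *: x).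
Proof. by move=> xi; rewrite -[X in grmod_comp X]add0r; apply: grmod_act xi; exact: hact_deg. Qed.

Section Hop.
Variables (p : {poly K}) (M : grmodule A).
Let gM := grmod_grading M.

Definition hop_fun (x : M) : M := glue gM (fun i y => hact p i *: y) x.

Lemma hop_homog i x : grmod_comp i x -> hop_fun x = hact p i *: x.
Proof. by move=> xi; apply: glue_homog xi => j; exact: scaler0. Qed.

Lemma hop_linear : linear hop_fun.
Proof.
have hD x y : hop_fun (x + y) = hop_fun x + hop_fun y.
  by apply: glueD => i {}x {}y; exact: scalerDr.
have h0 : hop_fun 0 = 0 by rewrite (@hop_homog 0) ?scaler0 //; exact: gr0 gM 0.
move=> a x y; rewrite hD; congr (_ + _).
elim/(homog_ind (gralg_grading A)): a => [|a b IHa IHb|j a aj].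
- by rewrite !scale0r h0.
- by rewrite !scalerDl hD IHa IHb.
elim/(homog_ind gM): x => [|x z IHx IHz|i x xi].
- by rewrite !scaler0 h0 scaler0.
- by rewrite !(scalerDr, hD) IHx IHz.
rewrite (hop_homog (grmod_act aj xi)) (hop_homog xi) !scalerA.
by rewrite hact_comm.
Qed.
HB.instance Definition _ :=
  GRing.isLinear.Build A M M *:%R hop_fun hop_linear.

Lemma hop_deg i x : grmod_comp i x -> grmod_comp i (hop_fun x).
Proof. by move=> xi; rewrite (hop_homog xi); exact: hact_grmod. Qed.
Definition hop : grhom M M := GrHom hop_deg.
Lemma hop_acts : acts hop p.
Proof. by move=> i x xi; exact: hop_homog. Qed.
End Hop.

Lemma acts_natural M N (f : grhom M M) (g : grhom N N) (h : grhom M N) p :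
  acts f p -> acts g p -> grhom_comp g h = grhom_comp h f.
Proof.
move=> fp gp; apply: grhom_homog_ext => i x xi /=.
by rewrite (gp _ _ (grhom_deg h xi)) (fp _ _ xi) linearZ.
Qed.

Lemma acts_comp M (f g : grhom M M) p q :
  acts f p -> acts g q -> acts (grhom_comp f g) (p * q).
Proof.
move=> fp gq i x xi /=.
by rewrite (gq _ _ xi) (fp _ _ (hact_grmod q xi)) hactM scalerA.
Qed.
Lemma acts_add M (f g : grhom M M) p q : acts f p -> acts g q -> acts (f + g) (p + q).
Proof. by move=> fp gq i x xi; rewrite hactD scalerDl -(fp _ _ xi) -(gq _ _ xi). Qed.
Lemma acts_id M : acts (grhom_id M) 1.
Proof. by move=> i x _; rewrite hact1 scale1r. Qed.
Lemma acts0 M : acts (0 : grhom M M) 0.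
Proof. by move=> i x _; rewrite hact0 scale0r. Qed.
Lemma acts_scale M (f : grhom M M) c p : acts f p -> acts (c *: f) (c *: p).
Proof.
move=> fp i x xi; rewrite -mul_polyC hactM hactC -scalerA -(fp _ _ xi).
by [].
Qed.
(** * The free modules generated in one degree *)

Section Regular.
Let reg : lmodType A := (A : algType K)^o.
Lemma reg_act i j (a : A) (x : reg) :
  gralg_comp i a -> @gralg_comp _ A j x -> @gralg_comp _ A (i + j) (a *: x).
Proof. exact: gralg_mul. Qed.
Definition regular : grmodule A := @GrModule _ A reg _ (gralg_grading A) reg_act.
End Regular.

Definition free (m : int) : grmodule A := shift (- m) regular.

Lemma free_compE m i (x : free m) : grmod_comp i x = @gwa_comp _ v (i - m) x.
Proof. by []. Qed.
Lemma free_gen_deg m : @grmod_comp _ _ (free m) m (1 : A).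
Proof. by rewrite free_compE subrr; exact: (@gralg_one _ A). Qed.

Section Yoneda.
Variables (m : int) (M : grmodule A) (x : M) (xm : grmod_comp m x).
Definition yoneda_fun (a : free m) : M := (a : A) *: x.
Fact yoneda_linear : linear yoneda_fun.
Proof. by move=> a b c; rewrite /yoneda_fun scalerDl scalerA. Qed.
HB.instance Definition _ :=
  GRing.isLinear.Build A (free m) M *:%R yoneda_fun yoneda_linear.
Fact yoneda_deg i a : @grmod_comp _ _ (free m) i a -> grmod_comp i (yoneda_fun a).
Proof. by move=> ai; rewrite -(subrK m i); apply: grmod_act xm. Qed.
Definition yoneda : grhom (free m) M := GrHom yoneda_deg.
End Yoneda.

Lemma yoneda1 m M (x : M) (xm : grmod_comp m x) : yoneda xm (1 : A) = x.
Proof. exact: scale1r. Qed.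

Lemma free_homE m M (f : grhom (free m) M) (a : free m) : f a = (a : A) *: f (1 : A).
Proof. by rewrite -linearZ /=; congr (f _); rewrite -[RHS]/((a : A) * 1) mulr1. Qed.

Lemma free_hom_ext m M (f g : grhom (free m) M) : f (1 : A) = g (1 : A) -> f = g.
Proof. by move=> fg; apply: grhom_ext => a; rewrite free_homE fg -free_homE. Qed.

(** Right multiplication by p(h) is left multiplication by a translate of p(h)
    that depends on the degree, which is p(H). *)
Lemma free_acts m (f : grhom (free m) (free m)) p :
  f (1 : A) = hact p m -> acts f p.
Proof.
move=> f1 i x; rewrite free_compE free_homE f1 => xi.
by rewrite -[in RHS](subrK m i) -[RHS]/(hact p _ * (x : A)) (hact_comm _ _ xi).
Qed.

Lemma gwa_comp0E (x : A) : @gralg_comp _ A 0 x -> exists p, x = pol p.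
Proof. by move=> /gwa_compE[p ->]; exists p; rewrite mulr1. Qed.

Lemma free_end m (f : grhom (free m) (free m)) : exists p, acts f p.
Proof.
have := grhom_deg f (free_gen_deg m); rewrite free_compE subrr => /gwa_comp0E[p f1].
exists (shp m%:~R p); apply: free_acts; rewrite f1 /hact shp_shp addNr shp0.
by [].
Qed.

Lemma free_faithful m p : v != 0 -> acts (0 : grhom (free m) (free m)) p -> p = 0.
Proof.
move=> v0 /(_ _ _ (free_gen_deg m)) /esym; rewrite -[LHS]/(hact p m * 1) mulr1.
by rewrite -[RHS]/(pol 0) => /pol_inj/eqP; rewrite shp_eq0 => /eqP.
Qed.

Definition edges_between (w : {poly K}) (m n : int) : {poly K} :=
  if m <= n then edges w m `|n - m|%N else edges w n `|m - n|%N.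

Lemma tpow_edges m n :
  tpow v (m - n) * tpow v (n - m) = hact (edges_between v m n) m.
Proof.
rewrite /edges_between /hact -rmorphN.
case: leP => mn; rewrite shp_edges.
  have -> : n - m = `|n - m|%N by lia.
  have -> : m - n = - (`|n - m|%N : int) by lia.
  by rewrite tpow_neg tmX_tpX addNr.
have -> : n - m = - (`|m - n|%N : int) by lia.
have -> : m - n = `|m - n|%N by lia.
rewrite tpow_neg tpX_tmX; congr (pol (edges _ _ _)); lia.
Qed.

(** In degrees j and -j, the algebra is K[h] t_+^j and K[h] t_-^j, so every
    round trip between two degrees is a multiple of the obvious one. *)
Lemma free_round_trip_dvd m n (f : grhom (free m) (free n))
    (g : grhom (free n) (free m)) p :
  acts (grhom_comp g f) p -> edges_between v m n %| p.
Proof.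
move=> /(_ _ _ (free_gen_deg m)) /=.
have := grhom_deg f (free_gen_deg m); rewrite free_compE => /gwa_compE[q f1].
have := grhom_deg g (free_gen_deg n); rewrite free_compE => /gwa_compE[r g1].
rewrite f1 free_homE g1 -[LHS]/((_ : A) * _) -[RHS]/(hact p m * 1) mulr1.
have tr : tpow v (m - n) * pol r = pol (shp (- (m - n)%:~R) r) * tpow v (m - n).
  by rewrite (pol_comm _ (tpow_deg v (m - n))) shp_shp subrr shp0.
rewrite mulrA -[X in X * _]mulrA tr mulrA -mulrA tpow_edges -!gwa_polyM => /pol_inj e.
apply/dvdpP; exists (shp m%:~R (q * shp (- (m - n)%:~R) r)).
by rewrite -[p]shp0 -(subrr m%:~R) -shp_shp -e shpM !shp_shp subrr !shp0.
Qed.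

Lemma free_round_trip m n : exists (f : grhom (free m) (free n))
    (g : grhom (free n) (free m)), acts (grhom_comp g f) (edges_between v m n).
Proof.
have fm : @grmod_comp _ _ (free n) m (tpow v (m - n) : A).
  by rewrite free_compE; exact: tpow_deg.
have gn : @grmod_comp _ _ (free m) n (tpow v (n - m) : A).
  by rewrite free_compE; exact: tpow_deg.
exists (yoneda fm), (yoneda gn); apply: free_acts => /=.
by rewrite -tpow_edges -[LHS]/((1 * tpow v (m - n)) * tpow v (n - m)) mul1r.
Qed.
End Central.
Arguments hop_acts {K v} p M [i x] _.
Arguments acts_id {K v} M [i x] _.
Arguments acts0 {K v} M [i x] _.

(** * Equivalences of categories *)

Section Equivalence.
Variables (C D : category) (F : functor C D).

Hypothesis eF : is_equivalence F.

Lemma equiv_faithful (X Y : C) (f g : hom X Y) : fmap F f = fmap F g -> f = g.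
Proof.
case: eF => G [[eta [etaI etaN]] _] fg.
have /= := etaN _ _ f; have /= := etaN _ _ g; rewrite fg => -> e.
have [k [_ ek]] := etaI X.
by move/(congr1 (fun h => comp h k)): e; rewrite -!compA ek !comp_idr.
Qed.

Lemma equiv_full (X Y : C) (h : hom (F X) (F Y)) : exists f, fmap F f = h.
Proof.
case: (eF) => G [[eta [etaI etaN]] [eps [epsI epsN]]].
have Gfaithful U V (f g : hom U V) : fmap G f = fmap G g -> f = g.
  move=> fg; have /= := epsN _ _ f; have /= := epsN _ _ g; rewrite fg => -> e.
  have [k [_ ek]] := epsI U.
  by move/(congr1 (fun h => comp h k)): e; rewrite -!compA ek !comp_idr.
have [k [ke ek]] := etaI X; have [l [le el]] := etaI Y.
pose f := comp (eta Y) (comp (fmap G h) k); exists f; apply: Gfaithful.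
have /= e := etaN _ _ f.
have -> : fmap G (fmap F f) = comp l (comp f (eta X)) by rewrite -e compA le comp_idl.
by rewrite /f -!compA ke comp_idr compA le comp_idl.
Qed.

Lemma equiv_ess (Y : D) : exists X, isomorphic (F X) Y.
Proof.
by case: (eF) => G [_ [eps [epsI _]]]; exists (G Y), (eps Y); exact: epsI.
Qed.
End Equivalence.

Lemma equiv_inverse (C D : category) (F : functor C D) : is_equivalence F ->
  exists2 G : functor D C, is_equivalence G & forall Y, isomorphic (F (G Y)) Y.
Proof.
move=> [G [e1 e2]]; exists G; first by exists F.
by case: e2 => eps [epsI _] Y; exists (eps Y); exact: epsI.
Qed.

Section Separating.
Variable C : category.

Definition separating (I : Type) (B : I -> C) :=
  forall (X Y : C) (f g : hom X Y),
    (forall n (phi : hom (B n) X), comp f phi = comp g phi) -> f = g.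
End Separating.

Lemma equiv_separating (C D : category) (F : functor C D) (I : Type) (B : I -> C) :
  is_equivalence F -> separating B -> separating (fun i => F (B i)).
Proof.
move=> eF sB X Y f g fg.
have [X' [a [a' [a'a aa']]]] := equiv_ess eF X.
have [Y' [b [b' [b'b bb']]]] := equiv_ess eF Y.
have [f' Ff] := equiv_full eF (comp b' (comp f a)).
have [g' Fg] := equiv_full eF (comp b' (comp g a)).
have E : f' = g'.
  apply: sB => n phi; apply: (equiv_faithful eF); rewrite !fmap_comp Ff Fg -!compA.
  by rewrite fg.
have e : comp b' (comp f a) = comp b' (comp g a) by rewrite -Ff -Fg E.
move/(congr1 (fun h => comp b (comp h a'))): e.
by rewrite -!compA aa' !comp_idr !compA bb' !comp_idl.
Qed.

(** * Factoring an identity through a separating family *)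

Section Trace.
Variables (K : numFieldType) (v : {poly K}).
Notation A := (GWA v).

(** Maps out of the free module generated in degree m are elements of degree m. *)
Lemma free_separating : @separating (grMod A) int (fun m => free v m).
Proof.
move=> X Y f g fg; apply: grhom_homog_ext => i x xi.
have := congr1 (fun h : grhom (free v i) Y => grhom_fun h (1 : A)) (fg i (yoneda xi)).
by rewrite /= /yoneda_fun scale1r.
Qed.

(** X is a retract of a finite direct sum of members of the family B. The bound
    on their indices is what later controls degrees uniformly. *)
Definition finitely_through (A' : gralg K) (B : int -> grmodule A') (X : grmodule A') :=
  exists (N : nat) (s : seq (grhom X X)),
    (forall e, e \in s -> exists n (f : grhom (B n) X) (g : grhom X (B n)),
       (`|n| <= N)%N /\ e = grhom_comp f g) /\
    \sum_(e <- s) e = grhom_id X.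

Lemma grhom_sumE (A' : gralg K) (X Y : grmodule A') (s : seq (grhom X Y)) x :
  (\sum_(e <- s) e : grhom X Y) x = \sum_(e <- s) e x.
Proof. exact: (big_morph (fun f : grhom X Y => f x)). Qed.

Variables (B : int -> grmodule A) (m : int).

Inductive trace : set (free v m) :=
| trace0 : trace 0
| traceB x y : trace x -> trace y -> trace (x - y)
| trace_im n (phi : grhom (B n) (free v m)) y : trace (phi y).

Lemma trace_submodule : graded_submodule trace.
Proof.
split; [exact: trace0|exact: traceB|move=> a x|move=> i x]; elim=> {x}.
- by rewrite scaler0; exact: trace0.
- by move=> x y _ IHx _ IHy; rewrite scalerBr; exact: traceB.
- by move=> n phi y; rewrite -linearZ; exact: trace_im.
- by rewrite /mpart part0; exact: trace0.
- by move=> x y _ IHx _ IHy; rewrite /mpart partB; exact: traceB.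
- by move=> n phi y; rewrite -grhom_part; exact: trace_im.
Qed.

(** An element phi(y) of degree m is the image of 1 under the endomorphism that
    goes through B_n by 1 |-> y. *)
Lemma trace_endos x : trace x -> exists (N : nat) (s : seq (grhom (free v m) (free v m))),
  (forall e, e \in s -> exists n (f : grhom (B n) (free v m)) (g : grhom (free v m) (B n)),
       (`|n| <= N)%N /\ e = grhom_comp f g) /\
  \sum_(e <- s) e (1 : A) = mpart m x.
Proof.
elim=> {x} [|x y _ [N [s [sP sx]]] _ [N' [t [tP ty]]]|n phi y].
- by exists 0, [::]; split=> //; rewrite big_nil /mpart part0.
- exists (maxn N N'), (s ++ map -%R t); split=> [e|]; last first.
    by rewrite big_cat big_map sumrN sx ty /mpart partB.
  rewrite mem_cat => /orP[/sP|/mapP[e' /tP]].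
    by move=> [n [f [g [nN ->]]]]; exists n, f, g; rewrite leq_max nN.
  move=> [n [f [g [nN ->]]]] ->; exists n, f, (- g); rewrite leq_max nN orbT; split=> //.
  by apply: grhom_ext => z /=; rewrite raddfN.
- have ym : grmod_comp m (mpart m y) by exact: part_comp.
  exists `|n|%N, [:: grhom_comp phi (yoneda ym)]; split=> [e|]; last first.
    by rewrite big_seq1 /= -grhom_part; congr (phi _); exact: yoneda1.
  by rewrite inE => /eqP ->; exists n, phi, (yoneda ym).
Qed.

(** The projection to the cokernel of all maps from the B_n to a free module
    vanishes on these maps, hence vanishes, as the B_n separate morphisms; so the
    generator 1 is a finite sum of elements in the images. *)
Lemma free_through : @separating (grMod A) int B -> finitely_through B (free v m).
Proof.
move=> sB; have t1 : trace (1 : A).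
  apply/(quo_proj_eq0 trace_submodule).
  suff -> : quo_proj trace_submodule = 0 by [].
  apply: sB => n phi; apply: grhom_ext => y.
  by apply/(quo_proj_eq0 trace_submodule); exact: trace_im.
have [N [s [sP s1]]] := trace_endos t1; exists N, s; split=> //.
apply: free_hom_ext; rewrite grhom_sumE s1 /mpart.
exact: part_id (free_gen_deg v m).
Qed.
End Trace.

(** * The center and the shift *)

Lemma nat_zeros_poly (K : numFieldType) (p : {poly K}) :
  (forall n : nat, p.[n%:R] = 0) -> p = 0.
Proof.
move=> p0; apply/(@roots_geq_poly_eq0 K _ [seq (n%:R : K) | n <- iota 0 (size p)]).
- by apply/allP => _ /mapP[n _ ->]; rewrite rootE p0.
- by rewrite map_inj_uniq ?iota_uniq // => m n /eqP; rewrite eqr_nat => /eqP.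
- by rewrite size_map size_iota.
Qed.

Lemma translation_poly (K : numFieldType) (p : {poly K}) :
  shp 1 p - p - 1 = 0 -> exists mu, p = 'X + mu%:P.
Proof.
move=> d0; pose q := p - 'X; exists q.[0].
have qS x : q.[x + 1] = q.[x].
  have := congr1 (fun r => r.[x]) d0.
  rewrite /q /= !hornerE horner_shp => /eqP; rewrite subr_eq0 subr_eq => /eqP ->.
  by ring.
have qn n : q.[n%:R] = q.[0] by elim: n => // n IH; rewrite -natr1 qS.
have /eqP : q - q.[0]%:P = 0.
  by apply: nat_zeros_poly => n; rewrite hornerD hornerN hornerC qn subrr.
by rewrite subr_eq0 => /eqP <-; rewrite /q addrC subrK.
Qed.

Lemma acts_sum (K : numFieldType) (v : {poly K}) (M : grmodule (GWA v))
    (s : seq (grhom M M)) (p : grhom M M -> {poly K}) :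
  (forall e, e \in s -> acts e (p e)) -> acts (\sum_(e <- s) e) (\sum_(e <- s) p e).
Proof.
move=> ap; rewrite big_seq [X in acts _ X]big_seq.
apply: (big_ind2 (@acts _ _ M)) => // [|f q g r]; first exact: acts0.
exact: acts_add.
Qed.

Section Annihilators.
Variables (K : numFieldType) (v : {poly K}).
Implicit Types M N : grmodule (GWA v).

(** p(H) = 0 on M. *)
Definition killed M p := acts (0 : grhom M M) p.

Lemma killedM M p q : killed M p -> killed M (q * p).
Proof.
move=> kp; have := acts_comp (hop_acts q M) kp.
by congr acts; apply: grhom_ext => x; rewrite /= raddf0.
Qed.
Lemma killedD M p q : killed M p -> killed M q -> killed M (p + q).
Proof. by move=> kp kq; have := acts_add kp kq; rewrite addr0. Qed.
Lemma killedB M p q : killed M p -> killed M q -> killed M (p - q).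
Proof. by move=> kp kq; apply: killedD => //; rewrite -mulN1r; exact: killedM. Qed.
Lemma killed_coprime M p q : coprimep p q -> killed M p -> killed M q ->
  grhom_id M = 0.
Proof.
move=> /Bezout_eq1_coprimepP[[a b] /= e] kp kq.
apply: (acts_uniq (acts_id M)); rewrite -e.
by apply: killedD; exact: killedM.
Qed.
Lemma killed_iso M N p : @isomorphic (grMod (GWA v)) M N -> killed M p -> killed N p.
Proof.
move=> [f [g [_ fg]]] kp i x xi; rewrite /=.
have e := congr1 (fun h : grhom N N => grhom_fun h x) fg.
rewrite -[x]e /= -linearZ -(kp _ _ (grhom_deg (g : grhom N M) xi)).
by rewrite /= raddf0.
Qed.
(** H on M[1] is H + 1 on M. *)
Lemma killed_shift M p : killed M p -> killed (shift 1 M) (shp (-1) p).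
Proof.
move=> kp i x xi; have -> : shp (-1) p = shp (-1)%:~R p by rewrite mulrN1z.
rewrite hact_shift opprK.
exact: (kp (i + 1) x xi).
Qed.
Lemma killed_unshift M p : killed (shift 1 M) p -> killed M (shp 1 p).
Proof.
move=> kp i x xi; rewrite (_ : shp 1 p = shp 1%:~R p) // hact_shift.
by apply: (kp (i - 1) x); rewrite /= /shift_comp subrK.
Qed.

(** The cokernel of H - c on a free module. It does not vanish since h - c is not
    invertible in K[h]. *)
Lemma exists_fibre c : exists M, killed M ('X - c%:P) /\ grhom_id M <> 0.
Proof.
pose f := hop ('X - c%:P) (free v 0).
pose I : set (free v 0) := [set f x | x in [set: free v 0]]%classic.
have hI : graded_submodule I.
  split=> [|_ _ [x _ <-] [y _ <-]|a _ [x _ <-]|i _ [x _ <-]].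
  - by exists 0 => //; exact: raddf0.
  - by exists (x - y) => //; exact: raddfB.
  - by exists (a *: x) => //; exact: linearZ.
  - by exists (mpart i x) => //; exact: grhom_part.
exists (quotient hI); split=> [i _ [x xi <-]|].
  rewrite -[quo_class hI x]/(quo_proj hI x) -linearZ; apply/esym/quo_proj_eq0.
  by exists x => //; exact: (hop_acts _ _ xi).
move=> /(congr1 (fun h : grhom (quotient hI) (quotient hI) =>
  grhom_fun h (quo_proj hI (1 : GWA v)))) /= /quo_proj_eq0[x _].
move=> /(congr1 (mpart 0)); rewrite -grhom_part.
have x0 := part_comp (grmod_grading (free v 0)) 0 x; move: x0.
rewrite -/(mpart 0 x); move: (mpart 0 x) => {}x x0.
rewrite (hop_acts _ _ x0) (_ : mpart 0 _ = (1 : GWA v) :> free v 0); last first.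
  exact: part_id (free_gen_deg v 0).
move: x0 => /= /gwa_comp0E[p ->].
rewrite hact_deg0 -[LHS]/(_ * _) -gwa_polyM -[RHS]/(gwa_poly v 1) => /pol_inj.
by move=> /(congr1 (fun q => q.[c])); rewrite !hornerE subrr mul0r => /eqP; rewrite eq_sym oner_eq0.
Qed.
End Annihilators.

Section CenterTransport.
Variables (K : numClosedFieldType) (v1 v2 : {poly K}).
Hypotheses (v1_neq0 : v1 != 0).
Notation A1 := (GWA v1).
Notation A2 := (GWA v2).
Variable F : functor (grMod A2) (grMod A1).
Hypotheses (eF : is_equivalence F) (lF : klinear F)
  (sF : forall M : grMod A2, isomorphic (F (shift 1 M)) (shift 1 (F M))).

Definition Fmap (M N : grmodule A2) (f : grhom M N) : grhom (F M) (F N) := fmap F f.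

Lemma FmapD M N (f g : grhom M N) : Fmap (f + g) = Fmap f + Fmap g.
Proof. by have := lF 1 f g; rewrite !scale1r. Qed.
Lemma Fmap0 M N : Fmap (0 : grhom M N) = 0.
Proof. by apply/eqP; rewrite -(inj_eq (addrI (Fmap 0))) -FmapD !addr0. Qed.
Lemma FmapZ M N c (f : grhom M N) : Fmap (c *: f) = c *: Fmap f.
Proof. by have := lF c f 0; rewrite !addr0 -/(Fmap _) -/(Fmap 0) Fmap0 addr0. Qed.
Lemma Fmap_comp L M N (f : grhom M N) (g : grhom L M) :
  Fmap (grhom_comp f g) = grhom_comp (Fmap f) (Fmap g).
Proof. exact: (fmap_comp F f g). Qed.
Lemma Fmap_id M : Fmap (grhom_id M) = grhom_id (F M).
Proof. exact: (fmap_id F M). Qed.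
Lemma Fmap_sum M N (s : seq (grhom M N)) :
  Fmap (\sum_(f <- s) f) = \sum_(f <- s) Fmap f.
Proof. by apply: (big_morph (@Fmap M N)); [exact: FmapD|exact: Fmap0]. Qed.

Notation H2 M := (hop 'X M).

(** Up to isomorphism every graded T(v1)-module is some F(M), so the F(H) define a
    natural endomorphism of the identity functor. On the free modules it is a
    polynomial in H; naturality along t^m makes it the same one for all of them,
    and along the maps out of free modules it carries over to all modules. *)
Lemma center_image : exists p0, forall M : grmodule A2, acts (Fmap (H2 M)) p0.
Proof.
have [G eG FG] := equiv_inverse eF.
have dat m : exists (Gm : grmodule A2) (e : grhom (F Gm) (free v1 m))
    (e' : grhom (free v1 m) (F Gm)), grhom_comp e' e = grhom_id _ /\
      grhom_comp e e' = grhom_id _.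
  by have [e [e' [h1 h2]]] := FG (free v1 m); exists (G (free v1 m)), e, e'.
have nat m (Gm : grmodule A2) (e : grhom (F Gm) (free v1 m))
    (e' : grhom (free v1 m) (F Gm)) p :
    grhom_comp e' e = grhom_id _ -> grhom_comp e e' = grhom_id _ ->
    acts (grhom_comp e (grhom_comp (Fmap (H2 Gm)) e')) p ->
    forall M x, grmod_comp m x -> Fmap (H2 M) x = hact v1 p m *: x.
  move=> e'e ee' ap M x xm; pose phi := yoneda xm.
  have [psi Fpsi] := equiv_full eF (grhom_comp phi e : @hom (grMod A1) _ _).
  have e1 : grhom_comp (Fmap (H2 M)) (Fmap psi) = grhom_comp (Fmap psi) (Fmap (H2 Gm)).
    by rewrite -!Fmap_comp; congr Fmap; exact: acts_natural (hop_acts _ _) (hop_acts _ _).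
  have ps y : Fmap psi y = phi (e y).
    by have -> : Fmap psi = grhom_comp phi e by [].
  have ee'1 : e (e' (1 : A1)) = (1 : A1).
    exact: (congr1 (fun h : grhom (free v1 m) (free v1 m) => grhom_fun h (1 : A1)) ee').
  have phi1 : phi (1 : A1) = x by exact: yoneda1.
  have e2 : Fmap (H2 M) (Fmap psi (e' (1 : A1))) = Fmap psi (Fmap (H2 Gm) (e' (1 : A1))).
    exact: (congr1 (fun h : grhom (F Gm) (F M) => grhom_fun h (e' (1 : A1))) e1).
  have ap1 : e (Fmap (H2 Gm) (e' (1 : A1))) = hact v1 p m *: ((1 : A1) : free v1 m).
    exact: ap _ _ (free_gen_deg v1 m).
  by move: e2; rewrite !ps ee'1 ap1 phi1 => ->; rewrite linearZ; congr (_ *: _).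
have [G0 [e0 [e0' [h1 h2]]]] := dat 0.
have [p0 ap0] := free_end (grhom_comp e0 (grhom_comp (Fmap (H2 G0)) e0')).
exists p0 => M m x xm.
have [Gm [e [e' [h3 h4]]]] := dat m.
have [p ap] := free_end (grhom_comp e (grhom_comp (Fmap (H2 Gm)) e')).
rewrite (nat _ _ _ _ _ h3 h4 ap M x xm); congr (hact _ _ _ *: _).
(* An element on which the polynomials found in degrees 0 and m both act. *)
pose t : free v1 0 := tpow v1 m.
have tm : grmod_comp m t by rewrite free_compE subr0; exact: tpow_deg.
have := ap0 _ _ tm.
rewrite /= (nat _ _ _ _ _ h3 h4 ap G0 (e0' t) (grhom_deg e0' tm)) linearZ.
have -> : e0 (e0' t) = t.
  exact: (congr1 (fun h : grhom (free v1 0) (free v1 0) => grhom_fun h t) h2).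
move=> /eqP; rewrite -subr_eq0 -scalerBl -hactN -hactD => /eqP.
move=> /(pol_tpow_eq0 v1_neq0)/eqP; rewrite shp_eq0 subr_eq0.
by move=> /eqP.
Qed.

Lemma center_image_comp p0 : (forall M : grmodule A2, acts (Fmap (H2 M)) p0) ->
  forall M (f : grhom M M) p, acts f p -> acts (Fmap f) (p \Po p0).
Proof.
move=> ap0 M f p fp; rewrite (acts_uniq fp (hop_acts p M)) {f fp}.
elim/poly_ind: p => [|p c IH].
  by rewrite comp_poly0 (acts_uniq (hop_acts 0 M) (acts0 M)) Fmap0; exact: acts0.
have e : hop (p * 'X + c%:P) M = grhom_comp (hop p M) (H2 M) + c *: grhom_id M.
  apply: acts_uniq (hop_acts _ _) _; apply: acts_add.
    exact: acts_comp (hop_acts _ _) (hop_acts _ _).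
  by rewrite -alg_polyC; apply: acts_scale; exact: acts_id.
rewrite e FmapD Fmap_comp FmapZ Fmap_id comp_polyD comp_polyM comp_polyX comp_polyC.
apply: acts_add; first exact: acts_comp.
by rewrite -alg_polyC; apply: acts_scale; exact: acts_id.
Qed.

(** Compatibility with the shift forces F(H) = H + mu: on the fibre over H = c,
    both p0 - c and p0(X + 1) - c - 1 vanish, so p0(X + 1) - p0 - 1 has a root in
    common with p0 - c, whatever c is. *)
Lemma center_translation :
  exists mu, forall M (f : grhom M M) p, acts f p -> acts (Fmap f) (shp mu p).
Proof.
have [p0 /center_image_comp ap0] := center_image.
suff [mu ep0] : exists mu, p0 = 'X + mu%:P by exists mu; rewrite /shp -ep0.
apply: translation_poly; set d := (_ - 1); apply/eqP/negPn/negP => d0.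
have [rs ed] := closed_field_poly_normal d.
have [c cP] : exists c, forall z, root d z -> p0.[z] != c.
  pose q := \prod_(y <- [seq p0.[z] | z <- rs]) ('X - y%:P).
  have q0 : q != 0 by rewrite monic_neq0 // monic_prod_XsubC.
  have [n qn] : exists n : nat, q.[n%:R] != 0.
    apply: contrapT => qn; move/eqP: q0; apply; apply: nat_zeros_poly => n.
    by apply/eqP/negPn/negP => h; apply: qn; exists n.
  exists n%:R => z; rewrite ed rootZ ?lead_coef_eq0 // root_prod_XsubC => zr.
  apply: contraNneq qn => <-; rewrite -rootE root_prod_XsubC; exact: map_f zr.
have [M [kM M0]] := exists_fibre v2 c.
have k1 : killed (F M) (p0 - c%:P).
  have := ap0 _ _ _ kM; rewrite Fmap0 rmorphB /= comp_polyX comp_polyC.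
  by [].
have k2 : killed (F M) (shp 1 (p0 - (c + 1)%:P)).
  apply: killed_unshift; apply: killed_iso (sF M) _.
  have := ap0 _ _ _ (killed_shift kM); rewrite Fmap0.
  congr acts; rewrite shpD shpX -polyCN shpC !comp_polyD comp_polyX !comp_polyC.
  by rewrite !polyCN polyCD; ring.
have kd : killed (F M) d.
  have := killedB k2 k1; congr acts.
  by rewrite shpD -polyCN shpC /d !polyCN !polyCD polyC1; ring.
have : coprimep d (p0 - c%:P).
  apply: Pdiv.ClosedField.root_coprimep => z dz; rewrite !hornerE subr_eq0.
  exact: cP.
move=> /killed_coprime/(_ kd k1) F0; apply: M0.
by apply: (equiv_faithful eF); rewrite -![fmap F _]/(Fmap _) Fmap_id Fmap0.
Qed.
End CenterTransport.

(** * Counting roots *)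

Section Tails.
Variable K : numClosedFieldType.
Implicit Types (w : {poly K}) (c : K) (n m : int).

Definition rootseq w : seq K := sval (closed_field_poly_normal w).
Lemma rootseqE w : w = lead_coef w *: \prod_(z <- rootseq w) ('X - z%:P).
Proof. exact: (svalP (closed_field_poly_normal w)). Qed.

Definition beyond c n : pred K := fun z => `[< exists2 k : int, z = c + k%:~R & n < k >].
Definition tail (s : seq K) c n : nat := count (beyond c n) s.

Lemma tail_shift s c (l : int) n : tail s (c + l%:~R) n = tail s c (l + n).
Proof.
apply: eq_count => z; apply/asboolP/asboolP => -[k -> nk].
- by exists (l + k); [rewrite intrD addrA|rewrite ltrD2l].
- exists (k - l); last by rewrite ltrBrDl.
  by rewrite -addrA -intrD [l + _]addrC subrK.
Qed.

Lemma beyondS c n z :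
  beyond c n z = (z == c + (n + 1)%:~R) || beyond c (n + 1) z.
Proof.
apply/asboolP/orP => [[k -> nk]|[/eqP ->|/asboolP[k -> nk]]].
- have [->|nk'] := eqVneq k (n + 1); [by left|right].
  by apply/asboolP; exists k => //; lia.
- by exists (n + 1) => //; lia.
- by exists k => //; lia.
Qed.

Lemma tailS s c n : tail s c n = (count_mem (c + (n + 1)%:~R)%R s + tail s c (n + 1)%R)%N.
Proof.
rewrite /tail -count_predUI (eq_count (beyondS c n)).
rewrite [X in (_ + X)%N](_ : _ = 0%N) ?addn0 //.
apply/eqP; rewrite -leqn0 leqNgt -has_count; apply/hasPn => z _ /=.
apply/negP => /andP[/eqP -> /asboolP[k e nk]].
by move: e => /addrI /intr_inj e; rewrite -e ltxx in nk.
Qed.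

Lemma tail_mono s c n m : n <= m -> (tail s c m <= tail s c n)%N.
Proof.
move=> nm; apply: sub_count => z /asboolP[k -> mk]; apply/asboolP; exists k => //.
exact: le_lt_trans mk.
Qed.

Lemma tail_large s c : exists n0, forall n, n0 <= n -> tail s c n = 0%N.
Proof.
suff [n0 h] : exists n0, tail s c n0 = 0%N.
  by exists n0 => n /(tail_mono s c); rewrite h leqn0 => /eqP.
elim: s => [|z s [n0 IH]]; first by exists 0.
have [[k zk]|nz] := pselect (exists k : int, z = c + k%:~R).
  exists (Num.max n0 k); rewrite /= -/(tail s c _).
  have := tail_mono s c (n := n0) (m := Num.max n0 k); rewrite le_max lexx IH leqn0.
  move=> /(_ isT)/eqP ->; rewrite addn0; apply/eqP; rewrite eqb0.
  apply/negP => /asboolP[l]; rewrite zk => /addrI/intr_inj <-.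
  by rewrite gt_max ltxx andbF.
exists n0; rewrite /= -/(tail s c _) IH addn0; apply/eqP; rewrite eqb0.
by apply/negP => /asboolP[l zl _]; apply: nz; exists l.
Qed.

Lemma mup_shp w c d : w != 0 -> mup c (shp d w) = mup (c + d) w.
Proof.
have le (u : {poly K}) x e : u != 0 -> (mup (x + e)%R u <= mup x (shp e u))%N.
  move=> u0; rewrite mup_geq ?shp_eq0 //.
  have : ('X - (x + e)%:P) ^+ mup (x + e) u %| u by rewrite -mup_geq.
  move=> /dvdpP[q uq]; apply/dvdpP; exists (shp e q); rewrite {1}uq shpM.
  congr (_ * _); rewrite /shp rmorphXn /= comp_polyB comp_polyX comp_polyC.
  by rewrite polyCD opprD [- _ - _]addrC addrA addrK.
move=> w0; have h1 := le w c d w0.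
have w0' : shp d w != 0 by rewrite shp_eq0.
have h2 := le (shp d w) (c + d) (- d) w0'.
rewrite shp_shp addNr shp0 addrK in h2.
by apply/eqP; rewrite eqn_leq h1 h2.
Qed.

Lemma mup_rootseq w c : w != 0 -> mup c w = count_mem c (rootseq w).
Proof.
move=> w0; rewrite {1}(rootseqE w) -mul_polyC mupMr; last first.
  by rewrite rootC lead_coef_eq0.
elim: (rootseq w) => [|z s IH]; first by rewrite big_nil mupNroot // rootE hornerC oner_neq0.
rewrite big_cons mupM ?polyXsubC_eq0 ?monic_neq0 ?monic_prod_XsubC // IH.
by rewrite -[X in mup c X]expr1 mup_XsubCX /= [z == c]eq_sym; case: eqP.
Qed.

Lemma mup_edges w c n (k : nat) : w != 0 ->
  tail (rootseq w) c n = (mup c (edges w n k) + tail (rootseq w) c (n + k%:Z)%R)%N.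
Proof.
move=> w0; elim: k => [|k IH].
  by rewrite edges0 addr0 mupNroot // rootE hornerC oner_neq0.
rewrite edgesS mupM ?edges_neq0 ?shp_eq0 // mup_shp // (mup_rootseq _ w0) -addnA.
by rewrite IH tailS; congr (_ + (_ + tail _ _ _))%N; lia.
Qed.

(** If no root lies beyond c + m, the round trip between m and n meets, at H = c,
    exactly the roots beyond c + n, whichever of m and n is larger. *)
Lemma mup_edges_between w c m n : w != 0 -> tail (rootseq w) c m = 0%N ->
  mup c (edges_between w m n) = tail (rootseq w) c n.
Proof.
move=> w0 tm; rewrite /edges_between; case: leP => mn.
  have := mup_edges c m `|n - m|%N w0; rewrite tm => /esym/eqP.
  rewrite addn_eq0 => /andP[/eqP -> _].
  by have := tail_mono (rootseq w) c mn; rewrite tm leqn0 => /eqP.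
rewrite (mup_edges c n `|m - n|%N w0) (_ : n + _ = m); last by lia.
by rewrite tm addn0.
Qed.

End Tails.

(** * Chains of objects *)

Section Chains.
Variables (K : numClosedFieldType) (v : {poly K}).
Notation C := (grMod (GWA v)).
Implicit Types (X Y : int -> grmodule (GWA v)) (M N : grmodule (GWA v)) (w : {poly K}).

(** What the free modules over T(w), and their images under an equivalence,
    retain of the quiver: round trips are measured by the labels w(H + i + 1). *)
Record chain w X : Prop := Chain {
  chain_neq0 : w != 0;
  chain_end : forall m (f : grhom (X m) (X m)), exists p, acts f p;
  chain_faithful : forall m p, killed (X m) p -> p = 0;
  chain_dvd : forall m n (f : grhom (X m) (X n)) (g : grhom (X n) (X m)) p,
    acts (grhom_comp g f) p -> edges_between w m n %| p;
  chain_trip : forall m n, exists (f : grhom (X m) (X n)) (g : grhom (X n) (X m)),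
    acts (grhom_comp g f) (edges_between w m n)
}.

Lemma free_chain : v != 0 -> chain v (free v).
Proof.
move=> v0; split=> //.
- exact: free_end.
- by move=> m p; exact: free_faithful.
- exact: free_round_trip_dvd.
- exact: free_round_trip.
Qed.

Lemma chain_acts_inj w X m (f : grhom (X m) (X m)) p q : chain w X ->
  acts f p -> acts f q -> p = q.
Proof.
move=> cX fp fq; apply/eqP; rewrite -subr_eq0; apply/eqP/(chain_faithful cX (m := m)).
move=> i x xi; rewrite hactD hactN scalerBl -(fp _ _ xi) -(fq _ _ xi).
by rewrite subrr.
Qed.

(** M and N become isomorphic when polynomials in H not vanishing at c are
    inverted. *)
Definition iso_at (c : K) (M N : grmodule (GWA v)) :=
  exists (f : grhom M N) (g : grhom N M) s,
    [/\ ~~ root s c, acts (grhom_comp f g) s & acts (grhom_comp g f) s].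

Lemma iso_at_sym c M N : iso_at c M N -> iso_at c N M.
Proof. by move=> [f [g [s [sc fg gf]]]]; exists g, f, s. Qed.

(** A polynomial in H in the middle of a round trip can be moved outside. *)
Lemma acts_sandwich M N (f : grhom M N) (g : grhom N M) (e : grhom N N) (p q : {poly K}) :
  acts e p -> acts (grhom_comp g f) q -> acts (grhom_comp g (grhom_comp e f)) (p * q).
Proof.
move=> ep gfq i x xi; rewrite hactM -scalerA -(gfq _ _ xi) /=.
by rewrite (ep _ _ (grhom_deg f xi)) linearZ.
Qed.

(** The identity of Y n is a sum of round trips through members of X, all of them
    polynomials in H; as they add up to 1, one of them does not vanish at c. *)
Lemma exists_iso_at w w' X Y n : chain w X -> chain w' Y ->
  finitely_through X (Y n) ->
  exists N : nat, forall c, exists2 m, (`|m| <= N)%N & iso_at c (X m) (Y n).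
Proof.
move=> cX cY [N [s [sP s1]]]; exists N => c.
pose p e := projT1 (cid (chain_end cY (e : grhom (Y n) (Y n)))).
have pP e : acts e (p e) by rewrite /p; case: cid.
have p1 : \sum_(e <- s) p e = 1.
  apply: (chain_acts_inj cY (f := grhom_id (Y n))); last exact: acts_id.
  by rewrite -s1; apply: acts_sum => e _; exact: pP.
have [e es pe] : exists2 e, e \in s & ~~ root (p e) c.
  apply: contrapT => h; have := congr1 (fun q => q.[c]) p1.
  rewrite horner_sum hornerC big_seq big1 => [/eqP|e es].
    by rewrite eq_sym oner_eq0.
  by apply/eqP/negPn/negP => pe; apply: h; exists e.
have [m [f [g [mN efg]]]] := sP _ es; exists m => //.
have [r gfr] := chain_end cX (grhom_comp g f).
have fgp : acts (grhom_comp f g) (p e) by rewrite -efg.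
have fgr : acts (grhom_comp (grhom_comp f g) (grhom_comp f g)) (r * p e).
  have := acts_sandwich gfr fgp; congr acts.
(* f (g f) = (f g) f, so the round trips f g and g f are the same polynomial. *)
have E := chain_acts_inj cY fgr (acts_comp fgp fgp).
have {E} E : r = p e.
  by apply: (mulIf (x := p e)) => //; apply: contraNneq pe => ->; rewrite root0.
by exists f, g, (p e); split; rewrite // -?E // E.
Qed.

(** A round trip in Y, preceded and followed by local isomorphisms, is one in X. *)
Lemma iso_at_le w w' X Y c m n m' n' : chain w X -> chain w' Y ->
  iso_at c (X m) (Y n) -> iso_at c (X m') (Y n') ->
  (mup c (edges_between w m m') <= mup c (edges_between w' n n'))%N.
Proof.
move=> cX cY [f [g [s [sc fg gf]]]] [f' [g' [s' [sc' fg' gf']]]].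
have [t [t' tt']] := chain_trip cY n n'.
have a1 := acts_sandwich (acts_sandwich fg' tt') gf.
have : edges_between w m m' %| s' * edges_between w' n n' * s.
  apply: (@chain_dvd _ _ cX _ _ (grhom_comp g' (grhom_comp t f)) (grhom_comp g (grhom_comp t' f'))).
  by move: a1; congr acts.
have e0 : edges_between w' n n' != 0.
  by rewrite /edges_between; case: ifP => _; rewrite edges_neq0 ?(chain_neq0 cY).
have e0' : edges_between w m m' != 0.
  by rewrite /edges_between; case: ifP => _; rewrite edges_neq0 ?(chain_neq0 cX).
have s0 : s != 0 by apply: contraNneq sc => ->; rewrite root0.
have s0' : s' != 0 by apply: contraNneq sc' => ->; rewrite root0.
move=> dv; rewrite -[leqRHS](mupMr _ sc') -[leqRHS](mupMl _ sc) mup_geq ?mulf_neq0 //.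
apply: dvdp_trans dv; by rewrite -mup_geq.
Qed.

(** Replace c by c + L, with L so large that all roots of w' in the class lie
    below Y 0 and all roots of w below the X m that is isomorphic to Y 0 there; the
    second is possible because m is bounded independently of L. Round trips from
    these two members then count the roots beyond a given degree. *)
Lemma chain_tails w w' X Y : chain w X -> chain w' Y ->
  (forall n, finitely_through X (Y n)) ->
  forall c n, exists m, tail (rootseq w) c m = tail (rootseq w') c n.
Proof.
move=> cX cY thr c n.
have [N hN] := exists_iso_at cX cY (thr 0).
have [L1 hL1] := tail_large (rootseq w) c.
have [L2 hL2] := tail_large (rootseq w') c.
pose L : int := (`|L1| + `|L2| + N)%N.
have [m0 m0N i0] := hN (c + L%:~R).
have [N' hN'] := exists_iso_at cX cY (thr (n - L)).
have [m1 _ i1] := hN' (c + L%:~R).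
exists (L + m1); rewrite -tail_shift.
have [w0 w0'] := (chain_neq0 cX, chain_neq0 cY).
rewrite -(mup_edges_between _ w0 (m := m0)); last first.
  by rewrite tail_shift; apply: hL1; rewrite /L; lia.
have -> : n = L + (n - L) by rewrite addrC subrK.
rewrite -(tail_shift _ c) -(mup_edges_between _ w0' (m := 0)); last first.
  by rewrite tail_shift; apply: hL2; rewrite /L; lia.
apply/eqP; rewrite eqn_leq.
rewrite (iso_at_le cX cY i0 i1).
by rewrite (iso_at_le cY cX (iso_at_sym i0) (iso_at_sym i1)).
Qed.
End Chains.

Section Invariant.
Variables (K : numClosedFieldType) (v1 v2 : {poly K}).
Hypotheses (v1_neq0 : v1 != 0) (v2_neq0 : v2 != 0).

Lemma shp_edges_between (mu : K) w m n :
  shp mu (edges_between w m n) = edges_between (shp mu w) m n.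
Proof.
rewrite /edges_between /edges; case: ifP => _; rewrite shp_prod; apply: eq_bigr => i _.
all: by rewrite !shp_shp [in LHS](addrC mu).
Qed.

(** An equivalence carries the chain of free modules over T(v2) to a chain over
    T(v1), with v2 translated as H is. *)
Lemma Morita_tails : strongly_graded_Morita_equivalent (GWA v1) (GWA v2) ->
  exists mu, forall c,
    (forall n, exists m, tail (rootseq v1) c m = tail (rootseq (shp mu v2)) c n) /\
    (forall n, exists m, tail (rootseq (shp mu v2)) c m = tail (rootseq v1) c n).
Proof.
move=> [F [eF lF sF]].
have [mu muP] := center_translation v1_neq0 eF lF sF; exists mu.
pose X := free v1; pose Y n : grmodule (GWA v1) := F (free v2 n).
have cX : chain v1 X by exact: free_chain.
have c2 := free_chain v2_neq0.
have ffaith n p : killed (Y n) (shp mu p) -> p = 0.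
  move=> kp; apply: (chain_faithful c2 (m := n)).
  have : hop p (free v2 n) = 0.
    apply: (equiv_faithful eF); rewrite -![fmap F _]/(Fmap F _) (Fmap0 lF).
    exact: acts_uniq (muP _ _ _ (hop_acts p _)) kp.
  by move=> e i x xi; rewrite -e; exact: hop_acts xi.
have full m n (f : grhom (Y m) (Y n)) : exists f0, Fmap F f0 = f.
  exact: (equiv_full eF).
have cY : chain (shp mu v2) Y.
  split.
  - by rewrite shp_eq0.
  - move=> m f; have [f0 <-] := full _ _ f; have [p fp] := chain_end c2 f0.
    by exists (shp mu p); exact: muP.
  - move=> m p; rewrite -[p]shp0 -(subrr mu) -shp_shp => /ffaith ->.
    exact: shpp0.
  - move=> m n f g p; have [f0 <-] := full _ _ f; have [g0 <-] := full _ _ g.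
    rewrite -Fmap_comp; have [q fq] := chain_end c2 (grhom_comp g0 f0).
    have := muP _ _ _ fq => a1 a2.
    have -> : p = shp mu q.
      apply/eqP; rewrite -subr_eq0 -[p - _]shp0 -(subrr mu) -shp_shp shp_eq0.
      apply/eqP; apply: (ffaith m); rewrite shp_shp subrr shp0.
      move=> i x xi; rewrite hactD hactN scalerBl -(a1 _ _ xi) -(a2 _ _ xi).
      by rewrite subrr.
    have /dvdpP[r ->] := chain_dvd c2 fq.
    by rewrite shpM shp_edges_between dvdp_mull.
  - move=> m n; have [f [g fg]] := chain_trip c2 m n.
    exists (Fmap F f), (Fmap F g); rewrite -Fmap_comp -shp_edges_between.
    exact: muP.
have thr1 n : finitely_through X (Y n).
  have [G eG FG] := equiv_inverse eF.
  have [N [s [sP s1]]] := free_through n (equiv_separating eG (@free_separating _ v1)).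
  exists N, (map (Fmap F (N := free v2 n)) s); split; last first.
    by rewrite big_map -(Fmap_sum lF) s1 Fmap_id.
  move=> _ /mapP[e /sP[m [f [g [mN ->]]]] ->].
  have [a [b [ba ab]]] := FG (free v1 m).
  exists m, (grhom_comp (Fmap F f) b), (grhom_comp a (Fmap F g)); split=> //.
  rewrite Fmap_comp; apply: grhom_ext => x /=; congr (Fmap F f _).
  exact: esym (congr1 (fun h : grhom (F (G (free v1 m))) (F (G (free v1 m))) =>
    grhom_fun h (Fmap F g x)) ba).
have thr2 n : finitely_through Y (X n).
  exact: (free_through n (equiv_separating eF (@free_separating _ v2))).
by move=> c; split; apply: chain_tails cX cY _ c || apply: chain_tails cY cX _ c.
Qed.
End Invariant.

(** * Modules from operators *)

Section Rep.
Variables (K : numFieldType) (u : {poly K}) (W : zmodType).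
Variables (pl : {poly K} -> W -> W) (up dn : W -> W).

(** The defining relations of T(u), for the operators of h, t_+ and t_-. *)
Record gwa_rep : Prop := GwaRep {
  rep_pB : forall p, {morph pl p : x y / x - y};
  rep_pD : forall p q x, pl (p + q) x = pl p x + pl q x;
  rep_pM : forall p q x, pl (p * q) x = pl p (pl q x);
  rep_p1 : forall x, pl 1 x = x;
  rep_upB : {morph up : x y / x - y};
  rep_dnB : {morph dn : x y / x - y};
  rep_up : forall r x, pl r (up x) = up (pl (tau r) x);
  rep_dn : forall r x, pl (tau r) (dn x) = dn (pl r x);
  rep_dnup : forall x, dn (up x) = pl (tau u) x;
  rep_updn : forall x, up (dn x) = pl u x
}.
Hypothesis hR : gwa_rep.

Fixpoint rep_term (t : gwa_term K) (x : W) : W :=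
  match t with
  | gpoly p => pl p x
  | gplus => up x
  | gminus => dn x
  | gopp y => - rep_term y x
  | gadd y z => rep_term y x + rep_term z x
  | gmul y z => rep_term y (rep_term z x)
  end.

Lemma rep_termB t : {morph rep_term t : x y / x - y}.
Proof.
elim: t => [p|||t IH|t IHt t' IHt'|t IHt t' IHt'] x y /=.
- exact: rep_pB.
- exact: rep_upB.
- exact: rep_dnB.
- by rewrite IH opprD.
- by rewrite IHt IHt' addrACA opprD.
- by rewrite IHt' IHt.
Qed.
Lemma rep_term0 t : rep_term t 0 = 0.
Proof. by rewrite -[in LHS](subrr 0) rep_termB subrr. Qed.
Lemma rep_termD t : {morph rep_term t : x y / x + y}.
Proof.
move=> x y; have := rep_termB t 0 y; rewrite rep_term0 !sub0r => e.
by have := rep_termB t x (- y); rewrite opprK e opprK.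
Qed.

Lemma rep_pl0 x : pl 0 x = 0.
Proof. by apply: (addIr (pl 0 x)); rewrite -rep_pD // !add0r. Qed.

Lemma rep_cong t t' : gwa_cong u t t' -> forall x, rep_term t x = rep_term t' x.
Proof.
elim=> {t t'}
  [|x y _ IH|x y z _ IHx _ IHy|x x' _ IH|x x' y y' _ IHx _ IHy|x x' y y' _ IHx _ IHy
  |x y z|x y|x|x|x y z|x|x|x y z|x y z|p q|p q|r|r||] //= w.
- by rewrite IHx.
- by rewrite IH.
- by rewrite IHx IHy.
- by rewrite IHx IHy.
- by rewrite addrA.
- by rewrite addrC.
- by rewrite rep_pl0 add0r.
- by rewrite addNr rep_pl0.
- by rewrite rep_p1.
- by rewrite rep_p1.
- by rewrite rep_termD.
- exact: rep_pD.
- exact: rep_pM.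
- exact: rep_up.
- exact: rep_dn.
- exact: rep_dnup.
- exact: rep_updn.
Qed.

Definition rep_scale (a : GWA u) (x : W) : W := rep_term (repr (a : gwa u)) x.

Lemma rep_scaleE t x : rep_scale (gwa_class u t) x = rep_term t x.
Proof. exact: rep_cong (gwa_repr _ _) _. Qed.

Fact rep_scaleA a b x : rep_scale a (rep_scale b x) = rep_scale (a * b) x.
Proof.
elim/gwa_classW: a => a; elim/gwa_classW: b => b.
by rewrite -[_ * _]/(gwa_mul _ _) gwa_mulE !rep_scaleE.
Qed.
Fact rep_scale1 : left_id 1 rep_scale.
Proof. by move=> x; rewrite -[1]/(gwa_class u (gpoly 1)) rep_scaleE /= rep_p1. Qed.
Fact rep_scaleDr : right_distributive rep_scale +%R.
Proof. by move=> a; elim/gwa_classW: a => a x y; rewrite !rep_scaleE rep_termD. Qed.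
Fact rep_scaleDl x : {morph rep_scale^~ x : a b / a + b}.
Proof.
move=> a b; elim/gwa_classW: a => a; elim/gwa_classW: b => b.
by rewrite -[_ + _ in LHS]/(gwa_add _ _) gwa_addE !rep_scaleE.
Qed.
End Rep.

(** * Sliding factors along the edges *)

Section Move.
Variable K : numFieldType.

(** The roots of a slide up by one relative to those of b, s translates
    everything and rho rescales; the inverse of a move is then again a move. *)
Record move (v u : {poly K}) := Move {
  mva : {poly K};
  mvb : {poly K};
  mvs : K;
  mvr : K;
  move_src : v = mva * mvb;
  move_tgt : u = mvr ^+ 2 *: (shp (mvs - 1) mva * shp mvs mvb);
  mvr_neq0 : mvr != 0
}.

(** Undoing a move: now b slides up by one, and everything is translated back. *)
Section Inverse.
Variables (v u : {poly K}) (t : move v u).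
Definition inva := mvr t *: shp (mvs t) (mvb t).
Definition invb := mvr t *: shp (mvs t - 1) (mva t).
Lemma inv_src : u = inva * invb.
Proof. by rewrite (move_tgt t) /inva /invb -scalerAl -scalerAr scalerA mulrC. Qed.
Lemma inv_tgt : v = (mvr t)^-1 ^+ 2 *: (shp (1 - mvs t - 1) inva * shp (1 - mvs t) invb).
Proof.
rewrite /inva /invb !shpZ -scalerAl -scalerAr !scalerA !shp_shp.
have -> : 1 - mvs t - 1 + mvs t = 0 by ring.
have -> : 1 - mvs t + (mvs t - 1) = 0 by ring.
rewrite !shp0.
rewrite -mulrA -expr2 -exprMn mulVf ?mvr_neq0 // expr1n scale1r mulrC.
exact: move_src.
Qed.
Lemma inv_neq0 : (mvr t)^-1 != 0.
Proof. by rewrite invr_eq0 mvr_neq0. Qed.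
Definition move_inv : move u v := Move inv_src inv_tgt inv_neq0.
End Inverse.
End Move.

(** In terms of H, the pairs (x, y) below form a module inserted on the edge from
    x to y, labelled a b, so as to split it into a b-edge followed by an a-edge:

      M_(i-1) -- b -- X_i -- a -- M_i -- b -- X_(i+1) -- a -- M_(i+1)

    Going from X_i to X_(i+1) through M_i gives t_+, and going back gives t_-. *)
Section Mid.
Variables (K : numFieldType) (v u : {poly K}) (t : move v u).
Notation a := (mva t).
Notation b := (mvb t).
Notation s := (mvs t).
Notation rho := (mvr t).
Notation A := (GWA v).
Let pol (p : {poly K}) : A := gwa_poly v p.
Let tp : A := gwa_tp v.
Let tm : A := gwa_tm v.

Lemma scal_polM (M : lmodType A) p q (x : M) : pol p *: (pol q *: x) = pol (p * q) *: x.
Proof. by rewrite scalerA /pol gwa_polyM. Qed.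
Lemma scal_tp (M : lmodType A) p (x : M) : tp *: (pol p *: x) = pol (shp (-1) p) *: (tp *: x).
Proof.
rewrite !scalerA; congr (_ *: _); rewrite /pol -[RHS]/(_ * gwa_tp v) gwa_tpE tauE.
by rewrite shp_shp subrr shp0.
Qed.
Lemma scal_tm (M : lmodType A) p (x : M) : tm *: (pol p *: x) = pol (shp 1 p) *: (tm *: x).
Proof. by rewrite !scalerA; congr (_ *: _); rewrite /pol -tauE -[RHS]/(_ * gwa_tm v) gwa_tmE. Qed.
Lemma scal_tptm (M : lmodType A) (x : M) : tp *: (tm *: x) = pol (a * b) *: x.
Proof. by rewrite scalerA -move_src; congr (_ *: _); exact: gwa_pmE. Qed.
Lemma scal_tmtp (M : lmodType A) (x : M) : tm *: (tp *: x) = pol (shp 1 a * shp 1 b) *: x.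
Proof. by rewrite scalerA -shpM -move_src -tauE; congr (_ *: _); exact: gwa_mpE. Qed.

Section Carrier.
Variable M : lmodType A.

Definition mid_pred : {pred M * M} :=
  fun z => (tp *: z.1 == pol b *: z.2) && (tm *: z.2 == pol (shp 1 a) *: z.1).

Fact mid_zmod_closed : zmod_closed mid_pred.
Proof.
split=> [|x y /andP[/eqP x1 /eqP x2] /andP[/eqP y1 /eqP y2]].
  by rewrite unfold_in /= !scaler0 !eqxx.
by rewrite unfold_in /= !scalerBr x1 x2 y1 y2 !eqxx.
Qed.
HB.instance Definition _ := GRing.isZmodClosed.Build (M * M)%type mid_pred mid_zmod_closed.

Record mid := Mid { mid_val : M * M; _ : mid_val \in mid_pred }.
HB.instance Definition _ := [isSub for mid_val].
HB.instance Definition _ := [Choice of mid by <:].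
HB.instance Definition _ := [SubChoice_isSubZmodule of mid by <:].

Lemma mid1 (z : mid) : tp *: (val z).1 = pol b *: (val z).2.
Proof. by case: z => z /= /andP[/eqP]. Qed.
Lemma mid2 (z : mid) : tm *: (val z).2 = pol (shp 1 a) *: (val z).1.
Proof. by case: z => z /= /andP[_ /eqP]. Qed.
Lemma midP (x y : M) : tp *: x = pol b *: y -> tm *: y = pol (shp 1 a) *: x ->
  (x, y) \in mid_pred.
Proof. by move=> h1 h2; rewrite unfold_in /= h1 h2 !eqxx. Qed.

(** x and y sit in consecutive degrees, so the h of the new algebra, which is H
    plus the new degree when s = 0, acts on them as h - s + 1 and h - s. *)
Fact mid_pol_proof p (z : mid) :
  (pol (shp (1 - s) p) *: (val z).1, pol (shp (- s) p) *: (val z).2) \in mid_pred.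
Proof.
apply: midP.
- rewrite scal_tp mid1 !scal_polM shp_shp mulrC; congr (pol (_ * shp _ _) *: _).
  by rewrite addrA addNr add0r.
- by rewrite scal_tm mid2 !scal_polM shp_shp mulrC.
Qed.
Definition mid_pol p z := Mid (mid_pol_proof p z).

Fact mid_up_proof (z : mid) :
  (pol (rho *: shp 1 b) *: (val z).2, pol rho%:P *: (tp *: (val z).2)) \in mid_pred.
Proof.
apply: midP.
- rewrite scal_tp !scal_polM shpZ shp_shp addNr shp0.
  by rewrite [b * _]mulrC mul_polyC.
- rewrite scal_tm shpC scal_tmtp !scal_polM; congr (pol _ *: _).
  by rewrite mul_polyC scalerAr.
Qed.
Definition mid_up z := Mid (mid_up_proof z).

Fact mid_dn_proof (z : mid) :
  (pol rho%:P *: (tm *: (val z).1), pol (rho *: a) *: (val z).1) \in mid_pred.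
Proof.
apply: midP.
- rewrite scal_tp shpC scal_tptm !scal_polM; congr (pol _ *: _).
  by rewrite mul_polyC -scalerAr [b * _]mulrC.
- rewrite scal_tm !scal_polM shpZ; congr (pol _ *: _).
  by rewrite [RHS]mulrC mul_polyC.
Qed.
Definition mid_dn z := Mid (mid_dn_proof z).

Lemma mid_ext (y z : mid) : (val y).1 = (val z).1 -> (val y).2 = (val z).2 -> y = z.
Proof. by move=> h1 h2; apply: val_inj; rewrite [val y]surjective_pairing h1 h2 -surjective_pairing. Qed.

Lemma mid_rep : gwa_rep u mid_pol mid_up mid_dn.
Proof.
have uE c : shp c u = rho%:P * rho%:P * (shp (c + (s - 1)) a * shp (c + s) b).
  rewrite [in LHS](move_tgt t) !(shpZ, shpM) !shp_shp -mul_polyC.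
  by rewrite polyC_exp expr2.
have u1 : shp (1 - s) (tau u) = rho%:P * rho%:P * (shp 1 a * shp (1 + 1) b).
  by rewrite tauE shp_shp uE; congr (_ * (shp _ _ * shp _ _)); ring.
have u2 : shp (- s) (tau u) = rho%:P * rho%:P * (a * shp 1 b).
  by rewrite tauE shp_shp uE -[a in RHS]shp0; congr (_ * (shp _ _ * shp _ _)); ring.
have u3 : shp (1 - s) u = rho%:P * rho%:P * (a * shp 1 b).
  by rewrite uE -[a in RHS]shp0; congr (_ * (shp _ _ * shp _ _)); ring.
have u4 : shp (- s) u = rho%:P * rho%:P * (shp (-1) a * b).
  by rewrite uE -[b in RHS]shp0; congr (_ * (shp _ _ * shp _ _)); ring.
have i1 : - s + 1 = 1 - s by ring.
have i2 : 1 - s + 1 = 1 + (1 - s) by ring.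
have i3 : -1 + (1 - s) = - s by ring.
split=> [p y z|p q z|p q z|z|y z|y z|r z|r z|z|z]; apply: mid_ext => /=;
  rewrite ?scalerBr // ?shpD ?shpM ?shp1 ?scal_polM ?u1 ?u2 ?u3 ?u4 ?tauE.
- by rewrite -scalerDl /pol -gwa_polyD.
- by rewrite -scalerDl /pol -gwa_polyD.
- by [].
- by [].
- exact: scale1r.
- exact: scale1r.
- by rewrite shp_shp i1 mulrC.
- by rewrite shp_shp i1 scal_tp !scal_polM shp_shp i3 mulrC.
- by rewrite shp_shp i2 scal_tm !scal_polM shp_shp mulrC.
- by rewrite shp_shp i1 mulrC.
- rewrite scal_tm mid2 !scal_polM; congr (pol _ *: _).
  by rewrite shpZ shp_shp -mul_polyC; ring.
- by congr (pol _ *: _); rewrite -!mul_polyC; ring.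
- by congr (pol _ *: _); rewrite -!mul_polyC; ring.
- rewrite scal_tp mid1 !scal_polM; congr (pol _ *: _).
  by rewrite shpZ -mul_polyC; ring.
Qed.

HB.instance Definition _ := GRing.Zmodule_isLmodule.Build (GWA u) mid
  (rep_scaleA mid_rep) (rep_scale1 mid_rep) (rep_scaleDr mid_rep) (rep_scaleDl mid_rep).

Lemma mid_polE p (z : mid) : (gwa_poly u p : GWA u) *: z = mid_pol p z.
Proof. exact: (rep_scaleE mid_rep (gpoly p)). Qed.
Lemma mid_tpE (z : mid) : (gwa_tp u : GWA u) *: z = mid_up z.
Proof. exact: (rep_scaleE mid_rep (@gplus K)). Qed.
Lemma mid_tmE (z : mid) : (gwa_tm u : GWA u) *: z = mid_dn z.
Proof. exact: (rep_scaleE mid_rep (@gminus K)). Qed.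
End Carrier.
Arguments mid_pred M _ : clear implicits.

(** The offset e of the degrees makes a move and its inverse cancel exactly when
    their offsets add up to 1. *)
Section MidGraded.
Variables (e : int) (M : grmodule A).
Let gM := grmod_grading M.

Definition mid_comp (i : int) : set (mid M) :=
  fun z => grmod_comp (i - 1 + e) (val z).1 /\ grmod_comp (i + e) (val z).2.

Lemma mid_part_proof i (z : mid M) :
  (mpart (i - 1 + e) (val z).1, mpart (i + e) (val z).2) \in mid_pred M.
Proof.
apply: midP.
- rewrite (act_part _ _ (gwa_comp_tp v : @gralg_comp _ A 1 _)).
  rewrite (act_part _ _ (gwa_comp_poly v b : @gralg_comp _ A 0 _)) -mid1.
  by congr mpart; ring.
- rewrite (act_part _ _ (gwa_comp_tm v : @gralg_comp _ A (-1) _)).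
  rewrite (act_part _ _ (gwa_comp_poly v _ : @gralg_comp _ A 0 _)) -mid2.
  by congr mpart; ring.
Qed.
Definition mid_part i z := Mid (mid_part_proof i z).

Lemma mid_partP i z : mid_comp i (mid_part i z).
Proof. by split; exact: part_comp. Qed.

Fact val_fst_sum (I : Type) (r : seq I) (F : I -> mid M) :
  (val (\sum_(k <- r) F k)).1 = \sum_(k <- r) (val (F k)).1.
Proof. exact: (big_morph (fun z : mid M => (val z).1)). Qed.
Fact val_snd_sum (I : Type) (r : seq I) (F : I -> mid M) :
  (val (\sum_(k <- r) F k)).2 = \sum_(k <- r) (val (F k)).2.
Proof. exact: (big_morph (fun z : mid M => (val z).2)). Qed.

Lemma mid_grading : is_grading mid_comp.
Proof.
split=> [i|i y z [y1 y2] [z1 z2]|z|r f ur fg r0 i ir].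
- by split; exact: (gr0 gM).
- by split; exact: (grB gM).
- pose r := undup ([seq k + 1 - e | k <- degrees gM (val z).1] ++
                   [seq k - e | k <- degrees gM (val z).2]).
  have ur : uniq r by exact: undup_uniq.
  have sum_all x (h h' : int -> int) : cancel h h' -> cancel h' h ->
      {subset [seq h k | k <- degrees gM x] <= r} ->
      \sum_(k <- r) mpart (h' k) x = x.
    move=> hK h'K sub; rewrite [RHS](part_sum gM x).
    rewrite -(@sum_widen M (degrees gM x) [seq h' k | k <- r] (fun l => part gM l x)).
    + by rewrite big_map.
    + exact: degrees_uniq.
    + by rewrite map_inj_uniq //; exact: can_inj h'K.
    + by move=> k kx; rewrite -[k]hK; apply/map_f/sub/map_f.
    + by move=> k; exact: part_notin.
  exists [seq mid_part k z | k <- r]; split.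
    by move=> _ /mapP[k _ ->]; exists k; exact: mid_partP.
  rewrite big_map; apply: mid_ext.
  + rewrite val_fst_sum /= (sum_all _ (fun k => k + 1 - e) (fun k => k - 1 + e)) // => k.
    * by ring.
    * by ring.
    * by rewrite mem_undup mem_cat => ->.
  + rewrite val_snd_sum /= (sum_all _ (fun k => k - e) (fun k => k + e)) // => k.
    * by ring.
    * by ring.
    * by rewrite mem_undup mem_cat => ->; rewrite orbT.
- have sep (h : int -> int) (F : int -> M) : injective h ->
      (forall k, grmod_comp (h k) (F k)) -> \sum_(k <- r) F k = 0 -> F i = 0.
    move=> hI Fg F0; have := congr1 (mpart (h i)) F0.
    rewrite /mpart part0 (big_morph _ (partD gM (h i)) (part0 gM (h i))).
    rewrite (bigD1_seq i) //= (part_id _ (Fg i)) big1 ?addr0 // => k ki.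
    by rewrite (part_homog gM _ (Fg k)) (inj_eq hI) eq_sym (negbTE ki).
  apply: mid_ext.
  + apply: (sep (fun k => k - 1 + e) (fun k => (val (f k)).1)).
    * by move=> k l /addIr/addIr.
    * by move=> k; case: (fg k).
    * by rewrite -val_fst_sum r0.
  + apply: (sep (fun k => k + e) (fun k => (val (f k)).2)).
    * by move=> k l /addIr.
    * by move=> k; case: (fg k).
    * by rewrite -val_snd_sum r0.
Qed.

Lemma scal_deg i j k (c : A) (x : M) : @gralg_comp _ A k c -> i = k + j ->
  grmod_comp j x -> grmod_comp i (c *: x).
Proof. by move=> ck -> xj; exact: grmod_act. Qed.

Lemma mid_act i j (c : GWA u) z :
  gralg_comp i c -> mid_comp j z -> mid_comp (i + j) (c *: z).
Proof.
have dp p k (x : M) : grmod_comp k x -> grmod_comp k (pol p *: x).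
  by apply: (scal_deg (gwa_comp_poly v p)); rewrite add0r.
have dtp k l (x : M) : k = 1 + l -> grmod_comp l x -> grmod_comp k (tp *: x).
  exact: (scal_deg (gwa_comp_tp v)).
have dtm k l (x : M) : k = -1 + l -> grmod_comp l x -> grmod_comp k (tm *: x).
  exact: (scal_deg (gwa_comp_tm v)).
move=> ci; elim: ci j z => {i c} [p|||i|i x y _ IHx _ IHy|i k x y _ IHx _ IHy] j z zj.
- by rewrite mid_polE add0r; case: zj => z1 z2; split; exact: dp.
- rewrite mid_tpE; case: zj => z1 z2; split=> /=; last first.
    by apply: dp; apply: dtp z2; ring.
  by rewrite (_ : 1 + j - 1 = j); [exact: dp | ring].
- rewrite mid_tmE; case: zj => z1 z2; split=> /=.
    by apply: dp; apply: dtm z1; ring.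
  by rewrite (_ : -1 + j = j - 1); [exact: dp | ring].
- by rewrite scale0r; exact: (gr0 mid_grading).
- by rewrite scalerBl; apply: (grB mid_grading); [exact: IHx | exact: IHy].
- by rewrite -scalerA -addrA; apply: IHx; exact: IHy.
Qed.

Definition mid_module : grmodule (GWA u) := GrModule mid_grading mid_act.
End MidGraded.
End Mid.
Arguments mid_pred {K v u} t M _.

(** Linearity over T(u) need only be checked on generators. *)
Lemma gwa_linear (K : numFieldType) (u : {poly K}) (M N : lmodType (GWA u)) (f : M -> N) :
  {morph f : x y / x - y} ->
  (forall p x, f ((gwa_poly u p : GWA u) *: x) = (gwa_poly u p : GWA u) *: f x) ->
  (forall x, f ((gwa_tp u : GWA u) *: x) = (gwa_tp u : GWA u) *: f x) ->
  (forall x, f ((gwa_tm u : GWA u) *: x) = (gwa_tm u : GWA u) *: f x) ->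
  linear f.
Proof.
move=> fB fp ftp ftm.
have f0 : f 0 = 0 by rewrite -[in LHS](subrr 0) fB subrr.
have fN x : f (- x) = - f x by rewrite -sub0r fB f0 sub0r.
have fD x y : f (x + y) = f x + f y by have := fB x (- y); rewrite fN !opprK.
move=> c x y; rewrite fD; congr (_ + _); elim/gwa_ind: c x => //.
- by move=> c IH x; rewrite !scaleNr fN IH.
- by move=> c d IHc IHd x; rewrite !scalerDl fD IHc IHd.
- by move=> c d IHc IHd x; rewrite -!scalerA IHc IHd.
Qed.

Section MidFunctor.
Variables (K : numFieldType) (v u : {poly K}) (t : move v u) (e : int).
Notation A := (GWA v).
Notation B := (GWA u).

Section Map.
Variables (M N : grmodule A) (f : grhom M N).
Lemma mid_map_proof (z : mid t M) : (f (val z).1, f (val z).2) \in mid_pred t N.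
Proof. by apply: midP; rewrite -!linearZ /= ?mid1 ?mid2. Qed.
Definition mid_map_fun (z : mid_module t e M) : mid_module t e N := Mid (mid_map_proof z).
Fact mid_map_linear : linear mid_map_fun.
Proof.
apply: gwa_linear => [y z|p z|z|z]; apply: mid_ext; rewrite ?mid_polE ?mid_tpE ?mid_tmE /=.
all: by rewrite ?raddfB ?linearZ_LR.
Qed.
HB.instance Definition _ := GRing.isLinear.Build B (mid_module t e M) (mid_module t e N)
  *:%R mid_map_fun mid_map_linear.
Fact mid_map_deg i (z : mid_module t e M) : grmod_comp i z -> grmod_comp i (mid_map_fun z).
Proof. by case=> z1 z2; split; exact: grhom_deg. Qed.
Definition mid_map : grhom (mid_module t e M) (mid_module t e N) := GrHom mid_map_deg.
End Map.

Fact mid_map_id M : mid_map (grhom_id M) = grhom_id (mid_module t e M).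
Proof. by apply: grhom_ext => z; exact: mid_ext. Qed.
Fact mid_map_comp L M N (f : grhom M N) (g : grhom L M) :
  mid_map (grhom_comp f g) = grhom_comp (mid_map f) (mid_map g).
Proof. by apply: grhom_ext => z; exact: mid_ext. Qed.

Definition mid_functor : functor (grMod A) (grMod B) :=
  @Functor (grMod A) (grMod B) (mid_module t e) mid_map mid_map_id mid_map_comp.

Lemma mid_klinear : klinear mid_functor.
Proof.
move=> M N c f g; apply: grhom_ext => z.
have E (y : mid t N) : (c%:A : B) *: y = mid_pol c%:P y.
  rewrite -mid_polE; congr (_ *: _).
  by rewrite -[c%:A]/(gwa_poly u c%:P * 1) mulr1.
apply: mid_ext; rewrite /= /scale_fun E /= shpC; congr (_ *: _ + _).
all: by rewrite -[c%:A]/(gwa_poly v c%:P * 1) mulr1.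
Qed.

(** The two modules have the same elements and the same action; only the names of
    the degrees are computed differently. *)
Lemma mid_shift (M : grMod A) : isomorphic (mid_functor (shift 1 M)) (shift 1 (mid_functor M)).
Proof.
pose X : grmodule B := mid_module t e (shift 1 M).
pose Y : grmodule B := shift 1 (mid_module t e M).
have d i (z : X) : grmod_comp i z -> @grmod_comp _ _ Y i (idfun z).
  have key k l (x : M) : k = l -> @grmod_comp _ _ (M : grmodule A) k x ->
    @grmod_comp _ _ (M : grmodule A) l x by move=> ->.
  case=> z1 z2; split.
    by apply: (key (i - 1 + e + 1) (i + 1 - 1 + e) _ _ z1); ring.
  by apply: (key (i + e + 1) (i + 1 + e) _ _ z2); ring.
exists (@GrHom _ _ X Y idfun d); apply: iso_of_bijective => // z.
by exists z.
Qed.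
End MidFunctor.

(** M_i lies between X_i and X_(i+1), and the module inserted by the inverse move
    on that edge is M_i again: m corresponds to its images in X_i and X_(i+1). *)
Section Roundtrip.
Variables (K : numFieldType) (v u : {poly K}) (t : move v u) (t' : move u v).
Variables (e e' : int).
Notation a := (mva t).
Notation b := (mvb t).
Notation s := (mvs t).
Notation rho := (mvr t).
Notation A := (GWA v).
Hypotheses (ee' : e + e' = 1) (ea : mva t' = inva t) (eb : mvb t' = invb t)
  (es : mvs t' = 1 - s) (er : mvr t' = rho^-1).
Hypothesis cop : coprimep a (shp 1 b).
Let pol (p : {poly K}) : A := gwa_poly v p.
Let tp : A := gwa_tp v.
Let tm : A := gwa_tm v.

Section Unit.
Variable M : grmodule A.
Let N := mid_module t e M.
Let L := mid_module t' e' N.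

Fact eta1_proof (m : M) : (tm *: m, pol a *: m) \in mid_pred t M.
Proof.
apply: midP.
- by rewrite (scal_tptm t) scal_polM mulrC.
- by rewrite scal_tm.
Qed.
Definition eta1 m : N := Mid (eta1_proof m).
Fact eta2_proof (m : M) : (pol (shp 1 b) *: m, tp *: m) \in mid_pred t M.
Proof.
apply: midP.
- by rewrite scal_tp shp_shp addNr shp0.
- by rewrite (scal_tmtp t) scal_polM.
Qed.
Definition eta2 m : N := Mid (eta2_proof m).

Fact eta_proof (m : M) : (eta1 m, eta2 m) \in mid_pred t' N.
Proof.
have i1 : 1 - s + (s - 1) = 0 by ring.
have i2 : - s + (s - 1) = -1 by ring.
have i3 : 1 - s + 1 + s = 1 + 1 by ring.
have i4 : - s + 1 + s = 1 by ring.
apply: midP; rewrite ?mid_tpE ?mid_tmE mid_polE ?ea ?eb /inva /invb; apply: mid_ext => /=.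
- rewrite scal_polM shpZ shp_shp i1 shp0 scal_polM; congr (pol _ *: _).
  by rewrite -!mul_polyC; ring.
- rewrite !shpZ shp_shp i2 -mul_polyC -scal_polM; congr (_ *: _).
  by rewrite scal_tp.
- rewrite !shpZ !shp_shp i3 -mul_polyC -scal_polM; congr (_ *: _).
  by rewrite scal_tm shp_shp.
- rewrite !shpZ !shp_shp i4 !scal_polM; congr (pol _ *: _).
  by rewrite -!mul_polyC; ring.
Qed.
Definition eta_fun (m : M) : L := Mid (eta_proof m).

Fact eta_linear : linear eta_fun.
Proof.
have i1 : 1 - s + s = 1 by ring.
have i2 : - s + s = 0 by ring.
have i3 : 1 - s + (s - 1) = 0 by ring.
have i4 : - s + (s - 1) = -1 by ring.
have i5 : 1 - (1 - s) = s by ring.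
have i6 : - (1 - s) = s - 1 by ring.
have i7 : 1 - s + 1 + (s - 1) = 1 by ring.
have i8 : - s + 1 + (s - 1) = 0 by ring.
have rr : rho^-1 * rho = 1 by rewrite mulVf ?mvr_neq0.
have cc (x : M) : pol rho^-1%:P *: (pol rho%:P *: x) = x.
  by rewrite scal_polM -polyCM rr polyC1; exact: scale1r.
apply: gwa_linear => [m n|p m|m|m].
- by apply: mid_ext; apply: mid_ext; rewrite /= scalerBr.
- rewrite mid_polE; apply: mid_ext; rewrite /= mid_polE es; apply: mid_ext => /=.
  + by rewrite i5 shp_shp i1 scal_tm.
  + by rewrite i5 shp_shp i2 shp0 !scal_polM mulrC.
  + by rewrite i6 shp_shp i3 shp0 !scal_polM mulrC.
  + by rewrite i6 shp_shp i4 scal_tp.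
- rewrite mid_tpE; apply: mid_ext; rewrite /= ?mid_tpE mid_polE er ?eb /invb; apply: mid_ext => /=.
  + rewrite (scal_tmtp t) !scal_polM !shpZ !shp_shp i7.
    by rewrite scalerA rr scale1r.
  + rewrite !shpZ !shp_shp i8 shp0 [rho^-1 *: _]scalerA rr scale1r.
    by [].
  + rewrite !shpC scal_polM; congr (pol _ *: _).
    by rewrite mul_polyC scalerA rr scale1r.
  + by rewrite !shpC cc.
- rewrite mid_tmE; apply: mid_ext; rewrite /= ?mid_tmE mid_polE er ?ea /inva; apply: mid_ext => /=.
  + by rewrite !shpC cc.
  + by rewrite !shpC -mul_polyC -scal_polM cc.
  + by rewrite !shpZ shp_shp i1 [rho^-1 *: _]scalerA rr scale1r.
  + rewrite (scal_tptm t) !shpZ shp_shp i2 shp0 [rho^-1 *: _]scalerA rr scale1r.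
    by rewrite scal_polM mulrC.
Qed.
HB.instance Definition _ := GRing.isLinear.Build A M L *:%R eta_fun eta_linear.

Fact eta_deg i (m : M) : grmod_comp i m -> @grmod_comp _ _ L i (eta_fun m).
Proof.
have key k l (x : M) : k = l -> grmod_comp k x -> grmod_comp l x by move=> ->.
have dp p k (x : M) : grmod_comp k x -> grmod_comp k (pol p *: x).
  by apply: (scal_deg (gwa_comp_poly v p)); rewrite add0r.
have e'E : e' = 1 - e by rewrite -ee'; ring.
move=> mi; split; split=> /=; rewrite e'E.
- by apply: (scal_deg (gwa_comp_tm v)) mi; ring.
- by apply/dp/(key i) => //; ring.
- by apply/dp/(key i) => //; ring.
- by apply: (scal_deg (gwa_comp_tp v)) mi; ring.
Qed.
Definition eta : grhom M L := GrHom eta_deg.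

(** A Bezout relation between a and b(X + 1) recovers m from a m, which is the
    second entry of the pair in X_i, and b(h + 1) m, which is the first entry of
    the pair in X_(i+1). *)
Lemma eta_iso : @is_iso (grMod A) M L eta.
Proof.
have /Bezout_eq1_coprimepP[[al be] /= ab1] := cop.
have bez (x : M) : pol al *: (pol a *: x) + pol be *: (pol (shp 1 b) *: x) = x.
  rewrite !scal_polM -scalerDl /pol -gwa_polyD ab1; exact: scale1r.
apply: iso_of_bijective => [m n mn|z].
  have h1 : pol a *: m = pol a *: n := congr1 (fun z : L => (val (val z).1).2) mn.
  have h2 : pol (shp 1 b) *: m = pol (shp 1 b) *: n :=
    congr1 (fun z : L => (val (val z).2).1) mn.
  by rewrite -[m]bez h1 h2 bez.
case: z => -[z1 z2] zP.
have i1 : 1 - s + (s - 1) = 0 by ring.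
have i2 : - s + (s - 1) = -1 by ring.
have i3 : 1 - s + 1 + s = 1 + 1 by ring.
have i4 : - s + 1 + s = 1 by ring.
have rr : rho^-1 * rho = 1 by rewrite mulVf ?mvr_neq0.
have canc p (x y : M) : pol rho%:P *: x = pol (rho *: p) *: y -> x = pol p *: y.
  move=> /(congr1 (fun w => pol (rho^-1)%:P *: w)).
  rewrite !scal_polM -polyCM rr mul_polyC [rho^-1 *: _]scalerA rr scale1r polyC1 => <-.
  by apply/esym; exact: scale1r.
have /andP[/eqP h1 /eqP h2] := zP; move: h1 h2.
rewrite /= mid_tpE mid_tmE !mid_polE ea eb /inva /invb => h1 h2.
have := congr1 (fun z : N => (val z).1) h1; rewrite /= !shpZ shp_shp i1 shp0 => ya.
have := congr1 (fun z : N => (val z).2) h1; rewrite /= !shpZ shp_shp i2 => wa.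
have := congr1 (fun z : N => (val z).1) h2; rewrite /= !shpZ !shp_shp i3 => xb.
have := congr1 (fun z : N => (val z).2) h2; rewrite /= !shpZ !shp_shp i4 => yb.
have {}wa := canc _ _ _ wa; have {}xb := canc _ _ _ xb.
have {}ya : pol (shp 1 b) *: (val z1).2 = pol a *: (val z2).1.
  by apply: canc; rewrite -ya scal_polM mul_polyC.
have {}yb : pol a *: (val z2).1 = pol (shp 1 b) *: (val z1).2.
  by rewrite ya.
pose m := pol al *: (val z1).2 + pol be *: (val z2).1.
have ma : pol a *: m = (val z1).2.
  rewrite -[RHS]bez /m scalerDr !scal_polM; congr (_ + _).
    by rewrite mulrC.
  by rewrite [a * _]mulrC -[LHS]scal_polM -[RHS]scal_polM ya.
have mb : pol (shp 1 b) *: m = (val z2).1.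
  rewrite -[RHS]bez /m scalerDr !scal_polM; congr (_ + _).
    by rewrite mulrC -[LHS]scal_polM -[RHS]scal_polM ya.
  by rewrite mulrC.
exists m; apply: val_inj => /=; congr (_, _); apply: mid_ext => //=.
- rewrite -[tm]/(gwa_tm v : A) /m scalerDr !scal_tm (mid2 z1) xb !scal_polM -scalerDl.
  rewrite -gwa_polyD -shp_shp -!shpM -shpD ab1 shp1; exact: scale1r.
- rewrite -[tp]/(gwa_tp v : A) /m scalerDr !scal_tp (mid1 z2) wa !scal_polM -scalerDl.
  have -> : b = shp (-1) (shp 1 b) by rewrite shp_shp addNr shp0.
  rewrite -gwa_polyD -!shpM -shpD ab1 shp1; exact: scale1r.
Qed.
End Unit.

Lemma eta_natural (M N : grmodule A) (f : grhom M N) :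
  grhom_comp (eta N) f = grhom_comp (mid_map t' e' (mid_map t e f)) (eta M).
Proof.
apply: grhom_ext => m; apply: val_inj; congr (_, _); apply: mid_ext => /=.
all: by rewrite linearZ_LR.
Qed.
End Roundtrip.

Lemma naturally_isomorphic_sym (C D : category) (F G : functor C D) :
  naturally_isomorphic F G -> naturally_isomorphic G F.
Proof.
move=> [eta [etaI etaN]]; pose th X := projT1 (cid (etaI X)).
have [th1 th2] : (forall X, comp (th X) (eta X) = idm _) /\
    (forall X, comp (eta X) (th X) = idm _).
  by split=> X; rewrite /th; case: cid => ? [].
exists th; split=> [X|X Y f]; first by exists (eta X).
rewrite -[RHS]comp_idl -(th1 Y) -!compA; congr comp.
by rewrite !compA etaN -compA th2 comp_idr.
Qed.

Section Equivalent.
Variables (K : numFieldType) (v u : {poly K}) (t : move v u).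
Let t' := move_inv t.

Lemma inv_invE : [/\ mva t = inva t', mvb t = invb t', mvs t = 1 - mvs t' &
  mvr t = (mvr t')^-1].
Proof.
have rr : (mvr t)^-1 * mvr t = 1 by rewrite mulVf ?mvr_neq0.
split=> /=; [| |by ring|by rewrite invrK].
- rewrite /inva /= /invb shpZ scalerA rr scale1r shp_shp.
  by rewrite (_ : _ + _ = 0) ?shp0 //; ring.
- rewrite /invb /= /inva shpZ scalerA rr scale1r shp_shp.
  by rewrite (_ : _ + _ = 0) ?shp0 //; ring.
Qed.

Lemma coprimep_shp c (p q : {poly K}) : coprimep p q -> coprimep (shp c p) (shp c q).
Proof.
move=> /Bezout_eq1_coprimepP[[x y] /= xy]; apply/Bezout_eq1_coprimepP.
by exists (shp c x, shp c y) => /=; rewrite -!shpM -shpD xy shp1.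
Qed.

Lemma inv_coprime : coprimep (mva t) (mvb t) -> coprimep (mva t) (shp 1 (mvb t)) ->
  coprimep (inva t) (invb t) /\ coprimep (inva t) (shp 1 (invb t)).
Proof.
move=> cop cop1; rewrite /inva /invb shpZ shp_shp.
rewrite !coprimepZl ?mvr_neq0 // !coprimepZr ?mvr_neq0 // ![coprimep (shp (mvs t) _) _]coprimep_sym.
have -> : 1 + (mvs t - 1) = mvs t by ring.
split; last exact: coprimep_shp.
have -> : shp (mvs t) (mvb t) = shp (mvs t - 1) (shp 1 (mvb t)) by rewrite shp_shp subrK.
exact: coprimep_shp.
Qed.

Lemma mid_equivalence e : coprimep (mva t) (mvb t) ->
  coprimep (mva t) (shp 1 (mvb t)) -> is_equivalence (mid_functor t e).
Proof.
move=> cop cop1; exists (mid_functor t' (1 - e)); split; apply: naturally_isomorphic_sym.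
- have ee : e + (1 - e) = 1 by ring.
  exists (@eta _ _ _ t t' e (1 - e) ee erefl erefl erefl erefl); split=> [M|M N f].
  + exact: eta_iso.
  + exact: eta_natural.
- have ee : 1 - e + e = 1 by ring.
  have [ia ib is_ ir] := inv_invE.
  exists (@eta _ _ _ t' t (1 - e) e ee ia ib is_ ir); split=> [M|M N f].
  + by apply: eta_iso; have [] := inv_coprime cop cop1.
  + exact: eta_natural.
Qed.

Lemma move_Morita : coprimep (mva t) (mvb t) -> coprimep (mva t) (shp 1 (mvb t)) ->
  strongly_graded_Morita_equivalent (GWA u) (GWA v).
Proof.
move=> cop cop1; exists (mid_functor t 0); split.
- exact: mid_equivalence.
- exact: mid_klinear.
- exact: mid_shift.
Qed.
End Equivalent.

(** * Morita equivalence as a relation *)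

Lemma fmap_iso (C D : category) (F : functor C D) (X Y : C) (f : hom X Y) : is_iso f -> is_iso (fmap F f).
Proof.
by move=> [g [gf fg]]; exists (fmap F g); rewrite -!fmap_comp gf fg !fmap_id.
Qed.

Lemma comp_iso (C : category) (X Y Z : C) (g : hom Y Z) (f : hom X Y) :
  is_iso g -> is_iso f -> is_iso (comp g f).
Proof.
move=> [g' [g1 g2]] [f' [f1 f2]]; exists (comp f' g'); split.
- by rewrite -compA (compA g' g f) g1 comp_idl.
- by rewrite -compA (compA f f' g') f2 comp_idl.
Qed.

Section Compose.
Variables (C D E : category).

Lemma comp_unit (F : functor C D) (F' : functor D C) (G : functor D E) (G' : functor E D) :
  naturally_isomorphic (functor_comp F' F) (functor_id C) ->
  naturally_isomorphic (functor_comp G' G) (functor_id D) ->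
  naturally_isomorphic (functor_comp (functor_comp F' G') (functor_comp G F))
    (functor_id C).
Proof.
move=> [eta [etaI etaN]] [th [thI thN]].
exists (fun X => comp (eta X) (fmap F' (th (F X)))); split=> [X|X Y f].
  by apply: comp_iso; [exact: etaI|exact: (fmap_iso F' (thI (F X)))].
have /= e1 := etaN _ _ f; have /= e2 := thN _ _ (fmap F f).
by rewrite /= -compA -fmap_comp e2 fmap_comp compA e1 compA.
Qed.
End Compose.

Lemma comp_equivalence (C D E : category) (F : functor C D) (G : functor D E) :
  is_equivalence F -> is_equivalence G -> is_equivalence (functor_comp G F).
Proof.
move=> [F' [h1 h2]] [G' [h3 h4]]; exists (functor_comp F' G'); split.
- exact: comp_unit h1 h3.
- exact: comp_unit h4 h2.
Qed.

Section MoritaRelation.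
Variable K : numFieldType.
Implicit Types (p q v u w : {poly K}).

Lemma Morita_trans v u w :
  strongly_graded_Morita_equivalent (GWA v) (GWA u) ->
  strongly_graded_Morita_equivalent (GWA u) (GWA w) ->
  strongly_graded_Morita_equivalent (GWA v) (GWA w).
Proof.
move=> [F [eF lF sF]] [G [eG lG sG]]; exists (functor_comp F G); split.
- exact: comp_equivalence.
- move=> M N c f g.
  have -> : fmap (functor_comp F G) (c *: f + g) = fmap F (fmap G (c *: f + g)) by [].
  by rewrite (lG _ _ c f g) (lF _ _ c (fmap G f) (fmap G g)).
- move=> M; have [f fI] := sG M; have [g gI] := sF (G M).
  by exists (comp g (fmap F f)); apply: comp_iso => //; exact: fmap_iso.
Qed.

(** Both directions at once, since a move and its inverse are of the same kind. *)
Definition Morita_both v u :=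
  strongly_graded_Morita_equivalent (GWA v) (GWA u) /\
  strongly_graded_Morita_equivalent (GWA u) (GWA v).

Lemma Morita_both_sym v u : Morita_both v u -> Morita_both u v.
Proof. by case. Qed.
Lemma Morita_both_trans v u w : Morita_both v u -> Morita_both u w -> Morita_both v w.
Proof.
by move=> [vu uv] [uw wu]; split; [exact: Morita_trans uw|exact: Morita_trans wu uv].
Qed.

(** Coprimality of p and q makes the move invertible on one side, that of p and
    q(X + 1) on the other: the factors must not meet before or after. *)
Lemma Morita_slide p q c rho : rho != 0 -> coprimep p q -> coprimep p (shp 1 q) ->
  Morita_both (p * q) (rho ^+ 2 *: (shp (c - 1) p * shp c q)).
Proof.
move=> r0 pq pq1.
pose t := Move (erefl (p * q)) (erefl (rho ^+ 2 *: (shp (c - 1) p * shp c q))) r0.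
split; last exact: (@move_Morita _ _ _ t).
by have [c1 c2] := inv_coprime (t := t) pq pq1; exact: (@move_Morita _ _ _ (move_inv t)).
Qed.

Lemma Morita_translate p c rho : rho != 0 -> Morita_both p (rho ^+ 2 *: shp c p).
Proof.
by move=> r0; have := @Morita_slide 1 p c _ r0; rewrite shp1 !mul1r !coprime1p; exact.
Qed.
End MoritaRelation.

(** * Polynomials of the same type are related by slides *)

Section Slides.
Variable K : numClosedFieldType.

Section SlideUp.
Variables (I : finType) (d : I -> nat).

Definition rprod (S : pred I) (r : I -> K) : {poly K} :=
  \prod_(i | S i) ('X - (r i)%:P) ^+ d i.

Lemma rprod_root (S : pred I) (r : I -> K) z : root (rprod S r) z -> exists2 i, S i & z = r i.
Proof.
rewrite /rprod rootE horner_prod prodf_seq_eq0 => /hasP[i _ /andP[Si]].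
rewrite horner_exp expf_eq0 !hornerE subr_eq0 => /andP[_ /eqP zi].
by exists i.
Qed.

Lemma shp_rprod c (S : pred I) (r : I -> K) : shp c (rprod S r) = rprod S (fun i => r i - c).
Proof.
rewrite /rprod shp_prod; apply: eq_bigr => i _.
by rewrite /shp rmorphXn /= comp_polyB comp_polyX comp_polyC polyCB opprB addrA addrAC.
Qed.

Lemma rprod_coprime (S T : pred I) (r r' : I -> K) : (forall i j, S i -> T j -> r i != r' j) ->
  coprimep (rprod S r) (rprod T r').
Proof.
move=> rr'; apply: Pdiv.ClosedField.root_coprimep => z /rprod_root[i Si ->].
apply/negP => /rprod_root[j Tj rij].
by move: (rr' i j Si Tj); rewrite rij eqxx.
Qed.

(** At each step, the roots that still have to move go up by one together. Within
    a class these are the upper ones, so they never meet the others. *)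
Lemma slide_up (r : I -> K) (e : I -> nat) : injective r ->
  (forall i j (k : nat), r i - r j = k.+1%:R -> (e j <= e i)%N) ->
  Morita_both (rprod xpredT r) (rprod xpredT (fun i => r i + (e i)%:R)).
Proof.
move=> rI re; pose M := \max_i e i.
suff H m : Morita_both (rprod xpredT r) (rprod xpredT (fun i => r i + (minn (e i) m)%:R)).
  have -> : rprod xpredT (fun i => r i + (e i)%:R) =
      rprod xpredT (fun i => r i + (minn (e i) M)%:R).
    by apply: eq_bigr => i _; rewrite (minn_idPl (leq_bigmax i)).
  exact: H.
elim: m => [|m IH].
  have -> : rprod xpredT (fun i => r i + (minn (e i) 0)%:R) = rprod xpredT r.
    by apply: eq_bigr => i _; rewrite minn0 addr0.
  have := Morita_translate (rprod xpredT r) 0 (oner_neq0 K).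
  by rewrite shp0 expr1n scale1r.
apply: (Morita_both_trans IH).
pose S i := (m < e i)%N; pose T i := ~~ (m < e i)%N.
pose p := rprod S (fun i => r i + m%:R); pose q := rprod T (fun i => r i + (e i)%:R).
have sep i j (l : nat) : S i -> T j -> (m <= l <= m.+1)%N ->
    r i + l%:R != r j + (e j)%:R.
  rewrite /S /T -leqNgt => Si Tj ml; apply/eqP => E.
  have [lej|lej] := ltnP (e j) l; last first.
    have [lej'|ejl] := ltnP l (e j); first lia.
    have el : l = e j by lia.
    by move: E; rewrite el => /addIr/rI ij; move: Si; rewrite ij; lia.
  have : r j - r i = (l - e j).-1.+1%:R.
    rewrite prednK ?subn_gt0 // natrB ?(ltnW lej) //.
    by apply/eqP; rewrite subr_eq addrAC eq_sym subr_eq addrC -E addrC.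
  by move=> /re; lia.
have e1 : rprod xpredT (fun i => r i + (minn (e i) m)%:R) = p * q.
  rewrite /rprod (bigID S) /=; congr (_ * _); apply: eq_bigr => i.
    by rewrite /S => /ltnW/minn_idPr ->.
  by rewrite /S -leqNgt => /minn_idPl ->.
have e2 : rprod xpredT (fun i => r i + (minn (e i) m.+1)%:R) =
    1 ^+ 2 *: (shp (0 - 1) p * shp 0 q).
  rewrite expr1n scale1r shp0 shp_rprod /rprod (bigID S) /=; congr (_ * _).
    apply: eq_bigr => i; rewrite /S => /minn_idPr ->.
    by rewrite sub0r opprK -addrA natr1.
  by apply: eq_bigr => i; rewrite /S -leqNgt => /leqW/minn_idPl ->.
rewrite e1 e2; apply: Morita_slide; rewrite ?oner_neq0 // ?shp_rprod.
  by apply: rprod_coprime => i j Si Tj; apply: sep => //; rewrite leqnn leqnSn.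
apply: rprod_coprime => i j Si Tj; rewrite -(inj_eq (addIr 1)) subrK -addrA natr1.
by apply: sep => //; rewrite leqnn leqnSn.
Qed.
End SlideUp.

(** A move rescales by squares, and c is one. *)
Lemma Morita_both_scale c (p : {poly K}) : c != 0 -> Morita_both (c *: p) p.
Proof.
move=> c0; have s0 : (sqrtC c)^-1 != 0 by rewrite invr_eq0 sqrtC_eq0.
have := Morita_translate (c *: p) 0 s0.
by rewrite shp0 exprVn sqrtCK scalerA mulVf // scale1r.
Qed.

Section Classes.
Variables (k : nat) (n : 'I_k -> nat) (d : forall i, 'I_(n i) -> nat).
Notation J := {i : 'I_k & 'I_(n i)}.
Notation dJ := (fun p : J => d (tagged p)).

(** Adding the increasing y to x keeps upper roots moving at least as much as
    lower ones; N makes all displacements nonnegative. By symmetry y can be slid to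
    the same place. *)
Lemma slide_to_sum (a : 'I_k -> K) (x y : forall i, 'I_(n i) -> int) (N : nat) :
  (forall i j, i != j -> ~ eq_mod_Z (a i) (a j)) ->
  (forall i (l m : 'I_(n i)), (l < m)%N -> x i l < x i m) ->
  (forall i (l m : 'I_(n i)), (l < m)%N -> y i l < y i m) ->
  (forall i l, (`|y i l| <= N)%N) ->
  Morita_both (rprod dJ xpredT (fun p => a (tag p) + (x _ (tagged p))%:~R))
    (rprod dJ xpredT (fun p => a (tag p) + (x _ (tagged p) + y _ (tagged p) + N%:Z)%:~R)).
Proof.
move=> ai xi yi yN.
pose r (p : J) : K := a (tag p) + (x _ (tagged p))%:~R.
pose e (p : J) : nat := `|(y _ (tagged p) + N%:Z)%R|%N.
have eE p : (e p)%:Z = y _ (tagged p) + N%:Z.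
  by rewrite /e; have := yN _ (tagged p); lia.
have tgE : rprod dJ xpredT (fun p => a (tag p) + (x _ (tagged p) + y _ (tagged p) + N%:Z)%:~R)
    = rprod dJ xpredT (fun p => r p + (e p)%:R).
  apply: eq_bigr => p _; rewrite /r -[(e p)%:R]/((e p)%:Z%:~R) eE.
  by rewrite !intrD !addrA.
have same p q (z : int) : r p - r q = z%:~R -> tag p = tag q.
  move=> E; apply/eqP/negPn/negP => /ai; apply.
  exists (z + x _ (tagged q) - x _ (tagged p)).
  by rewrite intrB intrD -E /r; ring.
rewrite tgE; apply: slide_up => [p q pq|p q l E].
- have st : tag p = tag q by apply: (same p q 0); apply/eqP; rewrite subr_eq0; apply/eqP.
  case: p q st pq => [i l] [j m] /= ij; case: _ / ij m => m; rewrite /r /=.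
  move=> /addrI/intr_inj xlm; congr existT; apply: val_inj => /=.
  by case: (ltngtP l m) => // /xi; rewrite xlm ltxx.
- have st : tag p = tag q by apply: (same p q l.+1).
  have : (e q)%:Z <= (e p)%:Z; last by [].
  rewrite !eE lerD2r; case: p q st E => [i l1] [j l2] /= ij; case: _ / ij l2 => l2.
  rewrite /r /= opprD addrACA subrr add0r -intrB => E.
  have {}E : x i l1 - x i l2 = l.+1 by apply: (@intr_inj K); rewrite E.
  case: (ltngtP l1 l2) => [/xi|/yi/ltW //|/val_inj -> //]; lia.
Qed.
End Classes.

Lemma type_prodE (k : nat) (n : 'I_k -> nat) (d : forall i, 'I_(n i) -> nat)
    (x : forall i, 'I_(n i) -> int) (a : 'I_k -> K) (w : 'I_k -> {poly K}) :
  (forall i, Zf_factorization (x i) (@d i) (w i)) ->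
  \prod_(i < k) (w i \Po ('X - (a i)%:P)) =
  rprod (fun p : {i & 'I_(n i)} => d _ (tagged p)) xpredT
    (fun p => a (tag p) + (x _ (tagged p))%:~R).
Proof.
move=> wE; rewrite /rprod -(sig_big_dep xpredT (fun _ => xpredT)
  (fun i l => ('X - (a i + (x i l)%:~R)%:P) ^+ d i l)) /=.
apply: eq_bigr => i _; have [_ _ ->] := wE i.
rewrite -[_ \Po _]/(_ \Po ('X - (a i)%:P)) -polyCN -/(shp _ _) shp_prod; apply: eq_bigr => l _.
rewrite /shp rmorphXn /= comp_polyB comp_polyX comp_polyC polyCN polyCD.
by rewrite opprD addrA.
Qed.

Lemma same_type_Morita (u v : {poly K}) : same_type u v -> Morita_both u v.
Proof.
move=> [k [l [a [w [b [z [j [[_ ai [c c0 ->]] [_ bi [c' c'0 ->]] jb wz]]]]]]]].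
pose T := {n : nat & (('I_n -> nat) * ('I_n -> int) * ('I_n -> int))%type}.
have /choice[f fP] : forall i, exists f : T, Zf_factorization (tagged f).1.2 (tagged f).1.1 (w i)
    /\ Zf_factorization (tagged f).2 (tagged f).1.1 (z (j i)).
  by move=> i; have [_ [n [d [x [y h]]]]] := wz i; exists (existT _ n (d, x, y)).
have /choice[m mE] : forall i, exists m : int, a i - b (j i) = m%:~R.
  by move=> i; have [] := wz i.
pose n i := tag (f i); pose d i : 'I_(n i) -> nat := (tagged (f i)).1.1.
pose x i : 'I_(n i) -> int := (tagged (f i)).1.2; pose y i : 'I_(n i) -> int := (tagged (f i)).2.
have wE i : Zf_factorization (x i) (d i) (w i) by case: (fP i).
have zE i : Zf_factorization (y i) (d i) (z (j i)) by case: (fP i).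
(* The roots of u are b + y = a + (y - m), those of v are a + x: both go to
   a + x + y + N, the former through displacements x + m + N. *)
pose N : nat := (\sum_(p : {i & 'I_(n i)}) (`|y _ (tagged p)| + `|(x _ (tagged p) + m (tag p))%R|))%N.
have hN i (q : 'I_(n i)) : (`|y i q| + `|(x i q + m i)%R| <= N)%N.
  by rewrite /N (bigD1 (existT _ i q)) //= leq_addr.
apply: Morita_both_trans (Morita_both_scale _ c'0) _.
apply: Morita_both_trans _ (Morita_both_sym (Morita_both_scale _ c0)).
have -> : \prod_(i < l) (z i \Po ('X - (b i)%:P)) =
    \prod_(i < k) (z (j i) \Po ('X - (b (j i))%:P)).
  by rewrite (reindex j) //; apply: onW_bij.
rewrite (type_prodE (fun i => b (j i)) zE) (type_prodE a wE).
apply: Morita_both_sym.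
apply: Morita_both_trans (@slide_to_sum k n d a x y N ai _ _ _) _.
- by move=> i; case: (wE i).
- by move=> i; case: (zE i).
- by move=> i q; apply: leq_trans (hN i q); exact: leq_addr.
apply: Morita_both_sym.
have := @slide_to_sum k n d (fun i => b (j i)) y (fun i q => x i q + m i) N.
have -> : rprod (fun p : {i & 'I_(n i)} => d _ (tagged p)) xpredT (fun p => b (j (tag p)) +
     (y _ (tagged p) + (x _ (tagged p) + m (tag p)) + N%:Z)%:~R) =
   rprod (fun p : {i & 'I_(n i)} => d _ (tagged p)) xpredT (fun p => a (tag p) +
     (x _ (tagged p) + y _ (tagged p) + N%:Z)%:~R).
  apply: eq_bigr => p _; congr (('X - _%:P) ^+ _).
  by rewrite -[a _](subrK (b (j (tag p)))) mE !intrD; ring.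
apply.
- by move=> i i' ii'; apply: bi; rewrite (inj_eq (bij_inj jb)).
- by move=> i; case: (zE i).
- by move=> i p q pq; rewrite ltrD2r; case: (wE i) => + _ _; apply.
- by move=> i q; apply: leq_trans (hN i q); exact: leq_addl.
Qed.
End Slides.

(** * Recovering the type from the tails *)

Section IntegerTails.
Variable K : fieldType.
Implicit Types (S T : seq int) (n : int).

Definition above n S : nat := count (fun k => n < k) S.

Lemma above_le n S : (above n S <= size S)%N.
Proof. exact: count_size. Qed.

Lemma exists_min S : (0 < size S)%N -> exists2 x, x \in S & forall y, y \in S -> x <= y.
Proof.
elim: S => // x [|y S] IH _.
  by exists x; rewrite ?mem_head // => z; rewrite inE => /eqP ->.
have [//|m mS mP] := IH; have [xm|mx] := leP x m.
  exists x; rewrite ?mem_head // => z; rewrite inE => /orP[/eqP -> //|/mP].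
  exact: le_trans.
exists m; first by rewrite inE mS orbT.
by move=> z; rewrite inE => /orP[/eqP ->|/mP //]; apply: ltW.
Qed.

Lemma above_all S : exists n, above n S = size S.
Proof.
case: (posnP (size S)) => [S0|/exists_min[x _ xP]].
  by exists 0; apply/eqP; rewrite eqn_leq above_le S0.
exists (x - 1); apply/eqP; rewrite -all_count; apply/allP => y /xP /=.
by rewrite ltrBlDr ltzD1.
Qed.

Definition same_tails S T :=
  (forall n, exists m, above m T = above n S) /\ (forall n, exists m, above m S = above n T).

Lemma same_tails_size S T : same_tails S T -> size S = size T.
Proof.
have le A B : (forall n, exists m, above m B = above n A) -> (size A <= size B)%N.
  by move=> AB; have [n <-] := above_all A; have [m <-] := AB n; exact: above_le.
by move=> [ST TS]; apply/eqP; rewrite eqn_leq !le.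
Qed.

(** Removing the lowest block removes the largest tail and no other. *)
Lemma above_rem S x : x \in S -> (forall y, y \in S -> x <= y) ->
  let S1 := [seq y <- S | y != x] in
  [/\ (size S = count_mem x S + size S1)%N, (0 < count_mem x S)%N,
      forall n, above n S1 = above (Num.max n x) S &
      forall n, (above n S < size S)%N -> above n S1 = above n S].
Proof.
move=> xS xP S1.
have aS n : above n S1 = above (Num.max n x) S.
  rewrite /above count_filter; apply: eq_in_count => y /xP xy /=.
  by rewrite gt_max [x < y]lt_neqAle xy andbT [x == y]eq_sym.
split=> //.
- by rewrite size_filter -(count_predC (pred1 x) S).
- by rewrite -has_count has_pred1.
- move=> n nS; rewrite aS; case: (leP x n) => [//|nx].
  suff E : above n S = size S by rewrite E ltnn in nS.
  apply/eqP; rewrite -all_count; apply/allP => y /xP /=; exact: lt_le_trans.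
Qed.

Lemma prod_min_block S x : \prod_(n <- S) ('X - (n%:~R)%:P : {poly K}) =
  ('X - (x%:~R)%:P) ^+ count_mem x S * \prod_(n <- [seq y <- S | y != x]) ('X - (n%:~R)%:P).
Proof.
rewrite (bigID (pred1 x)) /= big_filter; congr (_ * _).
rewrite (eq_bigr (fun=> 'X - (x%:~R)%:P)) => [|i /eqP -> //].
by rewrite big_const_seq iter_mulr_1.
Qed.

(** The tails of S are the partial sums, from the top, of its multiplicities.
    Peeling off the lowest block, whose multiplicity is the difference between the
    two largest tails, gives the positions and multiplicities by induction. *)
Lemma same_tails_factorization S T : same_tails S T ->
  exists (n : nat) (d : 'I_n -> nat) (x y : 'I_n -> int),
    [/\ Zf_factorization x d (\prod_(n <- S) ('X - (n%:~R)%:P : {poly K})),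
        Zf_factorization y d (\prod_(n <- T) ('X - (n%:~R)%:P : {poly K})),
        forall i, x i \in S & forall i, y i \in T].
Proof.
move: {2}(size S) (leqnn (size S)) => N; elim: N S T => [|N IH] S T SN ST.
  have S0 : size S = 0%N by apply/eqP; rewrite -leqn0.
  have T0 : size T = 0%N by rewrite -(same_tails_size ST).
  move: S0 T0 => /size0nil -> /size0nil ->.
  have f0 (A : Type) : 'I_0 -> A by case.
  exists 0, (f0 _), (f0 _), (f0 _); split; try by case.
  - by split; try case; rewrite ?big_nil ?big_ord0.
  - by split; try case; rewrite ?big_nil ?big_ord0.
have [S0|Sgt] := posnP (size S); first by apply: IH => //; rewrite S0.
have eST := same_tails_size ST.
have [x xS xP] := exists_min Sgt.
have [|y yT yP] := @exists_min T; first by rewrite -eST.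
have [sS cS aS lS] := above_rem xS xP; have [sT cT aT lT] := above_rem yT yP.
move: sS aS lS sT aT lT.
set S1 := [seq z <- S | z != x]; set T1 := [seq z <- T | z != y] => sS aS lS sT aT lT.
have ST1 : same_tails S1 T1.
  have s1 n : (above n S1 < size S)%N.
    by apply: leq_ltn_trans (above_le n S1) _; rewrite sS -[X in (X < _)%N]add0n ltn_add2r.
  have t1 n : (above n T1 < size T)%N.
    by apply: leq_ltn_trans (above_le n T1) _; rewrite sT -[X in (X < _)%N]add0n ltn_add2r.
  case: ST => h1 h2; split=> n.
    have [m e] := h1 (Num.max n x); exists m; rewrite aS -e; apply: lT.
    by rewrite e -aS -eST s1.
  have [m e] := h2 (Num.max n y); exists m; rewrite aT -e; apply: lS.
  by rewrite e -aT eST t1.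
have [|n [d [f [g [[fI d0 fE] [gI _ gE] fS gT]]]]] := IH S1 T1 _ ST1.
  by rewrite -ltnS; apply: leq_trans SN; rewrite sS -[X in (X < _)%N]add0n ltn_add2r.
have ecount : count_mem x S = count_mem y T.
  by apply/eqP; rewrite -(eqn_add2r (size S1)) -sS eST sT (same_tails_size ST1).
pose ext (A : Type) (a0 : A) (h : 'I_n -> A) (i : 'I_n.+1) : A :=
  if unlift ord0 i is Some j then h j else a0.
have ext0 A a0 h : ext A a0 h ord0 = a0 by rewrite /ext unlift_none.
have extS A a0 h j : ext A a0 h (lift ord0 j) = h j by rewrite /ext liftK.
have incr (z : int) (h : 'I_n -> int) (U : seq int) : (forall y, y \in U -> z <= y) ->
    (forall i, h i \in [seq y <- U | y != z]) ->
    (forall i j : 'I_n, (i < j)%N -> h i < h j) ->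
    forall i j : 'I_n.+1, (i < j)%N -> ext _ z h i < ext _ z h j.
  move=> zP hU hI i j; case: (unliftP ord0 i) => [i'|] ->; case: (unliftP ord0 j) => [j'|] -> //.
    by rewrite !extS => ij; apply: hI; move: ij; rewrite !lift0.
  rewrite ext0 extS => _; have := hU j'; rewrite mem_filter => /andP[hz /zP].
  by rewrite le_eqVlt eq_sym (negbTE hz).
have mem (z : int) (h : 'I_n -> int) (U : seq int) : z \in U ->
    (forall i, h i \in [seq y <- U | y != z]) -> forall i, ext _ z h i \in U.
  move=> zU hU i; case: (unliftP ord0 i) => [i'|] ->; rewrite ?ext0 ?extS //.
  by have := hU i'; rewrite mem_filter => /andP[].
exists n.+1, (ext _ (count_mem x S) d), (ext _ x f), (ext _ y g); split.
- split; first exact: incr xP fS fI.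
    by move=> i; case: (unliftP ord0 i) => [i'|] ->; rewrite ?ext0 ?extS.
  rewrite (prod_min_block S x) -/S1 fE big_ord_recl !ext0; congr (_ * _).
  by apply: eq_bigr => i _; rewrite !extS.
- split; first exact: incr yP gT gI.
    by move=> i; case: (unliftP ord0 i) => [i'|] ->; rewrite ?ext0 ?extS.
  rewrite (prod_min_block T y) -/T1 gE big_ord_recl !ext0 ecount; congr (_ * _).
  by apply: eq_bigr => i _; rewrite !extS.
- exact: mem.
- exact: mem.
Qed.
End IntegerTails.

Section TypeOfTails.
Variable K : numClosedFieldType.
Implicit Types (a c z : K) (r : seq K).

Lemma eq_mod_Z_sym a c : eq_mod_Z a c -> eq_mod_Z c a.
Proof. by move=> [n e]; exists (- n); rewrite mulrNz -e opprB. Qed.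
Lemma eq_mod_Z_trans a c z : eq_mod_Z a c -> eq_mod_Z c z -> eq_mod_Z a z.
Proof. by move=> [n e] [m e']; exists (n + m); rewrite intrD -e -e' addrA subrK. Qed.

Definition offset a z : option int :=
  if pselect (exists n : int, z = a + n%:~R) is left h then Some (projT1 (cid h)) else None.

Lemma offsetP a z n : z = a + n%:~R <-> offset a z = Some n.
Proof.
rewrite /offset; case: pselect => [h|nh]; last first.
  by split=> // e; case: nh; exists n.
case: cid => m /= ->; split=> [/addrI/intr_inj -> //|[->] //].
Qed.

Lemma offset_none a z : ~ eq_mod_Z z a -> offset a z = None.
Proof.
case E: (offset a z) => [n|//] []; exists n.
by move/offsetP: E => ->; rewrite addrAC subrr add0r.
Qed.

Definition offsets a r : seq int := pmap (offset a) r.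

Lemma tail_offsets r a n : tail r a n = above n (offsets a r).
Proof.
rewrite /tail /above /offsets; elim: r => //= z r ->.
case E: (offset a z) => [k|] /=; last first.
  suff -> : beyond a n z = false by [].
  apply/negbTE/negP => /asboolP[k zk _].
  by move/offsetP: zk; rewrite E.
congr (nat_of_bool _ + _)%N; apply/asboolP/idP => [[l]|nk].
  by move/offsetP; rewrite E => -[->].
by exists k => //; apply/offsetP.
Qed.

Lemma class_representatives r : exists s : seq K,
  [/\ forall z, z \in r -> exists2 a, a \in s & eq_mod_Z z a,
      forall a, a \in s -> a \in r &
      forall i j, (i < size s)%N -> (j < size s)%N -> i != j -> ~ eq_mod_Z s`_i s`_j].
Proof.
elim: r => [|z r [s [s1 s2 s3]]]; first by exists [::].
have [[a as_ za]|nz] := pselect (exists2 a, a \in s & eq_mod_Z z a).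
  exists s; split=> // [y|a' /s2 a'r]; last by rewrite inE a'r orbT.
  by rewrite inE => /orP[/eqP -> |/s1 //]; exists a.
exists (z :: s); split=> [y|a|].
- rewrite inE => /orP[/eqP ->|/s1[a as_ ya]].
    by exists z; rewrite ?mem_head //; exists 0; rewrite subrr.
  by exists a => //; rewrite inE as_ orbT.
- by rewrite !inE => /orP[-> //|/s2 ->]; rewrite orbT.
- move=> [|i] [|j] //= hi hj ij.
  + by move=> zs; apply: nz; exists s`_j => //; exact: mem_nth.
  + by move=> /eq_mod_Z_sym zs; apply: nz; exists s`_i => //; exact: mem_nth.
  + exact: s3.
Qed.

(** Each z contributes X - z to the factor of its own class and 1 to the others. *)
Lemma prod_offsets (k : nat) (a : 'I_k -> K) r :
  (forall i j, i != j -> ~ eq_mod_Z (a i) (a j)) ->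
  (forall z, z \in r -> exists i, eq_mod_Z z (a i)) ->
  \prod_(i < k) ((\prod_(n <- offsets (a i) r) ('X - (n%:~R)%:P)) \Po ('X - (a i)%:P)) =
  \prod_(z <- r) ('X - z%:P).
Proof.
move=> ai; elim: r => [|z r IH] ra.
  by rewrite big_nil big1 // => i _; rewrite big_nil comp_polyC.
rewrite big_cons -IH; last by move=> y yr; apply: ra; rewrite inE yr orbT.
have [i0 [n0 zi0]] := ra z (mem_head _ _).
have off0 : offset (a i0) z = Some n0 by apply/offsetP; rewrite -zi0 addrC subrK.
rewrite (bigD1 i0) //= [in RHS](bigD1 i0) //= mulrA; congr (_ * _).
  rewrite /offsets /= off0 /= big_cons comp_polyM; congr (_ * _).
  rewrite comp_polyB comp_polyX comp_polyC -addrA -opprD -polyCD.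
  by rewrite -zi0 [a i0 + _]addrC subrK.
apply: eq_bigr => i ii0; rewrite /offsets /= offset_none // => zi.
by apply: (ai i i0 ii0); apply: eq_mod_Z_trans (eq_mod_Z_sym zi) _; exists n0.
Qed.

(** In each class the integers by which the roots of u and of v differ from a
    representative have the same tails. A class in which v has no root has only
    the tail 0, so u has none there either, and the representatives chosen for v
    serve for u. *)
Lemma same_type_of_tails (u v : {poly K}) : u != 0 -> v != 0 ->
  (forall c, (forall n, exists m, tail (rootseq u) c m = tail (rootseq v) c n) /\
    (forall n, exists m, tail (rootseq v) c m = tail (rootseq u) c n)) ->
  same_type u v.
Proof.
move=> u0 v0 uv; have [s [s1 s2 s3]] := class_representatives (rootseq v).
have same c : same_tails (offsets c (rootseq v)) (offsets c (rootseq u)).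
  case: (uv c) => h1 h2; split=> n.
    by have [m e] := h1 n; exists m; rewrite -!tail_offsets.
  by have [m e] := h2 n; exists m; rewrite -!tail_offsets.
pose a (i : 'I_(size s)) := s`_i.
pose w r (i : 'I_(size s)) : {poly K} := \prod_(n <- offsets (a i) r) ('X - (n%:~R)%:P).
have ai i j : i != j -> ~ eq_mod_Z (a i) (a j) by move=> ij; apply: s3.
have wtype p : p != 0 -> (forall i, size (offsets (a i) (rootseq p)) != 0%N) ->
    (forall z, z \in rootseq p -> exists i, eq_mod_Z z (a i)) ->
    type_factorization a (w (rootseq p)) p.
  move=> p0 ne cov; split=> // [i|].
    split; first by exists (offsets (a i) (rootseq p)).
    by rewrite /w -(big_map (fun n : int => n%:~R : K) xpredT (fun x => 'X - x%:P))
      size_prod_XsubC size_map; have := ne i; lia.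
  exists (lead_coef p); rewrite ?lead_coef_eq0 //.
  by rewrite (prod_offsets ai cov); exact: rootseqE.
have nev i : size (offsets (a i) (rootseq v)) != 0%N.
  have av : a i \in rootseq v by apply/s2/mem_nth.
  have : 0 \in offsets (a i) (rootseq v).
    by rewrite mem_pmap; apply/mapP; exists (a i) => //; apply/esym/offsetP; rewrite addr0.
  by case: (offsets _ _).
have covv z : z \in rootseq v -> exists i, eq_mod_Z z (a i).
  move=> /s1[b bs zb]; have bi : (index b s < size s)%N by rewrite index_mem.
  by exists (Ordinal bi); rewrite /a /= nth_index.
have covu z : z \in rootseq u -> exists i, eq_mod_Z z (a i).
  move=> zu; have := same_tails_size (same z).
  have : 0 \in offsets z (rootseq u).
    by rewrite mem_pmap; apply/mapP; exists z => //; apply/esym/offsetP; rewrite addr0.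
  case E: (offsets z (rootseq v)) => [|n t]; first by case: (offsets _ _).
  have : n \in offsets z (rootseq v) by rewrite E mem_head.
  rewrite mem_pmap => /mapP[y yv /esym/offsetP yz] _ _.
  have [i yi] := covv _ yv; exists i; apply: eq_mod_Z_trans yi.
  by exists (- n); rewrite yz opprD addrA subrr add0r mulrNz.
have neu i : size (offsets (a i) (rootseq u)) != 0%N.
  by rewrite -(same_tails_size (same (a i))).
exists (size s), (size s), a, (w (rootseq v)), a, (w (rootseq u)), id; split.
- exact: wtype.
- exact: wtype.
- by exists id.
- move=> i; split; first by exists 0; rewrite subrr.
  have [n [d [x [y [h1 h2 _ _]]]]] := same_tails_factorization K (same (a i)).
  by exists n, d, x, y.
Qed.

Lemma tail_shp (mu : K) w c n : w != 0 ->
  tail (rootseq (shp mu w)) c n = tail (rootseq w) (c + mu) n.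
Proof.
move=> w0; have w0' : shp mu w != 0 by rewrite shp_eq0.
have /permP pe : perm_eq (rootseq w) [seq z + mu | z <- rootseq (shp mu w)].
  apply/allP => z _ /=; apply/eqP; rewrite -mup_rootseq // count_map.
  rewrite -[z in LHS](subrK mu) -mup_shp // mup_rootseq //; apply: eq_count => y /=.
  by rewrite -[in RHS](inj_eq (addIr (- mu))) addrK.
rewrite /tail pe count_map; apply: eq_count => z /=; apply: asbool_equiv_eq.
split=> -[k e nk]; exists k => //; first by rewrite e addrAC.
by apply: (addIr mu); rewrite e addrAC.
Qed.

Theorem Morita_same_type (v1 v2 : {poly K}) : v1 != 0 -> v2 != 0 ->
  strongly_graded_Morita_equivalent (GWA v1) (GWA v2) <->
  exists b : K, same_type (v1 \Po ('X + b%:P)) v2.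
Proof.
move=> v10 v20; split=> [/(Morita_tails v10 v20)[mu muP]|[b]].
  exists (- mu); apply: same_type_of_tails => //; first by rewrite shp_eq0.
  move=> c; have [h1 h2] := muP (c - mu); split=> n.
    have [m e] := h1 n; exists m; move: e; rewrite !tail_shp // subrK.
    exact.
  have [m e] := h2 n; exists m; move: e; rewrite !tail_shp // subrK.
  exact.
move=> /same_type_Morita[h _].
have [h' _] := Morita_translate v1 b (oner_neq0 K); move: h'.
by rewrite expr1n scale1r => h'; exact: Morita_trans h' h.
Qed.
End TypeOfTails.

Theorem theorem4p8 (R : realType) (v1 v2 : {poly R[i]})
    (hv1 : v1 != 0) (hv2 : v2 != 0) :
  strongly_graded_Morita_equivalent (GWA v1) (GWA v2) <->
  exists b : R[i], same_type (v1 \Po ('X + b%:P)) v2.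
Proof. exact: Morita_same_type. Qed.
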